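(* Let $s\in(0,1)$ and $\Omega=\mathbb{R}^n$. For $t>0$, $\varepsilon>0$ and measurable $E\subset\mathbb{R}^n$ with $\chi_E\in L^1(\mathbb{R}^n)$, let $$\mathscr{G}^s_\varepsilon(E)=P(E)-t\,\varepsilon^{-s}\int_{\mathbb{R}^n}\chi_E(1-\phi_E^\varepsilon)\,dx,$$ where $\phi_E^\varepsilon$ is the unique bounded solution of $\phi+\varepsilon^s(-\Delta)^{s/2}\phi=\chi_E$ in $\mathbb{R}^n$. Then, for all $t>0$, the functional $\mathscr{G}^s_\varepsilon$ $\Gamma$-converges, when $\varepsilon\to0$, to $$\mathscr{G}^s_0(E)=P(E)-t\,c_{n,s}P_s(E).$$
   Context: $\chi_E$ is the characteristic function of $E$; $P(E)=\int_{\mathbb{R}^n}|D\chi_E|\in[0,\infty]$ is the perimeter. Further, $$(-\Delta)^{s/2}u(x)=c_{n,s}\,\mathrm{P.V.}\int_{\mathbb{R}^n}\frac{u(x)-u(y)}{|x-y|^{n+s}}\,dy,\qquad c_{n,s}=\frac{2^s\Gamma\left(\frac{n+s}{2}\right)}{\pi^{n/2}|\Gamma(-\frac s2)|},$$ $$P_s(E)=\frac12\int_{\mathbb{R}^n}\int_{\mathbb{R}^n}\frac{|\chi_E(x)-\chi_E(y)|}{|x-y|^{n+s}}\,dx\,dy .$$ Convention: $\mathscr{G}^s_\varepsilon(E)=\mathscr{G}^s_0(E)=+\infty$ when $P(E)=\infty$. $\Gamma$-convergence of $\mathscr{G}_\varepsilon$ to $\mathscr{G}_0$ (with respect to $L^1(\mathbb{R}^n)$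 convergence of characteristic functions) means: for every family $E_\varepsilon\to E$ in $L^1$, $\liminf_{\varepsilon\to0}\mathscr{G}_\varepsilon(E_\varepsilon)\ge\mathscr{G}_0(E)$; and for every $E$ there is a family $E_\varepsilon\to E$ in $L^1$ with $\limsup_{\varepsilon\to0}\mathscr{G}_\varepsilon(E_\varepsilon)\le\mathscr{G}_0(E)$. *)

(* Defs.v *)
(* R^n is the type 'rV[R]_n of row vectors over R : realType. *)
From HB Require Import structures.
From mathcomp Require Import all_boot all_order all_algebra.
From mathcomp Require Import all_classical all_reals all_analysis.
Set Implicit Arguments.
Unset Strict Implicit.
Unset Printing Implicit Defensive.
Import Order.TTheory GRing.Theory Num.Theory.
Import numFieldNormedType.Exports.
Local Open Scope classical_set_scope.
Local Open Scope ring_scope.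

Definition row_display : measure_display. Proof. exact: default_measure_display. Qed.

Section measurable_row.
Context {R : realType}.
Variable n : nat.

Let coord (i : 'I_n) (x : 'rV[R]_n) : R := x ord0 i.

Let row_set0 : g_sigma_preimage coord set0.
Proof. exact: sigma_algebra0. Qed.

Let row_setC A : g_sigma_preimage coord A -> g_sigma_preimage coord (~` A).
Proof. exact: sigma_algebraC. Qed.

Let row_bigcup (F : (set 'rV[R]_n)^nat) :
  (forall i, g_sigma_preimage coord (F i)) ->
  g_sigma_preimage coord (\bigcup_i (F i)).
Proof. exact: sigma_algebra_bigcup. Qed.

HB.instance Definition _ := @isMeasurable.Build row_display
  'rV[R]_n (g_sigma_preimage coord) row_set0 row_setC row_bigcup.

Lemma measurable_coord (i : 'I_n) :
  measurable_fun [set: 'rV[R]_n] (fun x => x ord0 i).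
Proof.
move=> _ Y mY; rewrite setTI; apply: sub_sigma_algebra => /=.
rewrite -bigcup_seq/=; exists i => /=; first by rewrite mem_index_enum.
by exists Y => //; rewrite setTI.
Qed.

Lemma measurable_fun_row d (T : measurableType d) (f : T -> 'rV[R]_n) :
  (forall i, measurable_fun [set: T] (fun t => f t ord0 i)) ->
  measurable_fun [set: T] f.
Proof.
move=> mf _ Y mY.
suff : g_sigma_preimage coord `<=` [set A | measurable (f @^-1` A)].
  by move=> h; rewrite setTI; exact: h.
apply: smallest_sub.
  split => [|A|A] /=; first by rewrite preimage_set0.
  - by rewrite setTD preimage_setC => ?; exact: measurableC.
  - by move=> mA; rewrite preimage_bigcup; exact: bigcupT_measurable.
rewrite -bigcup_seq/= => A [i _] [B mB <-] /=; rewrite setTI.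
by rewrite -[X in measurable X]setTI; exact: mf.
Qed.

End measurable_row.

Section row_product.
Context {R : realType} {n : nat}.

Definition row_cons (p : R * 'rV[R]_n) : 'rV[R]_n.+1 :=
  row_mx (p.1%:M : 'rV_1) p.2.

Definition row_uncons (x : 'rV[R]_n.+1) : R * 'rV[R]_n :=
  (x ord0 ord0, rsubmx (x : 'rV_(1 + n))).

Lemma row_consK : cancel row_cons row_uncons.
Proof.
case=> a v; rewrite /row_uncons /row_cons /=; congr pair; last exact: row_mxKr.
have h : row_mx (a%:M : 'rV_1) v ord0 (lshift n (ord0 : 'I_1)) = a.
  by rewrite row_mxEl mxE.
by rewrite -[RHS]h; congr (row_mx _ _ _ _); exact/val_inj.
Qed.

Lemma measurable_row_cons : measurable_fun setT row_cons.
Proof.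
apply: measurable_fun_row => i; rewrite -[i]/(i : 'I_(1 + n)).
case: (split_ordP (i : 'I_(1 + n))) => j ->.
- rewrite [X in measurable_fun _ X](_ : _ = fst) //.
  apply/funext => p; rewrite /row_cons.
  by rewrite (row_mxEl (p.1%:M : 'rV_1) p.2 ord0 j) mxE (ord1 j).
- rewrite [X in measurable_fun _ X](_ : _ = (fun x : 'rV_n => x ord0 j) \o snd).
    by apply: measurableT_comp => //; exact: measurable_coord.
  by apply/funext => p; exact: (row_mxEr (p.1%:M : 'rV_1) p.2 ord0 j).
Qed.

Lemma measurable_row_uncons : measurable_fun setT row_uncons.
Proof.
apply: (measurable_fun_pair (f := fun x : 'rV[R]_n.+1 => x ord0 ord0)
  (g := fun x : 'rV[R]_n.+1 => rsubmx (x : 'rV_(1 + n)))).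
  exact: measurable_coord.
apply: measurable_fun_row => i.
rewrite [X in measurable_fun _ X](_ : _ = fun x : 'rV[R]_n.+1 => x ord0 (rshift 1 i)).
  exact: measurable_coord.
by apply/funext => x; rewrite mxE.
Qed.

Variable m : {sigma_finite_measure set 'rV[R]_n -> \bar R}.

Definition row_product_measure : set 'rV[R]_n.+1 -> \bar R :=
  pushforward (@lebesgue_measure R \x m)%E row_cons.

Let rpm0 : row_product_measure set0 = 0%E.
Proof. by rewrite /row_product_measure /pushforward preimage_set0 measure0. Qed.

Let rpm_ge0 A : (0 <= row_product_measure A)%E.
Proof. exact: (measure_ge0 (@lebesgue_measure R \x m)%E). Qed.

Let rpm_sigma_additive : semi_sigma_additive row_product_measure.
Proof.
have mpre (A : set 'rV[R]_n.+1) : measurable A -> measurable (row_cons @^-1` A).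
  by move=> mA; rewrite -[X in measurable X]setTI; exact: measurable_row_cons.
move=> F mF tF mUF; rewrite /row_product_measure /pushforward preimage_bigcup.
apply: measure_semi_sigma_additive; first by move=> k; exact: mpre.
- apply/trivIsetP => /= i j _ _ ij; rewrite -preimage_setI.
  by move/trivIsetP : tF => /(_ _ _ _ _ ij) ->//; rewrite preimage_set0.
- by rewrite -preimage_bigcup; exact: mpre.
Qed.

HB.instance Definition _ := isMeasure.Build _ _ _ row_product_measure
  rpm0 rpm_ge0 rpm_sigma_additive.

Let rpm_sigma_finite : sigma_finite setT row_product_measure.
Proof.
have /sigma_finiteP[F [TF ndF Foo]] := sigma_finiteT (@lebesgue_measure R).
have /sigma_finiteP[G [TG ndG Goo]] := sigma_finiteT m.
have FGT : \bigcup_k (F k `*` G k) = setT.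
  apply/seteqP; split => // -[x y] _.
  have [i _ Fix] : (\bigcup_k F k) x by rewrite -TF.
  have [j _ Gjy] : (\bigcup_k G k) y by rewrite -TG.
  exists (maxn i j) => //; split => /=.
  - by move: x Fix; exact/subsetPset/ndF/leq_maxl.
  - by move: y Gjy; exact/subsetPset/ndG/leq_maxr.
exists (fun k => row_uncons @^-1` (F k `*` G k)).
  by rewrite -preimage_bigcup FGT preimage_setT.
move=> k; have [mF Fk] := Foo k; have [mG Gk] := Goo k; split.
  rewrite -[X in measurable X]setTI; apply: measurable_row_uncons => //.
  exact: measurableX.
rewrite /row_product_measure /pushforward -comp_preimage.
rewrite (_ : row_uncons \o row_cons = id) ?preimage_id; last first.
  by apply/funext => p; exact: row_consK.
by rewrite product_measure1E// lte_mul_pinfty// ge0_fin_numE.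
Qed.

HB.instance Definition _ := @Measure_isSigmaFinite.Build _ _ _
  row_product_measure rpm_sigma_finite.

End row_product.

Fixpoint borel_lebesgue (R : realType) (n : nat) :
    {sigma_finite_measure set 'rV[R]_n -> \bar R} :=
  match n with
  | 0 => \d_(0 : 'rV[R]_0)
  | n'.+1 => row_product_measure (borel_lebesgue R n')
  end.

(* R^n with its sigma-algebra of Lebesgue (not only Borel) measurable sets. *)
Definition lebRn (R : realType) (n : nat) :=
  caratheodory_type (borel_lebesgue R n)^*%mu.

Definition leb (R : realType) (n : nat) : set (lebRn R n) -> \bar R :=
  @completed_measure_extension _ _ _ (borel_lebesgue R n).

HB.instance Definition _ (R : realType) (n : nat) := Measure.on (@leb R n).

HB.instance Definition _ (R : realType) (n : nat) :=
  @Measure_isSigmaFinite.Build _ _ _ (@leb R n)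
    (completed_measure_extension_sigma_finite
       (sigma_finiteT (borel_lebesgue R n))).

Arguments leb {R n}.

Section calculus.
Context {R : realType} {n : nat}.

(* The library norm of 'rV[R]_n is the sup norm. *)
Definition enorm (x : 'rV[R]_n) : R := Num.sqrt (\sum_(i < n) x ord0 i ^+ 2).

Definition partial (i : 'I_n) (f : 'rV[R]_n -> R) : 'rV[R]_n -> R :=
  fun x => 'D_(delta_mx ord0 i) f x.

Fixpoint Ck (k : nat) (f : 'rV[R]_n -> R) : Prop :=
  match k with
  | 0 => continuous f
  | k'.+1 => (forall x, differentiable f x) /\ forall i, Ck k' (partial i f)
  end.

Definition compactly_supported (V : zmodType) (f : 'rV[R]_n -> V) :=
  compact (closure [set x | f x != 0]).

Definition test_function (f : 'rV[R]_n -> R) :=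
  (forall k, Ck k f) /\ compactly_supported f.

Definition divergence (X : 'rV[R]_n -> 'rV[R]_n) (x : 'rV[R]_n) : R :=
  \sum_(i < n) partial i (fun y => X y ord0 i) x.

Definition test_field (X : 'rV[R]_n -> 'rV[R]_n) :=
  [/\ forall i, Ck 1 (fun y => X y ord0 i), compactly_supported X
    & forall x, enorm (X x) <= 1].

(* The total variation of the distributional gradient of the characteristic
   function of E. *)
Definition perimeter (E : set 'rV[R]_n) : \bar R :=
  ereal_sup [set (\int[leb]_(x in E) divergence X x)%:E | X in test_field].

End calculus.

Section fractional.
Context {R : realType}.

(* Euler's integral for 0 < x; otherwise k iterations of
   Gamma(x) = Gamma(x + 1) / x, with k large enough that 0 < x + k. *)
Definition euler_integral (x : R) : R :=
  \int[lebesgue_measure]_(u in `]0, +oo[) (u `^ (x - 1) * expR (- u)).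

Definition Gamma (x : R) : R :=
  if 0 < x then euler_integral x
  else let k := (Num.truncn `|x|).+1 in
       euler_integral (x + k%:R) / \prod_(i < k) (x + i%:R).

Context {n : nat}.

Definition frac_const (s : R) : R :=
  2 `^ s * Gamma ((n%:R + s) / 2) /
  (pi `^ (n%:R / 2) * `|Gamma (- (s / 2))|).

(* The operator of order s, i.e. the power s/2 of - Delta. *)
Definition frac_laplacian (s : R) (u : 'rV[R]_n -> R) (x : 'rV[R]_n) : R :=
  frac_const s *
  lim ((\int[leb]_(y in [set y | r < enorm (x - y)])
          ((u x - u y) / enorm (x - y) `^ (n%:R + s))) @[r --> 0^'+]).

Definition frac_perimeter (s : R) (E : set 'rV[R]_n) : \bar R :=
  (2^-1%:E * \int[leb]_x \int[leb]_y
     (`|\1_E x - \1_E y| / enorm (x - y) `^ (n%:R + s))%:E)%E.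

(* Bounded solutions of phi + eps^s (-Delta)^(s/2) phi = chi_E, in the sense of
   distributions: chi_E is discontinuous, so the equation cannot be asked at
   every point, and asking it only almost everywhere would not determine phi. *)
Definition bounded_solution (s eps : R) (E : set 'rV[R]_n)
    (phi : 'rV[R]_n -> R) :=
  [/\ measurable_fun [set: lebRn R n] (phi : lebRn R n -> R),
      exists M, forall x, `|phi x| <= M
    & forall psi, test_function psi ->
        \int[leb]_x (phi x * (psi x + eps `^ s * frac_laplacian s psi x)) =
        \int[leb]_x (\1_E x * psi x)].

(* The bounded solution is unique up to a null set, which the integral in
   [energy] does not see. *)
Definition potential (s eps : R) (E : set 'rV[R]_n) : 'rV[R]_n -> R :=
  get (bounded_solution s eps E).

(* The test on the perimeter is the convention that both energies are +oo on
   sets of infinite perimeter; it matters in [limit_energy], where the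
   fractional perimeter may be infinite too. *)
Definition energy (s t eps : R) (E : set 'rV[R]_n) : \bar R :=
  if perimeter E == +oo%E then +oo%E else
  (perimeter E -
   (t * eps `^ (- s) * \int[leb]_x (\1_E x * (1 - potential s eps E x)))%:E)%E.

Definition limit_energy (s t : R) (E : set 'rV[R]_n) : \bar R :=
  if perimeter E == +oo%E then +oo%E else
  (perimeter E - (t * frac_const s)%:E * frac_perimeter s E)%E.

End fractional.

Section gamma_convergence.
Context {R : realType} {n : nat}.

(* In particular E is Lebesgue measurable. *)
Definition L1_set (E : set 'rV[R]_n) :=
  leb.-integrable [set: lebRn R n] (EFin \o \1_E).

(* Only the indices eps > 0 matter. *)
Definition L1_cvg (F : R -> set 'rV[R]_n) (E : set 'rV[R]_n) :=
  [/\ forall eps, 0 < eps -> L1_set (F eps), L1_set E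
    & (\int[leb]_x (`|\1_(F eps) x - \1_E x|)%:E)%E @[eps --> 0^'+] --> 0%E].

Definition Gamma_converges (G : R -> set 'rV[R]_n -> \bar R)
    (G0 : set 'rV[R]_n -> \bar R) :=
  (forall F E, L1_cvg F E ->
     (G0 E <= limf_einf (fun eps => G eps (F eps)) 0^'+)%E) /\
  (forall E, L1_set E -> exists F, L1_cvg F E /\
     (limf_esup (fun eps => G eps (F eps)) 0^'+ <= G0 E)%E).

End gamma_convergence.

(* Main.v *)
(* On test functions (-Delta)^(s/2) is c L, where L is the singular integral with
   kernel |h|^(-n-s); of c = c_{n,s} only the sign matters. Truncating the kernel
   to |h| > r makes L bounded, and phi + beta L phi = chi_E, with beta = eps^s c,
   is then solved by monotone iteration. The solutions converge in L^1 as r -> 0,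
   because ||chi_E(. + h) - chi_E||_1 <= |h| P(E) makes the near part of the
   kernel contribute only O(r^(1-s)). Bounded solutions are unique by the maximum
   principle applied to their convolutions with test functions.

   Testing the equation with chi_E gives
   c P_s(E) - eps^(-s) int chi_E (1 - phi) = c int (L chi_E) (chi_E - phi) >= 0,
   hence G_eps >= G_0, and the right-hand side tends to 0 with eps because
   ||chi_E - phi||_1 <= 2 beta P_s(E): constant families are recovery families.
   The liminf inequality is then the lower semicontinuity of G_0: the near part
   of P_s is a small multiple of the perimeter, the far part is L^1-continuous. *)
From HB Require Import structures.
Require Import Defs.
From mathcomp Require Import all_boot all_order all_algebra.
From mathcomp Require Import all_classical all_reals all_analysis.
From mathcomp Require Import measurable_realfun.
From mathcomp Require Import ring lra.
Set Implicit Arguments.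
Unset Strict Implicit.
Unset Printing Implicit Defensive.
Import Order.TTheory GRing.Theory Num.Theory.
Import numFieldNormedType.Exports.
Local Open Scope classical_set_scope.
Local Open Scope ring_scope.

(** * Lebesgue measure on row vectors *)

(** The statement concerns Lebesgue sets and an arbitrarily chosen bounded solution, while the
    convolution calculus is carried out for Borel functions. Every set is therefore exchanged for a
    Borel set that differs from it by a null set, and the existence part produces a Borel solution.
    A competing solution is only Lebesgue measurable, so uniqueness pairs it with Borel functions
    through a map [g], and what is shown to be determined is the number int chi_E (1 - phi), which
    is all that the energy sees.

    The limit r -> 0 rests on ||phi(. + h) - phi||_1 <= ||chi_E(. + h) - chi_E||_1 for the truncated
    problems. The truncated operator commutes with translations, and phi + beta L phi controls phi
    in L^1, because the mass of the kernel is at once the coefficient of the diagonal term and the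
    L^1 norm of the convolution. So phi inherits the modulus of chi_E with a constant free of the
    truncation radius.

    In the bound of the energy gap the cut between near and far is a second radius, independent of
    the truncation. It can thus be fixed before eps tends to 0. *)

Section lebesgue_vs_borel.
Context {R : realType} {n : nat}.
Local Notation V := 'rV[R]_n.
Local Notation m := (borel_lebesgue R n).
Local Open Scope ereal_scope.

Lemma measurable_lebRn (A : set V) :
  measurable A -> measurable (A : set (lebRn R n)).
Proof. exact: caratheodory_measurable_mu_ext. Qed.

Lemma lebE (A : set V) : measurable A -> leb A = m A.
Proof. exact: measurable_mu_extE. Qed.

Lemma measurable_id_lebRn : measurable_fun [set: lebRn R n] (id : lebRn R n -> V).
Proof. by move=> _ A mA; rewrite setTI; exact: measurable_lebRn. Qed.

Lemma measurable_fun_lebRn d (T : measurableType d) (f : V -> T) :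
  measurable_fun setT f -> measurable_fun [set: lebRn R n] (f : lebRn R n -> T).
Proof. by move=> mf; apply: (measurableT_comp mf); exact: measurable_id_lebRn. Qed.

(** Change of variables with the image measure given by a hypothesis. It serves for [g] the identity
    from the Lebesgue to the Borel structure, under which [leb] is carried to [m]. *)
Lemma ge0_integral_image d1 d2 (T1 : measurableType d1) (T2 : measurableType d2)
    (m1 : {measure set T1 -> \bar R}) (m2 : {measure set T2 -> \bar R}) (g : T1 -> T2)
    (f : T2 -> \bar R) (D : set T2) :
  measurable_fun setT g -> (forall A, measurable A -> m1 (g @^-1` A) = m2 A) ->
  measurable D -> measurable_fun D f -> (forall x, D x -> 0 <= f x) ->
  \int[m1]_(x in g @^-1` D) f (g x) = \int[m2]_(x in D) f x.
Proof.
move=> mg gm mD mf f0.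
rewrite -(ge0_integral_pushforward mg)//; last by move=> x /set_mem; exact: f0.
by apply: eq_measure_integral => A mA _; exact: gm.
Qed.

Lemma ge0_integral_leb (f : V -> \bar R) (D : set V) : measurable D ->
  measurable_fun D f ->
  (forall x, D x -> 0 <= f x) -> \int[leb]_(x in D) f x = \int[m]_(x in D) f x.
Proof.
move=> mD mf f0.
exact: (ge0_integral_image (m1 := leb) measurable_id_lebRn lebE mD mf f0).
Qed.

Lemma integrable_leb (f : V -> \bar R) : m.-integrable setT f ->
  leb.-integrable [set: lebRn R n] f.
Proof.
move=> /integrableP[mf fi]; apply/integrableP; split.
  exact: measurable_fun_lebRn.
by rewrite (ge0_integral_leb measurableT)//; exact: measurableT_comp.
Qed.

Lemma integral_leb (f : V -> \bar R) : measurable_fun setT f ->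
  \int[leb]_x f x = \int[m]_x f x.
Proof.
move=> mf; rewrite integralE [RHS]integralE.
congr (_ - _); apply: (ge0_integral_leb measurableT) => //.
  exact: measurable_funepos.
exact: measurable_funeneg.
Qed.

(** The outer measure is an infimum over countable Borel covers. Intersecting covers whose excess is
    at most [k.+1%:R^-1] gives a Borel set containing [E], and since [leb E] is finite it can be
    subtracted to see that the excess is null. *)
Lemma borel_version (E : set V) : measurable (E : set (lebRn R n)) ->
  leb E < +oo -> exists2 B : set V, measurable B & leb ((E `\` B) `|` (B `\` E)) = 0.
Proof.
move=> mE Efin.
have /choice[F HF] : forall k : nat, exists F : set V,
    [/\ measurable F, E `<=` F & m F <= leb E + (k.+1%:R^-1)%:E].
  move=> k.
  have k0 : (0 < k.+1%:R^-1 :> R)%R by [].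
  have Efn : leb E \is a fin_num by rewrite ge0_fin_numE.
  have [_ [G [mG EG] <-] ltG] := lb_ereal_inf_adherent k0 Efn.
  exists (\bigcup_i G i); split => //; first exact: bigcupT_measurable.
  apply: le_trans (ltW ltG).
  by apply: measure_sigma_subadditive => //; exact: bigcupT_measurable.
exists (\bigcap_i F i).
  by apply: bigcapT_measurable => k; have [] := HF k.
have EB : E `<=` \bigcap_i F i by move=> x Ex k _; have [_ /(_ _ Ex)] := HF k.
have mB : measurable (\bigcap_i F i).
  by apply: bigcapT_measurable => k; have [] := HF k.
have mB' := measurable_lebRn mB.
have -> : E `\` \bigcap_i F i = set0 by rewrite setD_eq0.
rewrite set0U.
have mDE : measurable ((\bigcap_i F i) `\` E : set (lebRn R n)) by exact: measurableD.
have H : leb (\bigcap_i F i) = leb E + leb ((\bigcap_i F i) `\` E).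
  rewrite -measureU//; last by apply/seteqP; split => // x [Ex [_ nEx]].
  by congr leb; apply/seteqP; split => [x Bx|x [/EB|[]]] //; have [Ex|nEx] := pselect (E x); [left|right].
apply/eqP; rewrite eq_le measure_ge0 andbT.
apply/lee_addgt0Pr => e e0; rewrite add0e.
have [k ke] : exists k : nat, (k.+1%:R^-1 <= e)%R.
  exists (Num.truncn e^-1); rewrite invf_ple ?posrE//; exact/ltW/truncnS_gt.
have [mFk _ HFk] := HF k.
have Efn : leb E \is a fin_num by rewrite ge0_fin_numE.
rewrite -(@leeD2lE _ (leb E))// -H.
have : leb (\bigcap_i F i) <= m (F k).
  by rewrite lebE//; apply: le_measure; rewrite ?inE//; exact: bigcap_inf.
move=> /le_trans; apply; apply: le_trans HFk _.
by rewrite leeD2l// lee_fin.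
Qed.

End lebesgue_vs_borel.

(** * Invariance of Lebesgue measure under reflections and translations; cubes *)

Section invariance.
Context {R : realType}.
Local Open Scope ereal_scope.
Local Notation mu := (@lebesgue_measure R).

(** Uniqueness of Lebesgue measure reduces the claim to intervals, where a reflection only exchanges
    which end is closed. Reflections are the basic symmetry here: they are what the kernel
    [kap (x - y)] calls for, and two of them compose to a translation. *)
Lemma lebesgue_measure_reflect (a : R) (A : set R) : measurable A ->
  pushforward mu ((fun x => (a - x)%R) : _ -> measurableTypeR R) A = mu A.
Proof.
have mr : measurable_fun setT ((fun x => (a - x)%R) : R -> measurableTypeR R).
  by apply: measurable_funB.
move=> mA; apply/esym/lebesgue_measure_unique => //= _ [[u v]] _ <-.
rewrite /pushforward/= (_ : _ @^-1` _ = `[(a - v)%R, (a - u)%R[%classic); last first.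
  apply/seteqP; split => x /=; rewrite !in_itv/= => /andP[h1 h2]; apply/andP; split; lra.
rewrite !lebesgue_measure_itv/= !lte_fin.
by rewrite ltrD2l ltrN2; case: ifPn => // _; rewrite -!EFinB; congr (_%:E); lra.
Qed.

Lemma ge0_integral_reflect1 (a : R) (f : R -> \bar R) :
  measurable_fun setT f -> (forall x, 0 <= f x) ->
  \int[mu]_x f (a - x)%R = \int[mu]_x f x.
Proof.
have mr : measurable_fun setT ((fun x => (a - x)%R) : R -> measurableTypeR R).
  by apply: measurable_funB.
move=> mf f0.
transitivity (\int[pushforward mu ((fun x => (a - x)%R) : _ -> measurableTypeR R)]_x f x).
  by rewrite ge0_integral_pushforward.
by apply: eq_measure_integral => A mA _; exact: lebesgue_measure_reflect.
Qed.

Lemma ge0_integral_row_product n (f : 'rV[R]_n.+1 -> \bar R) :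
  measurable_fun setT f -> (forall x, 0 <= f x) ->
  \int[borel_lebesgue R n.+1]_x f x =
  \int[mu]_p \int[borel_lebesgue R n]_v f (row_cons (p, v)).
Proof.
move=> mf f0.
have -> : \int[borel_lebesgue R n.+1]_x f x =
   \int[pushforward (@lebesgue_measure R \x borel_lebesgue R n) row_cons]_x f x.
  by apply: eq_measure_integral; first exact: measurable_row_cons.
rewrite ge0_integral_pushforward//; last exact: measurable_row_cons.
rewrite (fubini_tonelli1 _ _ (fun x : measurableTypeR R * 'rV[R]_n => f0 (row_cons x)))//.
by apply: measurableT_comp => //; exact: measurable_row_cons.
Qed.

Lemma measurable_rowB n d (T : measurableType d) (f g : T -> 'rV[R]_n) :
  measurable_fun setT f -> measurable_fun setT g ->
  measurable_fun setT (fun x => f x - g x)%R.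
Proof.
move=> mf mg; apply: measurable_fun_row => i.
rewrite [X in measurable_fun _ X](_ : _ = (fun x => f x ord0 i - g x ord0 i)%R); last first.
  by apply/funext => x; rewrite !mxE.
apply: measurable_funB.
  exact: (measurableT_comp (@measurable_coord R n i) mf).
exact: (measurableT_comp (@measurable_coord R n i) mg).
Qed.

Lemma measurable_rowD n d (T : measurableType d) (f g : T -> 'rV[R]_n) :
  measurable_fun setT f -> measurable_fun setT g ->
  measurable_fun setT (fun x => f x + g x)%R.
Proof.
move=> mf mg; apply: measurable_fun_row => i.
rewrite [X in measurable_fun _ X](_ : _ = (fun x => f x ord0 i + g x ord0 i)%R); last first.
  by apply/funext => x; rewrite !mxE.
apply: measurable_funD.
  exact: (measurableT_comp (@measurable_coord R n i) mf).
exact: (measurableT_comp (@measurable_coord R n i) mg).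
Qed.

Lemma row_unconsK n : cancel (@row_uncons R n) row_cons.
Proof.
move=> x; rewrite /row_cons/row_uncons /=.
rewrite (_ : (x ord0 ord0)%:M = lsubmx (x : 'rV_(1 + n))); first exact: (@hsubmxK R 1 1 n x).
apply/rowP => i; rewrite !mxE (ord1 i) eqxx mulr1n; congr (x _ _).
exact/val_inj.
Qed.

Lemma row_cons0 n (p : R * 'rV[R]_n) : row_cons p ord0 ord0 = p.1.
Proof. by rewrite -[RHS]/((p.1, p.2).1) -{2}(row_consK p). Qed.

Lemma row_consS n (p : R * 'rV[R]_n) i : row_cons p ord0 (lift ord0 i) = p.2 ord0 i.
Proof.
rewrite (_ : lift ord0 i = rshift 1 i); last exact/val_inj.
exact: (row_mxEr (p.1%:M : 'rV_1) p.2 ord0 i).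
Qed.

Lemma row_consB n (p q : R * 'rV[R]_n) : (row_cons p - row_cons q = row_cons (p.1 - q.1, p.2 - q.2))%R.
Proof.
apply/rowP => i; rewrite [LHS]mxE [X in (_ + X)%R]mxE.
by case: (unliftP ord0 i) => [j|] ->; rewrite ?row_consS ?row_cons0//= !mxE.
Qed.

(** Induction on the dimension: Tonelli separates the first coordinate, which is reflected by the
    one-dimensional case, and the induction hypothesis reflects the remaining ones. *)
Lemma ge0_integral_reflect n (a : 'rV[R]_n) (f : 'rV[R]_n -> \bar R) :
  measurable_fun setT f -> (forall x, 0 <= f x) ->
  \int[borel_lebesgue R n]_x f (a - x)%R = \int[borel_lebesgue R n]_x f x.
Proof.
elim: n a f => [|n IH] a f mf f0.
  by apply: eq_integral => x _; congr f; apply/rowP; case.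
have mr k (b : 'rV[R]_k) : measurable_fun setT (fun x : 'rV[R]_k => b - x)%R.
  by apply: measurable_rowB => //; exact: measurable_cst.
have mra : measurable_fun [set: 'rV[R]_n.+1] (fun x : 'rV[R]_n.+1 => f (a - x)%R).
  exact: measurableT_comp mf (mr _ a).
rewrite [LHS](ge0_integral_row_product mra (fun x => f0 _)).
rewrite [RHS](ge0_integral_row_product mf f0).
have mfc : measurable_fun setT (f \o row_cons).
  by apply: measurableT_comp => //; exact: measurable_row_cons.
set g := fun p => \int[borel_lebesgue R n]_v f (row_cons (p, v)).
have mg : measurable_fun setT g.
  exact: (measurable_fun_fubini_tonelli_F (f \o row_cons) mfc (fun x => f0 _)).
have g0 p : 0 <= g p by exact: integral_ge0.
rewrite -(@ge0_integral_reflect1 (a ord0 ord0) g mg g0).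
apply: eq_integral => p _; rewrite /g.
rewrite -[RHS](IH (row_uncons a).2)//; last first.
  exact: (measurableT_comp mfc (pair1_measurable _)).
apply: eq_integral => v _; congr f.
by rewrite -[in LHS](row_unconsK a) row_consB.
Qed.

(** Cubes stand in for Euclidean balls: their measure is explicit, and the inclusion [sub_box] is
    enough for upper bounds on integrals. *)
Definition box n (r : R) : set 'rV[R]_n := [set x | forall i, (`|x ord0 i| <= r)%R].

Lemma measurable_box n r : measurable (@box n r).
Proof.
rewrite (_ : @box n r = \bigcap_(i in [set: 'I_n]) ((fun x : 'rV[R]_n => x ord0 i) @^-1` `[(- r)%R, r]%classic)).
  apply: fin_bigcap_measurable => // i _.
  by rewrite -[X in measurable X]setTI; exact: measurable_coord.
apply/seteqP; split => [x bx i _|x bx i] /=.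
  by rewrite in_itv/= -ler_norml.
by have := bx i I; rewrite /= in_itv/= -ler_norml.
Qed.

Lemma borel_lebesgue_box n r : (0 <= r)%R ->
  borel_lebesgue R n (@box n r) = (((2 * r) ^+ n)%:E)%R.
Proof.
move=> r0; elim: n => [|n IH].
  by rewrite /= diracE expr0 mem_set// => -[].
rewrite /= /row_product_measure/= /pushforward.
have -> : row_cons @^-1` @box n.+1 r = `[(- r)%R, r]%classic `*` @box n r.
  apply/seteqP; split => [[p v] /= h|[p v] /= [h1 h2] i].
    split; first by have := h ord0; rewrite in_itv/= -ler_norml row_cons0.
    by move=> i; have := h (lift ord0 i); rewrite row_consS.
  case: (unliftP ord0 i) => [j|] ->; last first.
    by rewrite row_cons0 ler_norml; move: h1; rewrite in_itv.
  by rewrite row_consS; exact: h2.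
have itvE : @lebesgue_measure R `[(- r)%R, r]%classic = (2 * r)%:E.
  rewrite lebesgue_measure_itv/= lte_fin; case: ifPn => [_|].
    by rewrite -EFinB; congr (_%:E); lra.
  by rewrite -leNgt => rr; congr (_%:E); lra.
rewrite product_measure1E//; last exact: measurable_box.
by rewrite [X in _ * X]IH [X in X * _]itvE exprS.
Qed.

Lemma integral_reflect n (a : 'rV[R]_n) (f : 'rV[R]_n -> \bar R) :
  measurable_fun setT f ->
  \int[borel_lebesgue R n]_x f (a - x)%R = \int[borel_lebesgue R n]_x f x.
Proof.
move=> mf; rewrite integralE [RHS]integralE; congr (_ - _).
  rewrite -[RHS](ge0_integral_reflect a (measurable_funepos mf) (funepos_ge0 f)).
  by apply: eq_integral => x _; rewrite unlock.
rewrite -[RHS](ge0_integral_reflect a (measurable_funeneg mf) (funeneg_ge0 f)).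
by apply: eq_integral => x _; rewrite unlock.
Qed.

(** A translation is the composition of the reflections [a - x] and [0 - x]. *)
Lemma integral_shift n (a : 'rV[R]_n) (f : 'rV[R]_n -> \bar R) :
  measurable_fun setT f ->
  \int[borel_lebesgue R n]_x f (x + a)%R = \int[borel_lebesgue R n]_x f x.
Proof.
move=> mf.
have mr : measurable_fun [set: 'rV[R]_n] (fun x : 'rV[R]_n => a - x)%R.
  by apply: measurable_rowB => //; exact: measurable_cst.
rewrite -[RHS](integral_reflect a mf).
rewrite -[RHS](integral_reflect 0%R (f := fun x => f (a - x)%R)); last first.
  exact: measurableT_comp mf mr.
by apply: eq_integral => x _; rewrite sub0r opprK addrC.
Qed.

End invariance.

(** * The kernel of the fractional Laplacian *)

Section enorm_theory.
Context {R : realType} {n : nat}.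
Local Notation V := 'rV[R]_n.
Implicit Types x y : V.

Lemma enorm_ge0 x : 0 <= enorm x.
Proof. exact: sqrtr_ge0. Qed.

Lemma coord_le_enorm x i : `|x ord0 i| <= enorm x.
Proof.
rewrite -sqrtr_sqr ler_wsqrtr// (bigD1 i)//= lerDl.
by apply: sumr_ge0 => j _; exact: sqr_ge0.
Qed.

Lemma enormN x : enorm (- x) = enorm x.
Proof. by congr Num.sqrt; apply: eq_bigr => i _; rewrite mxE sqrrN. Qed.

Lemma enorm_distC x y : enorm (x - y) = enorm (y - x).
Proof. by rewrite -enormN opprB. Qed.

Lemma enormZ (c : R) x : enorm (c *: x) = `|c| * enorm x.
Proof.
rewrite /enorm -sqrtr_sqr -sqrtrM ?sqr_ge0// mulr_sumr; congr Num.sqrt.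
by apply: eq_bigr => i _; rewrite mxE exprMn.
Qed.

Lemma enorm0 : enorm (0 : V) = 0.
Proof. by rewrite -(scale0r (0 : V)) enormZ normr0 mul0r. Qed.

Lemma enorm_gt0 x : x != 0 -> 0 < enorm x.
Proof.
move=> x0; rewrite lt_neqAle enorm_ge0 andbT; apply: contra x0 => /eqP e.
apply/eqP/rowP => i; apply/eqP; rewrite mxE -normr_le0 [leRHS]e.
exact: coord_le_enorm.
Qed.

Lemma measurable_enorm : measurable_fun [set: V] (@enorm R n).
Proof.
apply: (measurableT_comp (f := @Num.sqrt R)).
  exact: continuous_measurable_fun (@sqrt_continuous R).
apply: measurable_sum => i; apply: measurable_funX.
exact: measurable_coord.
Qed.

Lemma sub_box x (r : R) : enorm x <= r -> box r x.
Proof. by move=> xr i; exact: le_trans (coord_le_enorm x i) xr. Qed.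

End enorm_theory.

(** * Integrals of powers of the norm by summation over dyadic shells *)

Section dyadic.
Context {R : realType} {n : nat}.
Local Notation V := 'rV[R]_n.
Local Notation m := (borel_lebesgue R n).

Lemma nneseries_geometric_le (a z : R) : 0 <= a -> 0 <= z < 1 ->
  (\sum_(k <oo) (a * z ^+ k)%:E <= (a / (1 - z))%:E)%E.
Proof.
move=> a0 /andP[z0 z1].
apply: lime_le.
  by apply: is_cvg_nneseries => k _ _; rewrite lee_fin mulr_ge0// exprn_ge0.
apply: nearW => N; rewrite sumEFin lee_fin -mulr_sumr big_mkord.
apply: ler_wpM2l => //; rewrite -[leRHS]mul1r ler_pdivlMr ?subr_gt0// mulrC.
rewrite -opprB mulNr -subrX1 opprB gerBl exprn_ge0//.
Qed.

Lemma powR_geometric (r b e : R) (k : nat) : 0 <= r -> 0 < b ->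
  (r * b ^+ k) `^ e = r `^ e * (b `^ e) ^+ k.
Proof.
move=> r0 b0; rewrite powRM//; last by rewrite exprn_ge0// ltW.
congr (_ * _).
by rewrite -(powR_mulrn k (ltW b0)) -(powR_mulrn k (powR_ge0 b e)) -!powRrM mulrC.
Qed.

(** Let rho_k = r b^k. On the shell rho_k/2 < |h| <= rho_k the integrand is at most (rho_k/2)^(-q),
    and the shell lies in a cube of measure (2 rho_k)^n. The products form a geometric series of
    ratio b^(n-q). The choice [b = 2] handles a tail at infinity and [b = 2^-1] a singularity at the
    origin. *)
Lemma dyadic_integral_le (g : V -> R) (q r b : R) :
  measurable_fun setT g -> (forall h, 0 <= g h) -> 0 < r -> 0 < b -> 0 <= q ->
  b `^ (n%:R - q) < 1 ->
  (forall h, g h = 0 \/ exists2 k : nat,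
     r * b ^+ k / 2 < enorm h <= r * b ^+ k & g h <= (enorm h `^ q)^-1) ->
  (\int[m]_h (g h)%:E <=
    (2 `^ q * 2 ^+ n * r `^ (n%:R - q) / (1 - b `^ (n%:R - q)))%:E)%E.
Proof.
move=> mg g0 r0 b0 q0 bq hg.
pose rho k := r * b ^+ k.
have rho0 k : 0 < rho k by rewrite mulr_gt0// exprn_gt0.
pose c k := ((rho k / 2) `^ q)^-1.
have c0 k : 0 <= c k by rewrite invr_ge0 powR_ge0.
pose F k (h : V) := (c k * \1_(box (rho k)) h)%:E.
have F0 k h : (0 <= F k h)%E by rewrite lee_fin mulr_ge0.
have mF k : measurable_fun [set: V] (F k).
  apply/measurable_EFinP; apply: measurable_funM => //.
  by apply: measurable_indic; exact: measurable_box.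
apply: (@le_trans _ _ (\int[m]_h \sum_(k <oo) F k h)%E).
  apply: ge0_le_integral => //.
  - by move=> h _; rewrite lee_fin.
  - exact/measurable_EFinP.
  - exact: ge0_emeasurable_sum.
  move=> h _; have [->|[k /andP[hk1 hk2] gk]] := hg h; first exact: nneseries_ge0.
  apply: (@le_trans _ _ (F k h)); last first.
    rewrite (@nneseriesD1 _ (fun k => F k h) k)//= leeDl//.
    exact: nneseries_ge0.
  rewrite lee_fin indicE mem_set ?mulr1; last exact: sub_box.
  have e0 : 0 < enorm h by apply: lt_trans hk1; apply: divr_gt0 => //; exact: rho0.
  apply: (le_trans gk); rewrite /c lef_pV2 ?posrE ?powR_gt0 ?divr_gt0//.
  by apply: ge0_ler_powR => //; rewrite ?nnegrE ?enorm_ge0 ?divr_ge0 ?ltW.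
rewrite integral_nneseries//.
rewrite (eq_eseriesr (g := fun k => ((2 `^ q * 2 ^+ n * r `^ (n%:R - q)) * (b `^ (n%:R - q)) ^+ k)%:E)); last first.
  move=> k _; rewrite /F.
  under eq_integral do rewrite EFinM.
  rewrite ge0_integralZl_EFin//; last first.
    by apply/measurable_EFinP; apply: measurable_indic; exact: measurable_box.
  rewrite integral_indic//; last exact: measurable_box.
  rewrite setIT [X in (_ * X)%E]borel_lebesgue_box ?ltW// -EFinM; congr (_%:E).
  have -> : c k = 2 `^ q * (rho k `^ q)^-1.
    by rewrite /c powRM ?invr_ge0 ?ltW// invfM -powR_inv1// -powRrM mulN1r powRN invrK mulrC.
  rewrite exprMn -[rho k ^+ n]powR_mulrn ?ltW// -[in RHS]mulrA -powR_geometric ?ltW//.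
  rewrite powRB; last by rewrite (gt_eqF (rho0 k)) implybT.
  ring.
apply: nneseries_geometric_le; last by rewrite powR_ge0.
by rewrite !mulr_ge0// powR_ge0.
Qed.

End dyadic.

Section kernel.
Context {R : realType} {n : nat}.
Local Notation V := 'rV[R]_n.
Local Notation m := (borel_lebesgue R n).
Variable s : R.

Definition kern (h : V) : R := (enorm h `^ (n%:R + s))^-1.
Definition kfar (r : R) (h : V) : R := if r < enorm h then kern h else 0.
Definition knear (r : R) (h : V) : R := if enorm h <= r then kern h else 0.

Lemma kern_ge0 h : 0 <= kern h.
Proof. by rewrite invr_ge0 powR_ge0. Qed.

Lemma kfar_ge0 r h : 0 <= kfar r h.
Proof. by rewrite /kfar; case: ifP => // _; exact: kern_ge0. Qed.

Lemma knear_ge0 r h : 0 <= knear r h.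
Proof. by rewrite /knear; case: ifP => // _; exact: kern_ge0. Qed.

Lemma kfarN r h : kfar r (- h) = kfar r h.
Proof. by rewrite /kfar /kern enormN. Qed.

Lemma kern_split r h : kern h = kfar r h + knear r h.
Proof. by rewrite /kfar /knear leNgt; case: ifP => _; rewrite ?addr0 ?add0r. Qed.

Lemma kfar_le_kern r h : kfar r h <= kern h.
Proof. by rewrite /kfar; case: ifP => // _; exact: kern_ge0. Qed.

Lemma le_kfar r r' h : r <= r' -> kfar r' h <= kfar r h.
Proof.
move=> rr; rewrite /kfar; case: ifPn => [|_]; last exact: kfar_ge0.
by move=> /(le_lt_trans rr) ->.
Qed.

Lemma kfar_diff r r' h : r' <= r -> kfar r' h - kfar r h <= knear r h.
Proof.
move=> rr; rewrite /kfar /knear ltNge (leNgt _ r).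
case: ltP => rh /=; last by rewrite subr0; case: ifP => // _; exact: kern_ge0.
by rewrite -ltNge (le_lt_trans rr rh) subrr.
Qed.

Lemma measurable_kern : measurable_fun [set: V] kern.
Proof.
rewrite (_ : kern = fun h => enorm h `^ (- (n%:R + s))); last first.
  by apply/funext => h; rewrite powRN.
apply: (measurableT_comp (f := fun x : R => x `^ (- (n%:R + s)))) => //.
exact: measurable_enorm.
Qed.

Lemma measurable_kfar r : measurable_fun [set: V] (kfar r).
Proof.
apply: measurable_fun_ifT => //; last exact: measurable_kern.
by apply: measurable_fun_ltr => //; exact: measurable_enorm.
Qed.

Lemma measurable_knear r : measurable_fun [set: V] (knear r).
Proof.
apply: measurable_fun_ifT => //; last exact: measurable_kern.
by apply: measurable_fun_ler => //; exact: measurable_enorm.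
Qed.

Hypothesis s_gt0 : 0 < s.

(** Dyadic shells going outwards, with [q = n + s]: the ratio is 2^(-s) < 1 because [s] is
    positive. *)
Lemma kfar_lty r : 0 < r -> (\int[m]_h (kfar r h)%:E < +oo)%E.
Proof.
move=> r0; apply: le_lt_trans (ltry _).
apply: (@dyadic_integral_le _ _ _ (n%:R + s) (2 * r) 2) => //.
- exact: measurable_kfar.
- exact: kfar_ge0.
- exact: mulr_gt0.
- by rewrite addr_ge0// ltW.
- rewrite opprD addrA subrr sub0r powRN invf_lt1 ?powR_gt0//.
  have := @gt0_ltr_powR R s s_gt0 1 2; rewrite powR1; apply; rewrite ?nnegrE//.
  by rewrite ltr1n.
move=> h; rewrite /kfar; case: ltP => rh; [right|by left].
have [k hk] : exists k : nat, enorm h <= 2 * r * 2 ^+ k.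
  exists (Num.truncn (enorm h / r)).+1.
  rewrite -mulrA mulrCA -exprS -ler_pdivrMl// mulrC.
  apply: le_trans (ltW (truncnS_gt _)) _.
  by rewrite -natrX ler_nat (leq_trans (ltnW (ltn_expl _ (isT : 1 < 2)%N)))// leq_exp2l.
(* The least admissible index is the index of the shell. For index 0 the lower bound of the shell is
   the cut [r < enorm h] itself, which is why the radii start at [2 * r]. *)
have [k0 /= hk0 kmin] := ex_minnP (ex_intro (fun k => enorm h <= 2 * r * 2 ^+ k) k hk).
exists k0 => //; rewrite hk0 andbT.
case: k0 hk0 kmin => [|k0] hk0 kmin; first by rewrite expr0 mulr1 mulrC mulKf.
rewrite exprSr mulrA mulfK// ltNge; apply/negP => /kmin.
by rewrite ltnn.
Qed.

Hypothesis n_gt0 : (0 < n)%N.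
Hypothesis s_lt1 : s < 1.

(** The constant of [dyadic_integral_le] for [q = n + s - 1] and [b = 2^-1]; the exponent in the
    denominator is [1 - s]. *)
Definition knear_cst : R :=
  2 `^ (n%:R + s - 1) * 2 ^+ n / (1 - 2^-1 `^ (n%:R - (n%:R + s - 1))).

(** One factor |h| lowers the singularity to |h|^(-(n+s-1)), which is integrable at the origin
    exactly because s < 1. Since n >= 1 the exponent n + s - 1 is nonnegative, as the dyadic bound
    requires. *)
Lemma knear_moment_le r : 0 < r ->
  (\int[m]_h (knear r h * enorm h)%:E <= (knear_cst * r `^ (1 - s))%:E)%E.
Proof.
move=> r0.
have e1 : n%:R - (n%:R + s - 1) = 1 - s by lra.
have n1 : 1 <= n%:R :> R by rewrite ler1n.
have p0 : 0 < n%:R + s by rewrite ltr_wpDl.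
rewrite /knear_cst e1 mulrAC -e1.
apply: dyadic_integral_le => //.
- apply: measurable_funM; [exact: measurable_knear|exact: measurable_enorm].
- by move=> h; rewrite mulr_ge0 ?knear_ge0 ?enorm_ge0.
- by rewrite addrAC addr_ge0 // ?subr_ge0 // ltW.

- have s1 : 0 < 1 - s by rewrite subr_gt0.
  rewrite e1; have := @gt0_ltr_powR R _ s1 2^-1 1; rewrite powR1; apply; rewrite ?nnegrE//.
  by rewrite invf_lt1// ltr1n.
move=> h; have [->|h0] := eqVneq h 0; first by left; rewrite enorm0 mulr0.
rewrite /knear; case: leP => rh; [right|by left; rewrite mul0r].
have eh := enorm_gt0 h0.
have [k hk] : exists k : nat, r * 2^-1 ^+ k / 2 < enorm h.
  exists (Num.truncn (r / enorm h)).
  rewrite -mulrA -exprSr exprVn ltr_pdivrMr ?exprn_gt0// -ltr_pdivrMl// mulrC.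
  apply: lt_le_trans (truncnS_gt _) _.
  by rewrite -natrX ler_nat ltnW// ltn_expl.
(* The radii now decrease, so an index whose lower radius is below [enorm h] exists because [h] is
   not 0; the least such index is again that of the shell. *)
have [k0 /= hk0 kmin] := ex_minnP (ex_intro (fun k => r * 2^-1 ^+ k / 2 < enorm h) k hk).
exists k0.
  rewrite hk0/=; case: k0 hk0 kmin => [|k0] hk0 kmin; first by rewrite expr0 mulr1.
  by rewrite exprSr mulrA leNgt; apply/negP => /kmin; rewrite ltnn.
rewrite /kern -[X in _ * X](powRr1 (ltW eh)) -powRN -powRD; last by rewrite (gt_eqF eh) implybT.
by rewrite -powRN; rewrite le_eqVlt (_ : - _ + _ = - (n%:R + s - 1)) ?eqxx//; lra.
Qed.

End kernel.

(** * Smooth functions *)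

Section smooth.
Context {R : realType} {n : nat}.
Local Notation V := 'rV[R]_n.
Implicit Types f g : V -> R.

Definition smooth f := forall k, Ck k f.

Lemma Ck_continuous k f : Ck k f -> continuous f.
Proof. by case: k => // k [df _] x; exact: differentiable_continuous. Qed.

Lemma CkW k f : Ck k.+1 f -> Ck k f.
Proof.
elim: k f => [|k IH] f; first by move=> /Ck_continuous.
by move=> [df pf]; split => // i; exact: IH.
Qed.

Lemma smooth_partial i f : smooth f -> smooth (partial i f).
Proof. by move=> sf k; have [_] := sf k.+1; apply. Qed.

Lemma smooth_differentiable f : smooth f -> forall x, differentiable f x.
Proof. by move=> sf; have [] := sf 1%N. Qed.

Lemma smooth_continuous f : smooth f -> continuous f.
Proof. by move=> /(_ 0%N). Qed.

Lemma Ck_cst k (c : R) : Ck k (fun _ : V => c).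
Proof.
elim: k c => [|k IH] c; first exact: cst_continuous.
split => [x|i]; first exact: differentiable_cst.
rewrite (_ : partial i _ = fun=> 0) //.
by apply/funext => x; rewrite /partial derive_cst.
Qed.

Lemma Ck_add k f g : Ck k f -> Ck k g -> Ck k (fun x => f x + g x).
Proof.
elim: k f g => [|k IH] f g; first by move=> cf cg x; exact: cvgD (cf x) (cg x).
move=> [df pf] [dg pg]; split => [x|i]; first exact: differentiableD.
rewrite (_ : partial i _ = fun x => partial i f x + partial i g x).
  by apply: IH; [exact: pf|exact: pg].
by apply/funext => x; rewrite /partial deriveD//; exact: diff_derivable.
Qed.

Lemma Ck_mul k f g : Ck k f -> Ck k g -> Ck k (fun x => f x * g x).
Proof.
elim: k f g => [|k IH] f g; first by move=> cf cg x; exact: cvgM (cf x) (cg x).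
move=> Cf Cg; have [df pf] := Cf; have [dg pg] := Cg.
split => [x|i]; first exact: differentiableM.
rewrite (_ : partial i _ = fun x => f x * partial i g x + g x * partial i f x).
  by apply: Ck_add; apply: IH; [exact: CkW|exact: pg|exact: CkW|exact: pf].
by apply/funext => x; rewrite /partial deriveM//; exact: diff_derivable.
Qed.

Lemma Ck_coord k i : Ck k (fun x : V => x ord0 i).
Proof.
case: k => [|k]; first by move=> x; exact/differentiable_continuous/differentiable_coord.
split => [x|j]; first exact: differentiable_coord.
rewrite (_ : partial j _ = fun=> (j == i)%:R); first exact: Ck_cst.
apply/funext => x; rewrite /partial.
have hid : derivable (id : V -> V) x (delta_mx ord0 j) by exact: derivable_id.
have := @derive_mx R V 1 n id x (delta_mx ord0 j) hid.
rewrite derive_id => /matrixP/(_ ord0 i); rewrite !mxE eqxx/= => <-.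
by rewrite eq_sym.
Qed.

(** The derivative is a witness and not the function [derive1 g], so that an induction can stay
    inside a family given by formulas, as it does for [flat]. *)
Fixpoint Dk (k : nat) (g : R -> R) : Prop :=
  if k is k'.+1 then exists2 g' : R -> R, (forall x : R, is_derive x (1 : R) g (g' x)) & Dk k' g'
  else continuous g.

Lemma Dk_lin k (c : R) (g h : R -> R) : Dk k g -> Dk k h -> Dk k (fun x => c * g x + h x).
Proof.
elim: k g h => [|k IH] g h.
  by move=> cg ch x; apply: cvgD (ch x); apply: cvgM (cg x); exact: cvg_cst.
move=> [g' dg Dg] [h' dh Dh]; exists (fun x => c * g' x + h' x); last exact: IH.
move=> x; have := dg x; have := dh x => dh' dg'.
exact: is_deriveD.
Qed.

Lemma Ck_comp k (g : R -> R) f : Dk k g -> Ck k f -> Ck k (fun x => g (f x)).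
Proof.
elim: k g f => [|k IH] g f.
  by move=> cg cf x; apply: continuous_comp (cf x) (cg _).
move=> Dg Cf; have [g' dg Dg'] := Dg; have [df pf] := Cf.
have dg1 y : differentiable g y by apply/derivable1_diffP; exact: ex_derive.
split => [x|i]; first exact: differentiable_comp.
rewrite (_ : partial i _ = fun x => g' (f x) * partial i f x).
  by apply: Ck_mul; [apply: IH => //; exact: CkW|exact: pf].
apply/funext => x; rewrite /partial deriveE; last exact: differentiable_comp.
rewrite (_ : (fun x => g (f x)) = g \o f)// diff_comp//= diff1E//= derive1E.
by have dgf := dg (f x); rewrite derive_val deriveE// mulrC.
Qed.

Lemma derive_affine f (a : V) (c : R) (v x : V) : differentiable f (a + c *: x) ->
  'D_v (fun x => f (a + c *: x)) x = c * 'D_v f (a + c *: x).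
Proof.
move=> df.
have h : is_diff x (fun x : V => a + c *: x) (fun v => c *: v).
  have : is_diff x ((cst a : V -> V) + (fun y : V => c *: y)) (0 + (fun y : V => c *: y)).
    by apply: is_diffD.
  by rewrite add0r.
have dh : differentiable (fun x : V => a + c *: x) x by exact: ex_diff.
rewrite (_ : (fun x => _) = f \o (fun x : V => a + c *: x))// deriveE; last exact: differentiable_comp.
by rewrite diff_comp//= diff_val linearZ/= deriveE.
Qed.

Lemma Ck_affine k f (a : V) (c : R) : Ck k f -> Ck k (fun x => f (a + c *: x)).
Proof.
have dh x : differentiable (fun x : V => a + c *: x) x.
  by apply: differentiableD => //; apply: differentiableZ.
elim: k f => [|k IH] f.
  move=> cf x; apply: (continuous_comp (f := fun x : V => a + c *: x) (g := f)).
    exact: differentiable_continuous.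
  exact: cf.
move=> [df pf]; split => [x|i].
  exact: (differentiable_comp (f := fun x : V => a + c *: x)).
rewrite (_ : partial i _ = fun x : V => c * partial i f (a + c *: x)).
  by apply: Ck_mul; [exact: Ck_cst|apply: IH; exact: pf].
by apply/funext => x; rewrite /partial derive_affine.
Qed.

End smooth.

(** * A smooth step built from exp(-1/x) *)

Section flat.
Context {R : realType}.

(* Smooth on R and vanishing to infinite order at 0; the family is closed under differentiation up to linear combinations. *)
Definition flat (j : nat) (x : R) : R :=
  if 0 < x then x^-1 ^+ j * expR (- x^-1) else 0.

(** With N = j + 2, raise z <= exp z at z = 1/(N x) to the power N: this gives exp(1/x) >= (1/(N
    x))^N, hence x^(-j) exp(-1/x) <= N^N x^2. The square is what makes the difference quotient at 0
    vanish. *)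
Lemma flat_le (j : nat) (x : R) : 0 < x ->
  flat j x <= ((j.+2)%:R ^+ j.+2) * x ^+ 2.
Proof.
move=> x0; rewrite /flat x0.
have N0 : 0 < j.+2%:R :> R by [].
have : (x^-1 / j.+2%:R) ^+ j.+2 <= expR (x^-1).
  have -> : expR x^-1 = expR (x^-1 / j.+2%:R) ^+ j.+2.
    by rewrite -expRM_natl mulrC divfK// gt_eqF.
  have y0 : 0 <= x^-1 / j.+2%:R by rewrite divr_ge0// invr_ge0 ltW.
  apply: lerXn2r; rewrite ?nnegrE ?expR_ge0//.
  by apply: le_trans (expR_ge1Dx _); rewrite lerDr.
rewrite expRN ler_pdivrMr ?expR_gt0// => h.
rewrite -(ler_pM2l (x := j.+2%:R ^+ j.+2 * x ^+ 2)) in h; last by rewrite mulr_gt0// exprn_gt0.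
apply: le_trans h; rewrite expr_div_n le_eqVlt; apply/orP; left; apply/eqP.
have M0 : j.+2%:R ^+ j.+2 != 0 :> R by rewrite expf_neq0// gt_eqF.
move: (j.+2%:R ^+ j.+2) M0 => M M0.
rewrite 2!(exprS x^-1); move: (x^-1 ^+ j) => y.
by field; rewrite M0 (gt_eqF x0).
Qed.

Lemma flat_ge0 j x : 0 <= flat j x.
Proof.
rewrite /flat; case: ifP => // x0.
by rewrite mulr_ge0 ?expR_ge0// exprn_ge0// invr_ge0 ltW.
Qed.

Lemma flat_derive0 j : is_derive (0 : R) (1 : R) (flat j) 0.
Proof.
have c : (fun h => h^-1 *: ((flat j \o shift (0 : R)) (h *: (1 : R)) - flat j 0)) @ (0 : R)^' --> (0 : R).
  apply/cvgrPdist_le => /= e e0; near=> h.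
  have h0 : h != 0 by near: h; exact: nbhs_dnbhs_neq.
  rewrite sub0r normrN addr0 (_ : h *: (1 : R) = h); last exact: mulr1.
  rewrite {2}/flat ltxx subr0 normrM normfV ler_pdivrMl ?normr_gt0//.
  rewrite ger0_norm ?flat_ge0//.
  have [hp|hn] := ltP 0 h; last by rewrite /flat ltNge hn/= mulr_ge0// ltW.
  apply: le_trans (flat_le j hp) _.
  rewrite (gtr0_norm hp) expr2 mulrCA ler_pM2l//.
  have C0 : 0 < j.+2%:R ^+ j.+2 :> R by rewrite exprn_gt0.
  rewrite -ler_pdivlMl// mulrC; apply: le_trans (ler_norm h) _.
  near: h; apply: dnbhs0_le; exact: divr_gt0.
apply: DeriveDef; first by apply/cvg_ex; exists 0.
exact: cvg_lim.
Unshelve. all: by end_near. Qed.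

Lemma flat_derive j (x : R) :
  is_derive x (1 : R) (flat j) (- j%:R * flat j.+1 x + flat j.+2 x).
Proof.
have [x0|x0|->] := ltgtP x 0.
- rewrite /flat ltNge (ltW x0)/= mulr0 add0r.
  apply: (near_eq_is_derive (f := cst 0)); near=> y.
  by rewrite ifF//; apply/negbTE; rewrite -leNgt ltW//; near: y; exact: lt_nbhsl.
- apply: (near_eq_is_derive (f := (fun x : R => x^-1) ^+ j * (expR \o (fun x : R => - x^-1)))).
    near=> y; have y0 : 0 < y by near: y; exact: lt_nbhsr.
    by rewrite /flat y0 -[LHS]/(((fun x : R => x^-1) ^+ j) y * expR (- y^-1)) exprfctE.
  rewrite /flat x0.
  have hV : is_derive x (1 : R) (fun y : R => y^-1) (- x ^- 2).
    have := @is_deriveV R id x 1 1; rewrite /GRing.scale/= mulr1; apply.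
    by rewrite gt_eqF.
  have hE : is_derive x (1 : R) (expR \o (fun x : R => - x^-1)) (expR (- x^-1) * x ^- 2).
    apply: is_derive1_comp.
    by rewrite -[X in is_derive _ _ _ X]opprK; exact: is_deriveN.
  have hM := is_deriveM (is_deriveX j hV) hE.
  apply: is_derive_eq hM _.
  rewrite /GRing.scale/= !exprfctE.
  case: j => [|j]; first by rewrite /= !mul0r expr0 oppr0 !mul0r mul1r mulr0 addr0 add0r exprVn mulrC.
  rewrite -!exprVn /= !exprS.
  by move: (expR (- x^-1)) (x^-1 ^+ j) (x^-1) (j.+1%:R) => e p y a; ring.
- by rewrite /flat ltxx mulr0 addr0; exact: flat_derive0.
Unshelve. all: by end_near. Qed.

Lemma Dk_flat k j : Dk k (flat j).
Proof.
elim: k j => [|k IH] j.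
  move=> x; apply: differentiable_continuous; apply/derivable1_diffP.
  by have := flat_derive j x => ?; exact: ex_derive.
exists (fun x => - j%:R * flat j.+1 x + flat j.+2 x); first exact: flat_derive.
exact: Dk_lin.
Qed.

Lemma flat0_le1 x : flat 0 x <= 1.
Proof.
rewrite /flat; case: ifPn => // x0.
by rewrite expr0 mul1r -[leRHS]expR0 ler_expR oppr_le0 invr_ge0 ltW.
Qed.

Lemma flat0_ge x : 0 < x -> 1 - x^-1 <= flat 0 x.
Proof. by move=> x0; rewrite /flat x0 expr0 mul1r; exact: expR_ge1Dx. Qed.

(** Rescaling turns [flat 0], which vanishes on the nonpositive half-line, into smooth
    approximations of the indicator of the positive half-line; half-spaces and cubes are
    approximated from these. *)
Lemma flat0_cvg1 a : 0 < a -> flat 0 (k.+1%:R * a) @[k --> \oo] --> (1 : R).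
Proof.
move=> a0; apply/cvgrPdist_le => /= e e0; near=> k.
have y0 : 0 < k.+1%:R * a by rewrite mulr_gt0.
rewrite ger0_norm ?subr_ge0 ?flat0_le1//.
apply: (@le_trans _ _ (k.+1%:R * a)^-1); first by rewrite lerBlDr addrC -lerBlDr flat0_ge.
rewrite invf_ple ?posrE// -ler_pdivrMr//.
apply: (@le_trans _ _ k%:R); last by rewrite ler_nat.
by near: k; exact: nbhs_infty_ger.
Unshelve. all: by end_near. Qed.

End flat.

(** * Density of test functions in L^1 *)

Section borel.
Context {R : realType} {n : nat}.
Local Notation V := 'rV[R]_n.

(** The sigma-algebra is generated by the coordinates, so an open set is exhibited as the union of
    the cubes with rational centre and rational radius that it contains. *)
Lemma open_measurable_row (U : set V) : open U -> measurable U.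
Proof.
move=> oU.
pose B (c : 'rV[rat]_n) (q : rat) : set V :=
  [set x | forall i, `|x ord0 i - ratr (c ord0 i)| < ratr q].
have mB c q : measurable (B c q).
  rewrite (_ : B c q = \bigcap_(i in [set: 'I_n])
    ((fun x : V => x ord0 i) @^-1` `](ratr (c ord0 i) - ratr q), (ratr (c ord0 i) + ratr q)[%classic)).
    apply: fin_bigcap_measurable => // i _.
    by rewrite -[X in measurable X]setTI; exact: measurable_coord.
  apply/seteqP; split => [x bx i _|x bx i] /=.
    by rewrite in_itv/= -ltr_distl.
  by have := bx i I; rewrite /= in_itv/= -ltr_distl.
pose F (p : 'rV[rat]_n * rat) := if `[< B p.1 p.2 `<=` U >] then B p.1 p.2 else set0.
rewrite (_ : U = \bigcup_p F p).
  apply: countable_bigcupT_measurable => [|p]; first exact: countableP.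
  by rewrite /F; case: ifP.
apply/seteqP; split => [x Ux|x [p _]]; last by rewrite /F; case: asboolP => // BU /BU.
have : nbhs x U by exact: open_nbhs_nbhs.
move=> /nbhs_ballP[e /= e0 eU].
have [q] := @rat_in_itvoo R 0 (e / 2) (divr_gt0 e0 (ltr0n _ 2)).
rewrite in_itv/= => /andP[q0 qe].
have /choice[c hc] : forall i : 'I_n, exists c : rat, `|x ord0 i - ratr c| < ratr q.
  move=> i; have [c] := @rat_in_itvoo R (x ord0 i - ratr q) (x ord0 i + ratr q) ltac:(lra).
  by rewrite in_itv/= => hc; exists c; rewrite distrC ltr_distl.
exists (\row_i c i, q) => //; rewrite /F asboolT; first by move=> i /=; rewrite mxE.
move=> y By; apply: eU; split => // i j; rewrite (ord1 i).
have := By j; have := hc j; rewrite /= mxE => h1 h2.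
rewrite /ball/=.
rewrite (_ : x ord0 j - y ord0 j = (x ord0 j - ratr (c j)) - (y ord0 j - ratr (c j))); last by ring.
by apply: le_lt_trans (ler_normB _ _) _; lra.
Qed.

Lemma continuous_measurable_row (f : V -> R) : continuous f -> measurable_fun [set: V] f.
Proof.
move=> cf; apply: (measurability _ (RGenOInfty.measurableE R)) => _ [_ [a ->] <-].
rewrite setTI preimage_itvoy; apply: open_measurable_row.
by move/continuousP : cf => /(_ _ (@open_gt R a)).
Qed.

Lemma smooth_measurable (f : V -> R) : smooth f -> measurable_fun [set: V] f.
Proof. by move=> /smooth_continuous; exact: continuous_measurable_row. Qed.

End borel.

Section density.
Context {R : realType} {n : nat}.
Local Notation V := 'rV[R]_n.
Local Notation m := (borel_lebesgue R n).
Local Open Scope ereal_scope.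

Lemma bounded_convergence_lt (Q : set V) (f : nat -> V -> R) (eta : R) :
  measurable Q -> m Q < +oo -> (0 < eta)%R ->
  (forall k, measurable_fun [set: V] (f k)) -> (forall k x, (0 <= f k x <= 1)%R) ->
  (forall x, Q x -> f ^~ x @ \oo --> (0%R : R)) ->
  exists k, \int[m]_(x in Q) (f k x)%:E <= eta%:E.
Proof.
move=> mQ Qfin eta0 mf f01 f0.
have ig : m.-integrable Q (EFin \o cst (1 : R)%R).
  apply: measurable_bounded_integrable => //.
  by exists 1%R; split => // M M1 x _; rewrite /= normr1; exact: ltW.
have := @dominated_cvg _ _ R m Q mQ (fun k x => (f k x)%:E) (cst 0) (cst 1).
have h1 k : measurable_fun Q (fun x => (f k x)%:E).
  by apply/measurable_EFinP; exact: measurable_funTS.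
have h2 x : Q x -> (f k x)%:E @[k --> \oo] --> (0 : \bar R).
  by move=> /f0 fx; apply: cvg_EFin fx; exact: nearW.
have h3 k x : Q x -> `|(f k x)%:E| <= (1 : \bar R).
  by move=> _; rewrite abse_EFin lee_fin ger0_norm; have /andP[] := f01 k x.
move=> /(_ h1 h2 _ ig h3); rewrite integral0 => /(_ (fun _ _ => isT)).
move=> /fine_cvgP[].
move=> [k1 _ hk1] /cvgrPdist_le/(_ eta eta0)[k2 _ hk2].
exists (maxn k1 k2).
have := hk1 _ (leq_maxl k1 k2); have := hk2 _ (leq_maxr k1 k2) => /=.
rewrite sub0r normrN => h hfin; rewrite -(fineK hfin) lee_fin.
exact: le_trans (ler_norm _) h.
Qed.

(** Measurability of [A] is included so that the approximable sets themselves form a sigma-algebra,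
    and the bounds 0 and 1 so that approximants can be multiplied without loss. *)
Definition approximable (Q A : set V) := measurable A /\
  forall eta : R, (0 < eta)%R -> exists rho : V -> R,
    [/\ smooth rho, forall x, (0 <= rho x <= 1)%R &
        \int[m]_(x in Q) `|\1_A x - rho x|%:E <= eta%:E].

Let mdistR (A : set V) (rho : V -> R) : measurable A -> smooth rho ->
  measurable_fun [set: V] (fun x => `|\1_A x - rho x|)%R.
Proof.
move=> mA srho; apply: measurableT_comp => //.
by apply: measurable_funB; [exact: measurable_indic|exact: smooth_measurable].
Qed.

Let mdist (A : set V) (rho : V -> R) : measurable A -> smooth rho ->
  measurable_fun [set: V] (fun x => `|\1_A x - rho x|%:E).
Proof. by move=> mA srho; apply/measurable_EFinP; exact: mdistR. Qed.

Variable (Q : set V).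
Hypotheses (mQ : measurable Q) (Qfin : m Q < +oo).

Lemma approximable_halfspace i (a : R) : approximable Q [set x | (a < x ord0 i)%R].
Proof.
have mA : measurable [set x : V | (a < x ord0 i)%R].
  rewrite (_ : mkset _ = [set: V] `&` (fun x : V => x ord0 i) @^-1` `]a, +oo[%classic); last first.
    by apply/seteqP; split => [x|x []] /=; rewrite in_itv/= andbT.
  exact: measurable_coord.
split => // eta eta0.
pose rho k (x : V) := @flat R 0 (k.+1%:R * (x ord0 i + - a))%R.
have srho k : smooth (rho k).
  move=> j; apply: Ck_comp; first exact: Dk_flat.
  by apply: Ck_mul; [exact: Ck_cst|apply: Ck_add; [exact: Ck_coord|exact: Ck_cst]].
have rho01 k x : (0 <= rho k x <= 1)%R by rewrite flat_ge0/= flat0_le1.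
have [|||k hk] := @bounded_convergence_lt Q (fun k x => `|\1_[set x | (a < x ord0 i)%R] x - rho k x|)%R eta mQ Qfin eta0.
- by move=> k; exact: mdistR.
- move=> k x; rewrite normr_ge0/= indicE; have /andP[h1 h2] := rho01 k x.
  by case: (_ \in _) => /=; rewrite ler_norml; apply/andP; split; lra.
- move=> x _; have [ax|ax] := ltP a (x ord0 i); last first.
    rewrite (_ : (fun k => _) = cst 0%R); first exact: cvg_cst.
    apply/funext => k; rewrite /rho /flat pmulr_rgt0// subr_gt0 ltNge ax subr0.
    by rewrite indicE memNset ?normr0//= ltNge ax.
  rewrite indicE mem_set//.
  have xa : (0 < x ord0 i - a)%R by rewrite subr_gt0.
  have h1 : (fun k => 1 - rho k x)%R @ \oo --> (1 - 1 : R)%R.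
    by apply: cvgB; [exact: cvg_cst|exact: flat0_cvg1].
  by have := cvg_norm h1; rewrite subrr normr0; apply.
by exists (rho k).
Qed.

Lemma approximableC A : approximable Q A -> approximable Q (~` A).
Proof.
move=> [mA hA]; split; first exact: measurableC.
move=> eta /hA [rho [srho rho01 hrho]]; exists (fun x => 1 + (-1) * rho x)%R; split.
- by move=> k; apply: Ck_add; [exact: Ck_cst|apply: Ck_mul; [exact: Ck_cst|exact: srho]].
- by move=> x; have := rho01 x; lra.
rewrite (eq_integral (fun x => `|\1_A x - rho x|%:E))// => x _; congr (_%:E).
rewrite !indicE in_setC; case: (x \in A) => /=; rewrite -normrN; congr (`| _ |%R); ring.
Qed.

Lemma approximableU A B : approximable Q A -> approximable Q B -> approximable Q (A `|` B).
Proof.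
move=> [mA hA] [mB hB]; split; first exact: measurableU.
move=> eta eta0; have e2 : (0 < eta / 2)%R by rewrite divr_gt0.
have [f [sf f01 hf]] := hA _ e2; have [g [sg g01 hg]] := hB _ e2.
(* This is 1 - (1 - f)(1 - g), the product form of the indicator of a union. For values in [0, 1]
   its error is at most the sum of the two errors. *)
exists (fun x => 1 + (-1) * ((1 + (-1) * f x) * (1 + (-1) * g x)))%R; split.
- have h (u : V -> R) : smooth u -> smooth (fun x => 1 + (-1) * u x)%R.
    by move=> su k; apply: Ck_add; [exact: Ck_cst|apply: Ck_mul; [exact: Ck_cst|exact: su]].
  by apply: (h) => k; apply: Ck_mul; exact: h.
- by move=> x; have := f01 x; have := g01 x; nra.
apply: (@le_trans _ _ (\int[m]_(x in Q) (`|\1_A x - f x|%:E + `|\1_B x - g x|%:E))).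
  apply: ge0_le_integral => //.
  - apply/measurable_funTS/measurable_EFinP; apply: measurableT_comp => //.
    apply: measurable_funB; first by apply: measurable_indic; exact: measurableU.
    have := smooth_measurable sf; have := smooth_measurable sg => mg mf.
    by repeat (apply: measurable_funD || apply: measurable_funM || by []).
  - by apply: emeasurable_funD; apply/measurable_funTS; exact: mdist.
  move=> x _; rewrite -EFinD lee_fin !indicE in_setU.
  have := f01 x; have := g01 x => /andP[g0 g1] /andP[f0 f1].
  case: (x \in A); case: (x \in B) => /=.
  - rewrite !ger0_norm; nra.
  - rewrite (ger0_norm (x := 1 - f x)%R) ?subr_ge0// sub0r normrN (ger0_norm g0) ger0_norm; nra.
  - rewrite (ger0_norm (x := 1 - g x)%R) ?subr_ge0// sub0r normrN (ger0_norm f0) ger0_norm; nra.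
  - rewrite !sub0r !normrN !ger0_norm //; nra.
rewrite ge0_integralD//; [|by apply/measurable_funTS; exact: mdist..].
by apply: le_trans (leeD hf hg) _; rewrite -EFinD lee_fin; lra.
Qed.

(** Partial unions converge in L^1(Q) by bounded convergence, which is where the finite measure of
    [Q] enters; half of [eta] pays for this and half for approximating one partial union. *)
Lemma approximable_bigcup (F : (set V)^nat) : (forall i, approximable Q (F i)) ->
  approximable Q (\bigcup_i F i).
Proof.
move=> hF; have mF i : measurable (F i) by have [] := hF i.
have mU : measurable (\bigcup_i F i) by exact: bigcupT_measurable.
split => // eta eta0; have e2 : (0 < eta / 2)%R by rewrite divr_gt0.
pose G k := \big[setU/set0]_(i < k) F i.
have mG k : measurable (G k) by exact: bigsetU_measurable.
have aG k : approximable Q (G k).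
  rewrite /G; elim: k => [|k IH].
    rewrite big_ord0; split => // e e0; exists (fun=> 0%R); split.
    - by move=> k; exact: Ck_cst.
    - by move=> x; rewrite lexx ler01.
    - rewrite (eq_integral (cst 0)) ?integral0 ?lee_fin ?ltW// => x _.
      by rewrite indic0 subrr normr0.
  by rewrite big_ord_recr; exact: approximableU.
have [|||k hk] := @bounded_convergence_lt Q (fun k x => `|\1_(\bigcup_i F i) x - \1_(G k) x|)%R _ mQ Qfin e2.
- by move=> k; apply: measurableT_comp => //; apply: measurable_funB; exact: measurable_indic.
- move=> k x; rewrite normr_ge0/= !indicE.
  by do 2 case: (_ \in _) => /=; rewrite ler_norml; lra.
- move=> x _; apply: cvg_near_cst.
  have [[i _ Fx]|nx] := pselect ((\bigcup_i F i) x).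
    near=> k; rewrite !indicE mem_set ?mem_set ?subrr ?normr0//; last by exists i.
    rewrite /G -bigcup_mkord; exists i => //=; near: k; exact: nbhs_infty_gt.
  apply: nearW => k; rewrite !indicE memNset ?memNset ?subrr ?normr0//.
  by rewrite /G -bigcup_mkord => -[i _ Fx]; apply: nx; exists i.
have [_ /(_ _ e2)[rho [srho rho01 hrho]]] := aG k.
exists rho; split => //.
apply: (@le_trans _ _ (\int[m]_(x in Q) (`|\1_(\bigcup_i F i) x - \1_(G k) x|%:E + `|\1_(G k) x - rho x|%:E))).
  apply: ge0_le_integral => //.
  - by apply/measurable_funTS; exact: mdist.
  - apply: emeasurable_funD; apply/measurable_funTS; last exact: mdist.
    apply/measurable_EFinP; apply: measurableT_comp => //.
    by apply: measurable_funB; exact: measurable_indic.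
  - by move=> x _; rewrite -EFinD lee_fin; exact: ler_distD.
rewrite ge0_integralD//; last 2 first.
- apply/measurable_funTS/measurable_EFinP; apply: measurableT_comp => //.
  by apply: measurable_funB; exact: measurable_indic.
- by apply/measurable_funTS; exact: mdist.
by apply: le_trans (leeD hk hrho) _; rewrite -EFinD lee_fin; lra.
Unshelve. all: by end_near. Qed.

(** The approximable sets form a sigma-algebra that contains the half-spaces [a < x ord0 i], and
    these generate the Borel sets. Neither regularity of the measure nor mollification is
    involved. *)
Lemma measurable_approximable A : measurable A -> approximable Q A.
Proof.
have a0 : approximable Q set0.
  rewrite (_ : set0 = \bigcup_(i : nat) (set0 : set V)); last by rewrite bigcup0.
  split => [|e e0]; first exact: bigcupT_measurable.
  exists (fun=> 0%R); split.
  - by move=> k; exact: Ck_cst.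
  - by move=> x; rewrite lexx ler01.
  - rewrite (eq_integral (cst 0)) ?integral0 ?lee_fin ?ltW// => x _.
    by rewrite bigcup0// indic0 subrr normr0.
apply: smallest_sub.
  split => //; last exact: approximable_bigcup.
  by move=> B; rewrite setTD; exact: approximableC.
rewrite -bigcup_seq/= => B [i _] [Y mY <-] /=; rewrite setTI.
suff: (measurable : set (set R)) `<=` [set Y | approximable Q ((fun x : V => x ord0 i) @^-1` Y)] by apply.
have -> : (measurable : set (set R)) = _ := RGenOInfty.measurableE R.
apply: smallest_sub; first split => /=.
- by rewrite preimage_set0.
- by move=> Z; rewrite setTD preimage_setC; exact: approximableC.
- by move=> F hF; rewrite preimage_bigcup; exact: approximable_bigcup.
move=> Z [a ->] /=.
rewrite (_ : _ @^-1` _ = [set x : V | (a < x ord0 i)%R]); first exact: approximable_halfspace.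
by apply/seteqP; split => x /=; rewrite in_itv/= andbT.
Qed.

End density.

(** * Bounds for test functions: support, Taylor expansion, L^1 modulus *)

Section test_functions.
Context {R : realType} {n : nat}.
Local Notation V := 'rV[R]_n.
Local Notation m := (borel_lebesgue R n).
Implicit Types (f g : V -> R) (x y v : V).

Lemma compact_box (r : R) : compact (box r : set V).
Proof.
rewrite (_ : box r = [set v : V | forall i, `[- r, r]%classic (v ord0 i)]).
  by apply: (@rV_compact R n (fun=> `[- r, r]%classic)) => i; exact: segment_compact.
by apply/seteqP; split => x bx i; have := bx i; rewrite /= in_itv/= ler_norml.
Qed.

Lemma closed_box (r : R) : closed (box r : set V).
Proof. by apply: compact_closed; [exact: norm_hausdorff|exact: compact_box]. Qed.

Lemma compactly_supportedP (W : zmodType) (f : V -> W) :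
  compactly_supported f <-> exists2 r : R, 0 <= r & forall x, ~ box r x -> f x = 0.
Proof.
split => [/compact_bounded[M [Mr hM]]|[r r0 hr]].
  exists (`|M| + 1); first by rewrite addr_ge0.
  move=> x nbx; apply/eqP/negPn/negP => fx0; apply: nbx => i.
  have M1 : M < `|M| + 1 by rewrite (le_lt_trans (ler_norm M))// ltrDl.
  have := hM (`|M| + 1) M1 x.
  move=> /(_ (subset_closure _)) /= => /(_ fx0); apply: le_trans.
  rewrite [leRHS]mx_normrE.
  exact: (@le_bigmax _ _ _ 0 (fun ij => `|x ij.1 ij.2|) (ord0, i)).
apply: (@subclosed_compact _ _ (box r)); first exact: closed_closure.
- exact: compact_box.
- apply: (subset_trans (closureS (B := box r) _)).
    by move=> x /eqP fx0; have [//|/hr] := pselect (box r x).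
  by rewrite -(closure_id _).1//; exact: closed_box.
Qed.

Lemma test_smooth f : test_function f -> smooth f.
Proof. by case. Qed.

Lemma test_measurable f : test_function f -> measurable_fun [set: V] f.
Proof. by case=> sf _; exact: smooth_measurable. Qed.

Lemma continuous_compact_bounded f : continuous f -> compactly_supported f ->
  exists2 M : R, 0 <= M & forall x, `|f x| <= M.
Proof.
move=> sf cf.
have [[y Sy]|/nonemptyPn S0] := pselect ([set x | f x != 0] !=set0); last first.
  exists 0 => // x; have [->|fx0] := eqVneq (f x) 0; first by rewrite normr0.
  by have : [set x | f x != 0] x by []; rewrite S0.
have cn : continuous (fun x => `|f x|).
  move=> x; apply: (continuous_comp (f := f) (g := @Num.norm _ R)); last exact: norm_continuous.
  exact: sf.
have [c _ hc] := @EVT_max_rV R n (fun x => `|f x|) _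
  (ex_intro _ y (subset_closure Sy)) cf (continuous_subspaceT cn).
exists `|f c| => // x; have [->|fx0] := eqVneq (f x) 0; first by rewrite normr0.
by apply: hc; rewrite inE; exact: subset_closure.
Qed.

Lemma test_bounded f : test_function f -> exists2 M : R, 0 <= M & forall x, `|f x| <= M.
Proof. by case=> sf; apply: continuous_compact_bounded; exact: smooth_continuous. Qed.

Lemma compactly_supported_partial i f : compactly_supported f -> compactly_supported (partial i f).
Proof.
move=> /compactly_supportedP[r r0 hr].
apply/compactly_supportedP; exists r => // x nbx; rewrite /partial.
rewrite (@near_eq_derive _ _ _ f (cst 0)) ?derive_cst//.
have : open (~` (box r : set V)) by exact/closed_openC/closed_box.
by rewrite openE => /(_ x nbx); apply: filterS => y; exact: hr.
Qed.

Lemma test_partial i f : test_function f -> test_function (partial i f).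
Proof.
by move=> [sf cf]; split; [exact: smooth_partial|exact: compactly_supported_partial].
Qed.

Lemma derive_partial f x v : differentiable f x ->
  'D_v f x = \sum_(i < n) v ord0 i * partial i f x.
Proof.
move=> df; rewrite deriveE// {1}(row_sum_delta v) linear_sum/=.
by apply: eq_bigr => i _; rewrite linearZ/= /partial deriveE.
Qed.

Lemma derive_norm_le f x v (M : R) : differentiable f x ->
  (forall i, `|partial i f x| <= M) -> `|'D_v f x| <= enorm v * (n%:R * M).
Proof.
move=> df hM; rewrite derive_partial//; apply: le_trans (ler_norm_sum _ _ _) _.
apply: (@le_trans _ _ (\sum_(i < n) enorm v * M)).
  by apply: ler_sum => i _; rewrite normrM ler_pM//; exact: coord_le_enorm.
by rewrite -mulr_sumr sumr_const card_ord mulr_natl.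
Qed.

Lemma mean_value f x v : (forall y, differentiable f y) ->
  exists2 t : R, 0 <= t <= 1 & f (x + v) - f x = 'D_v f (x + t *: v).
Proof.
move=> df.
have dl (t : R) : is_diff t (fun t : R => x + t *: v) (fun h : R => h *: v).
  have : is_diff t ((cst x : R -> V) + (fun t : R => t *: v)) (0 + (fun t : R => t *: v)).
    by apply: is_diffD.
  by rewrite add0r.
have dl' (t : R) : differentiable (fun t : R => x + t *: v) t by have := dl t => ?; exact: ex_diff.
pose phi t := f (x + t *: v).
have dphi (t : R) : is_derive t (1 : R) phi ('D_v f (x + t *: v)).
  have d : differentiable (f \o (fun t : R => x + t *: v)) t by exact: differentiable_comp.
  apply: DeriveDef; first exact: diff_derivable.
  rewrite (_ : phi = f \o (fun t : R => x + t *: v))// deriveE// diff_comp//=.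
  by have := dl t => dlt; rewrite diff_val scale1r deriveE.
have cphi : {within `[0, 1], continuous phi}.
  apply: continuous_subspaceT => t; apply: differentiable_continuous.
  by apply/derivable1_diffP; have := dphi t => ?; exact: ex_derive.
have [c c01] := MVT_segment ler01 (fun t _ => dphi t) cphi.
rewrite /phi scale1r scale0r addr0 subr0 mulr1 => e.
by exists c => //; move: c01; rewrite in_itv.
Qed.

Lemma test_lipschitz f : test_function f ->
  exists2 L : R, 0 <= L & forall x v, `|f (x + v) - f x| <= L * enorm v.
Proof.
move=> tf.
have /choice[M hM] : forall i : 'I_n, exists M : R, 0 <= M /\ forall x, `|partial i f x| <= M.
  by move=> i; have [M M0 hM] := test_bounded (test_partial i tf); exists M.
have M0 : 0 <= \sum_i M i by apply: sumr_ge0 => i _; have [] := hM i.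
exists (n%:R * (\sum_i M i)); first by rewrite mulr_ge0.
move=> x v; have [t _ ->] := mean_value x v (smooth_differentiable (test_smooth tf)).
rewrite mulrC; apply: derive_norm_le; first exact: smooth_differentiable (test_smooth tf) _.
move=> i; have [_ h] := hM i; apply: le_trans (h _) _.
by rewrite (bigD1 i)//= lerDl sumr_ge0// => j _; have [] := hM j.
Qed.

Lemma test_derive_lipschitz f v : test_function f ->
  exists2 L : R, 0 <= L & forall x y, `|'D_v f (x + y) - 'D_v f x| <= L * enorm y.
Proof.
move=> tf.
have /choice[L hL] : forall i : 'I_n, exists L : R, 0 <= L /\
    forall x y, `|partial i f (x + y) - partial i f x| <= L * enorm y.
  by move=> i; have [L L0 hL] := test_lipschitz (test_partial i tf); exists L.
exists (\sum_i `|v ord0 i| * L i).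
  by apply: sumr_ge0 => i _; rewrite mulr_ge0//; have [] := hL i.
have df := smooth_differentiable (test_smooth tf).
move=> x y; rewrite !derive_partial// -sumrB mulr_suml.
apply: le_trans (ler_norm_sum _ _ _) _; apply: ler_sum => i _.
by rewrite -mulrBr normrM -mulrA ler_wpM2l//; have [_] := hL i.
Qed.

(** The directional derivative is itself Lipschitz, so the mean value theorem leaves an error
    quadratic in [t], uniform in [x] and valid for both signs of [t]. *)
Lemma test_taylor f v : test_function f ->
  exists2 L : R, 0 <= L & forall x (t : R),
    `|f (x + t *: v) - f x - t * 'D_v f x| <= L * t ^+ 2.
Proof.
move=> tf; have [L L0 hL] := test_derive_lipschitz v tf.
have df := smooth_differentiable (test_smooth tf).
exists (L * enorm v); first by rewrite mulr_ge0// enorm_ge0.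
move=> x t; have [c /andP[c0 c1] ->] := mean_value x (t *: v) df.
have DZ y : 'D_(t *: v) f y = t * 'D_v f y by rewrite !deriveE// linearZ.
rewrite DZ -mulrBr normrM.
apply: le_trans (ler_wpM2l (normr_ge0 _) (hL _ _)) _.
rewrite scalerA enormZ normrM (ger0_norm c0).
rewrite (_ : `|t| * _ = c * (L * enorm v * `|t| ^+ 2)); last by ring.
rewrite real_normK ?num_real// -[leRHS]mul1r ler_wpM2r//.
by rewrite mulr_ge0 ?sqr_ge0// mulr_ge0 ?enorm_ge0.
Qed.

Local Open Scope ereal_scope.

(** The increment vanishes unless [x] or [x + h] lies in the cube that carries [f], so the Lipschitz
    bound is integrated over measure at most [2 * (2 * r) ^+ n]. This is for test functions what the
    perimeter bound is for sets, and it controls the near part of the kernel in the uniqueness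
    proof. *)
Lemma test_L1_lipschitz f : test_function f ->
  exists2 C : R, (0 <= C)%R &
    forall h, \int[m]_x `|f (x + h) - f x|%:E <= (C * enorm h)%:E.
Proof.
move=> tf; have [L L0 hL] := test_lipschitz tf.
have [r r0 hr] := (compactly_supportedP _).1 tf.2.
exists (L * (2 * (2 * r) ^+ n))%R.
  by rewrite !mulr_ge0// exprn_ge0// mulr_ge0.
move=> h.
have mb : measurable_fun [set: V] (fun x => (\1_(box r : set V) x : R)%:E).
  by apply/measurable_EFinP; apply: measurable_indic; exact: measurable_box.
have ms : measurable_fun [set: V] (fun x : V => x + h)%R.
  by apply: measurable_rowD => //; exact: measurable_cst.
have mf := test_measurable tf.
apply: (@le_trans _ _ (\int[m]_x ((L * enorm h)%:E * ((\1_(box r : set V) x)%:E + (\1_(box r : set V) (x + h)%R)%:E)))).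
  apply: ge0_le_integral => //.
  - apply/measurable_EFinP; apply: measurableT_comp => //; apply: measurable_funB => //.
    exact: (measurableT_comp mf ms).
  - apply: measurable_funeM; apply: emeasurable_funD => //; exact: (measurableT_comp mb ms).
  - move=> x _; rewrite -EFinD -EFinM lee_fin !indicE.
    have [bx|bx] := pselect (box r x).
      rewrite (mem_set bx); apply: le_trans (hL _ _) _; rewrite ler_peMr ?mulr_ge0 ?enorm_ge0//.
      by case: (_ \in _); rewrite /= ?addr0// lerDl.
    have [bxh|bxh] := pselect (box r (x + h)%R).
      rewrite (mem_set bxh); apply: le_trans (hL _ _) _; rewrite ler_peMr ?mulr_ge0 ?enorm_ge0//.
      by rewrite lerDr.
    by rewrite (hr _ bx) (hr _ bxh) subrr normr0 !mulr_ge0// ?enorm_ge0// addr_ge0.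
rewrite ge0_integralZl_EFin//; last 3 first.
- by move=> x _; rewrite adde_ge0.
- by apply: emeasurable_funD => //; exact: (measurableT_comp mb ms).
- by rewrite mulr_ge0// enorm_ge0.
rewrite ge0_integralD//; last exact: (measurableT_comp mb ms).
rewrite (integral_shift h mb) integral_indic//; last exact: measurable_box.
rewrite setIT [X in X + X]borel_lebesgue_box// -EFinD -EFinM lee_fin le_eqVlt.
by apply/orP; left; apply/eqP; ring.
Qed.

End test_functions.

Section test_algebra.
Context {R : realType} {n : nat}.
Local Notation V := 'rV[R]_n.
Implicit Types (f g : V -> R) (a x v : V).

Lemma test_add f g : test_function f -> test_function g -> test_function (fun x => f x + g x).
Proof.
move=> [sf /compactly_supportedP[r r0 hr]] [sg /compactly_supportedP[r' r0' hr']].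
split; first by move=> k; exact: Ck_add.
apply/compactly_supportedP; exists (r + r'); first exact: addr_ge0.
move=> x nb; rewrite hr ?hr' ?addr0// => bx; apply: nb => i; apply: le_trans (bx i) _;
  by rewrite ?lerDl ?lerDr.
Qed.

Lemma test_mul f g : smooth f -> test_function g -> test_function (fun x => f x * g x).
Proof.
move=> sf [sg /compactly_supportedP[r r0 hr]]; split; first by move=> k; exact: Ck_mul.
by apply/compactly_supportedP; exists r => // x /hr ->; rewrite mulr0.
Qed.

Lemma test_scale (c : R) f : test_function f -> test_function (fun x => c * f x).
Proof. by apply: test_mul => k; exact: Ck_cst. Qed.

Lemma test0 : test_function (fun _ : V => 0 : R).
Proof.
by split=> [k|]; [exact: Ck_cst|apply/compactly_supportedP; exists 0].
Qed.

Lemma test_sum (I : Type) (r : seq I) (F : I -> V -> R) :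
  (forall i, test_function (F i)) -> test_function (fun x => \sum_(i <- r) F i x).
Proof.
move=> hF; elim: r => [|i r IH].
  by rewrite (_ : (fun x => _) = fun=> 0); [exact: test0|apply/funext => x; rewrite big_nil].
rewrite (_ : (fun x => _) = fun x => F i x + \sum_(i <- r) F i x); first exact: test_add.
by apply/funext => x; rewrite big_cons.
Qed.

Lemma test_affine f a (c : R) : `|c| = 1 -> test_function f ->
  test_function (fun x => f (a + c *: x)).
Proof.
move=> c1 [sf /compactly_supportedP[r r0 hr]]; split; first by move=> k; exact: Ck_affine.
apply/compactly_supportedP; exists (r + enorm a); first by rewrite addr_ge0// enorm_ge0.
move=> x nb; apply: hr => b; apply: nb => i; have := b i; rewrite !mxE.
have := coord_le_enorm a i => ai h.
rewrite -[leLHS]mul1r -c1 -normrM.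
rewrite (_ : c * x ord0 i = (a ord0 i + c * x ord0 i) - a ord0 i); last by ring.
by apply: le_trans (ler_normB _ _) _; exact: lerD.
Qed.

Lemma test_shift f a : test_function f -> test_function (fun x => f (x + a)).
Proof.
move=> tf; rewrite (_ : (fun x => _) = fun x => f (a + 1 *: x)).
  by apply: test_affine => //; rewrite normr1.
by apply/funext => x; rewrite scale1r addrC.
Qed.

End test_algebra.

Section test_density.
Context {R : realType} {n : nat}.
Local Notation V := 'rV[R]_n.
Local Notation m := (borel_lebesgue R n).
Local Open Scope ereal_scope.

Definition obox (N : R) : set V := [set x | forall i, (`|x ord0 i| < N)%R].

Lemma measurable_obox N : measurable (obox N).
Proof.
rewrite (_ : obox N = \bigcap_(i in [set: 'I_n]) ((fun x : V => x ord0 i) @^-1` `](- N)%R, N[%classic)).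
  apply: fin_bigcap_measurable => // i _.
  by rewrite -[X in measurable X]setTI; exact: measurable_coord.
apply/seteqP; split => [x bx i _|x bx i] /=.
  by rewrite in_itv/= -ltr_norml.
by have := bx i I; rewrite /= in_itv/= -ltr_norml.
Qed.

Lemma obox_near (x : V) : \forall k \near \oo, obox k%:R x.
Proof.
have : \forall k \near \oo, (\sum_i `|x ord0 i| < k%:R)%R by exact: nbhs_infty_gtr.
apply: filterS => k hk i; apply: le_lt_trans hk.
by rewrite (bigD1 i)//= lerDl sumr_ge0.
Qed.

(** Three errors of size eta/3: cutting [A] down to an open cube O, approximating the indicator of
    [A] cut with O by a smooth [f] on the closed cube, and multiplying [f] by smooth cut-offs that
    increase to the indicator of O. *)
Lemma test_density (A : set V) (eta : R) : measurable A -> m A < +oo -> (0 < eta)%R ->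
  exists rho : V -> R, [/\ test_function rho, forall x, (0 <= rho x <= 1)%R &
    \int[m]_x `|\1_A x - rho x|%:E <= eta%:E].
Proof.
move=> mA Afin eta0; have e3 : (0 < eta / 3)%R by rewrite divr_gt0.
have mo N := measurable_obox N.
have [|||N0 hN0] := @bounded_convergence_lt R n A (fun k x => \1_(~` obox k%:R) x)%R _ mA Afin e3.
- by move=> k; apply: measurable_indic; exact: measurableC.
- by move=> k x; rewrite indicE; case: (_ \in _); rewrite /= ?lexx ?ler01.
- move=> x _; apply: cvg_near_cst; have := obox_near x; apply: filterS => k ok.
  by rewrite indicE memNset.
set N : R := N0%:R in hN0; have N_ge0 : (0 <= N)%R by [].
pose O := obox N; pose Q := box N : set V.
have mQ : measurable Q by exact: measurable_box.
have Qfin : m Q < +oo by rewrite /Q [X in X < _]borel_lebesgue_box// ltry.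
have mAO : measurable (A `&` O) by apply: measurableI => //; exact: mo.
have [_ /(_ _ e3)[f [sf f01 hf]]] := measurable_approximable mQ Qfin mAO.
(* For each coordinate the two factors are both nonzero only when |x_i| < N, so [theta k] vanishes
   outside the open cube, while it tends to 1 at every point inside. *)
pose theta k (x : V) := (\prod_(i < n) (flat 0 (k.+1%:R * (x ord0 i + N)) * flat 0 (k.+1%:R * (N + (-1) * x ord0 i))))%R.
have stheta k : smooth (theta k).
  have h : forall r : seq 'I_n, smooth (fun x : V => \prod_(i <- r) (flat 0 (k.+1%:R * (x ord0 i + N)) * flat 0 (k.+1%:R * (N + (-1) * x ord0 i))))%R.
    elim=> [|i r IH].
      rewrite (_ : (fun x : V => _) = fun=> 1%R); first by move=> j; exact: Ck_cst.
      by apply/funext => x; rewrite big_nil.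
    rewrite (_ : (fun x : V => _) = fun x : V => (flat 0 (k.+1%:R * (x ord0 i + N)) * flat 0 (k.+1%:R * (N + (-1) * x ord0 i)) * \prod_(i <- r) (flat 0 (k.+1%:R * (x ord0 i + N)) * flat 0 (k.+1%:R * (N + (-1) * x ord0 i))))%R); last first.
      by apply/funext => x; rewrite big_cons.
    move=> j; apply: Ck_mul; last exact: IH.
    apply: Ck_mul; apply: Ck_comp; try exact: Dk_flat.
      by apply: Ck_mul; [exact: Ck_cst|apply: Ck_add; [exact: Ck_coord|exact: Ck_cst]].
    apply: Ck_mul; first exact: Ck_cst.
    by apply: Ck_add; [exact: Ck_cst|apply: Ck_mul; [exact: Ck_cst|exact: Ck_coord]].
  exact: h.
have theta01 k x : (0 <= theta k x <= 1)%R.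
  have h i : (0 <= flat 0 (k.+1%:R * (x ord0 i + N)) * flat 0 (k.+1%:R * (N + (-1) * x ord0 i)) <= 1)%R.
    by rewrite mulr_ge0 ?flat_ge0//= mulr_ile1 ?flat_ge0 ?flat0_le1.
  rewrite /theta; elim/big_ind : _ => // [|a b /andP[a0 a1] /andP[b0 b1]]; first by rewrite ler01 lexx.
  by rewrite mulr_ge0//= mulr_ile1.
have theta0 k x : ~ O x -> theta k x = 0%R.
  move=> nO; have [i hi] : exists i : 'I_n, (N <= `|x ord0 i|)%R.
    by apply: contrapT => nh; apply: nO => i; rewrite ltNge; apply/negP => h; apply: nh; exists i.
  rewrite /theta (bigD1 i)//=.
  suff -> : (flat 0 (k.+1%:R * (x ord0 i + N)) * flat 0 (k.+1%:R * (N + (-1) * x ord0 i)) = 0 :> R)%R.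
    by rewrite mul0r.
  have [x0|x0] := leP 0%R (x ord0 i).
    rewrite (_ : flat 0 (k.+1%:R * (N + _))%R = 0%R) ?mulr0//.
    rewrite /flat ifF// pmulr_rgt0//; apply/negbTE; rewrite -leNgt; rewrite ger0_norm// in hi; lra.
  rewrite (_ : flat 0 (k.+1%:R * (_ + N))%R = 0%R) ?mul0r//.
  rewrite /flat ifF// pmulr_rgt0//; apply/negbTE; rewrite -leNgt; rewrite ltr0_norm// in hi; lra.
have Ofin : m O < +oo.
  apply: le_lt_trans Qfin; apply: le_measure; rewrite ?inE//; first exact: mo.
  by move=> x Ox i; exact/ltW/Ox.
have mth k : measurable_fun [set: V] (fun x => 1 - theta k x)%R.
  by apply: measurable_funB => //; exact: smooth_measurable.
have [|||k hk] := @bounded_convergence_lt R n O (fun k x => 1 - theta k x)%R _ (mo N) Ofin e3.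
- exact: mth.
- by move=> k x; have := theta01 k x; lra.
- move=> x Ox; rewrite -(subrr (1%R : R)); apply: cvgB; first exact: cvg_cst.
  rewrite (_ : (1 = \prod_(i < n) (1%R : R))%R); last by rewrite big1.
  apply: cvg_big; first exact: mul_continuous.
  move=> i _; rewrite -[X in _ --> X]mulr1; have := Ox i; rewrite ltr_norml => /andP[h1 h2].
  by apply: cvgM; apply: flat0_cvg1; lra.
have sft : smooth (fun x => f x * theta k x)%R by move=> j; apply: Ck_mul; [exact: sf|exact: stheta].
exists (fun x => f x * theta k x)%R; split.
- split; first exact: sft.
  apply/compactly_supportedP; exists N => // x nb; rewrite theta0 ?mulr0// => Ox; apply: nb => i.
  exact/ltW/Ox.
- move=> x; have /andP[f0 f1] := f01 x; have /andP[t0 t1] := theta01 k x.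
  by rewrite mulr_ge0//= mulr_ile1.
rewrite integral_mkcond in hN0.
rewrite integral_mkcond in hf.
rewrite integral_mkcond in hk.
have mi D (g : V -> R) : measurable D -> measurable_fun [set: V] g ->
  measurable_fun [set: V] ((fun x => (g x)%:E) \_ D).
  move=> mD mg; apply/(measurable_restrictT _ mD)/measurable_funTS.
  exact/measurable_EFinP.
have mI : measurable_fun [set: V] (\1_(~` obox N) : V -> R).
  by apply: measurable_indic; exact: measurableC.
have m1 := mi A _ mA mI.
have m2 : measurable_fun [set: V] ((fun x => `|\1_(A `&` O) x - f x|%:E) \_ Q).
  apply: mi => //; apply: measurableT_comp => //; apply: measurable_funB; first exact: measurable_indic.
  exact: smooth_measurable.
have m3 := mi O _ (mo N) (mth k).
(* Outside O the approximant is 0 and only [A] itself contributes. Inside O, |chi_A - f theta| <=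
   |chi_A - f| + (1 - theta), because 0 <= f <= 1. *)
apply: (@le_trans _ _ (\int[m]_x (((fun x => (\1_(~` obox N) x)%:E) \_ A) x
   + (((fun x => `|\1_(A `&` O) x - f x|%:E) \_ Q) x + ((fun x => (1 - theta k x)%:E) \_ O) x)))).
  apply: ge0_le_integral => //.
  - apply/measurable_EFinP; apply: measurableT_comp => //; apply: measurable_funB; first exact: measurable_indic.
    exact: smooth_measurable.
  - by apply: emeasurable_funD => //; exact: emeasurable_funD.
  move=> x _; have /andP[f0 f1] := f01 x; have /andP[t0 t1] := theta01 k x.
  rewrite !patchE.
  have [Ox|nOx] := pselect (O x).
    have Qx : Q x by move=> i; exact/ltW/Ox.
    have eO : \1_(~` obox N) x = 0%R :> R by rewrite indicE memNset.
    rewrite (mem_set Ox) (mem_set Qx) eO.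
    rewrite if_same add0e -EFinD lee_fin !indicE in_setI (mem_set Ox) andbT.
    case: (x \in A) => /=.
      by rewrite ger0_norm ?subr_ge0 ?mulr_ile1// ger0_norm ?subr_ge0//; nra.
    by rewrite !sub0r !normrN !ger0_norm ?mulr_ge0//; nra.
  rewrite theta0// mulr0 subr0 (memNset nOx) adde0 ger0_norm//.
  have eO : \1_(~` obox N) x = 1%R :> R by rewrite indicE mem_set.
  rewrite eO indicE.
  have h0 : 0 <= (if x \in Q then `|\1_(A `&` O) x - f x|%:E else point).
    by case: ifP => // _; rewrite lee_fin.
  by case: (x \in A); [exact: leeDl|exact: adde_ge0].
have j1 (x : V) : 0 <= ((fun x => (\1_(~` obox N) x : R)%:E) \_ A) x.
  by rewrite patchE; case: ifP => // _; rewrite lee_fin indicE.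
have j2 (x : V) : 0 <= ((fun x => `|\1_(A `&` O) x - f x|%:E) \_ Q) x.
  by rewrite patchE; case: ifP => // _; rewrite lee_fin.
have j3 (x : V) : 0 <= ((fun x => (1 - theta k x)%:E) \_ O) x.
  by rewrite patchE; case: ifP => // _; rewrite lee_fin; have := theta01 k x; lra.
rewrite (ge0_integralD m measurableT (fun x _ => j1 x) m1 (fun x _ => adde_ge0 (j2 x) (j3 x)) (emeasurable_funD m2 m3)).
rewrite (ge0_integralD m measurableT (fun x _ => j2 x) m2 (fun x _ => j3 x) m3).
apply: le_trans (leeD hN0 (leeD hf hk)) _.
by rewrite -!EFinD lee_fin; lra.
Qed.

End test_density.

(** * Translations and lower semicontinuity of the perimeter *)

Section perimeter.
Context {R : realType} {n : nat}.
Local Notation V := 'rV[R]_n.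
Local Notation m := (borel_lebesgue R n).

Lemma integrable_indicM (A : set V) (F : V -> R) (M : R) : measurable A -> (m A < +oo)%E ->
  measurable_fun [set: V] F -> (forall x, `|F x| <= M) ->
  m.-integrable setT (fun x => (\1_A x * F x)%:E).
Proof.
move=> mA Afin mF hM.
have M0 : 0 <= M by apply: le_trans (hM 0).
apply/integrableP; split.
  by apply/measurable_EFinP; apply: measurable_funM => //; exact: measurable_indic.
apply: (@le_lt_trans _ _ (\int[m]_x (M%:E * (\1_A x)%:E))%E).
  apply: ge0_le_integral => //.
  - apply/measurable_EFinP; apply: measurableT_comp => //.
    by apply: measurable_funM => //; exact: measurable_indic.
  - by apply: measurable_funeM; apply/measurable_EFinP; exact: measurable_indic.
  - move=> x _; rewrite /= lee_fin normrM mulrC ler_pM//.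
    by rewrite indicE; case: (_ \in _); rewrite /= ?normr1 ?normr0.
rewrite ge0_integralZl_EFin//; last by apply/measurable_EFinP; exact: measurable_indic.
by rewrite integral_indic// setIT lte_mul_pinfty.
Qed.

Lemma Rintegral_indic d (T : measurableType d) (mu : {measure set T -> \bar R}) (A : set T) (F : T -> R) :
  \int[mu]_(x in A) F x = \int[mu]_x (\1_A x * F x).
Proof.
rewrite Rintegral_mkcond; congr fine; apply: eq_integral => x _.
by rewrite patchE indicE; case: (_ \in _) => /=; rewrite ?mul1r ?mul0r.
Qed.

Lemma test_field_divergence (X : V -> V) : test_field X ->
  measurable_fun [set: V] (divergence X) /\
  exists2 M : R, 0 <= M & forall x, `|divergence X x| <= M.
Proof.
move=> [C1 cX _].
have cXi i : compactly_supported (fun y => X y ord0 i).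
  have [r r0 hr] := (compactly_supportedP _).1 cX.
  by apply/compactly_supportedP; exists r => // x /hr ->; rewrite mxE.
have cp i : continuous (partial i (fun y => X y ord0 i)) by have [_] := C1 i; apply.
split.
  apply: measurable_sum => i; exact: continuous_measurable_row.
have /choice[M hM] : forall i : 'I_n, exists M : R, 0 <= M /\
    forall x, `|partial i (fun y => X y ord0 i) x| <= M.
  move=> i; have [M M0 hM] := continuous_compact_bounded (cp i) (@compactly_supported_partial _ _ i _ (cXi i)).
  by exists M.
exists (\sum_i M i); first by apply: sumr_ge0 => i _; have [] := hM i.
move=> x; apply: le_trans (ler_norm_sum _ _ _) _.
by apply: ler_sum => i _; have [_] := hM i.
Qed.

Lemma perimeterE (B : set V) : measurable B ->
  perimeter B = ereal_sup [set (\int[m]_x (\1_B x * divergence X x))%:E | X in test_field].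
Proof.
move=> mB; rewrite /perimeter; congr ereal_sup; apply: eq_imagel => X tX.
have [mX _] := test_field_divergence tX.
rewrite Rintegral_indic; congr (fine _)%:E; apply: integral_leb.
by apply/measurable_EFinP; apply: measurable_funM => //; exact: measurable_indic.
Qed.

Lemma perimeter_ge (B : set V) (X : V -> V) : measurable B -> test_field X ->
  ((\int[m]_x (\1_B x * divergence X x))%:E <= perimeter B)%E.
Proof. by move=> mB tX; rewrite perimeterE//; apply: ereal_sup_ubound; exists X. Qed.

Lemma perimeter_ge0 (B : set V) : (0 <= perimeter B)%E.
Proof.
apply: ereal_sup_ubound; exists (fun=> 0).
  split.
  - move=> i; rewrite (_ : (fun _ => _) = fun=> 0); first exact: Ck_cst.
    by apply/funext => x; rewrite mxE.
  - by apply/compactly_supportedP; exists 0.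
  - by move=> x; rewrite enorm0.
rewrite Rintegral_indic (_ : (fun x => _) = cst 0) ?/Rintegral ?integral0//.
apply/funext => x; rewrite /divergence big1 ?mulr0// => i _.
rewrite /partial (_ : (fun _ => _) = cst 0); first exact: derive_cst.
by apply/funext => y; rewrite mxE.
Qed.

(** The increment psi(x - h) - psi(x) equals |h| div X for the field X(x) = -(h/|h|) int_0^1 psi(x -
    t h) dt, whose norm is at most 1. Replacing the integral over t by a finite sum keeps X visibly
    a test field and costs an error that vanishes as the partition is refined. *)
Lemma perimeter_test (B : set V) (psi : V -> R) (h : V) (p : R) :
  measurable B -> (m B < +oo)%E -> (perimeter B <= p%:E)%E -> test_function psi ->
  (forall x, `|psi x| <= 1) ->
  \int[m]_x (\1_B x * (psi (x - h) - psi x)) <= enorm h * p.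
Proof.
move=> mB Bfin Bp tpsi psi1.
have [->|h0] := eqVneq h 0.
  rewrite enorm0 mul0r (_ : (fun x => _) = cst 0) ?/Rintegral ?integral0//.
  by apply/funext => x; rewrite subr0 subrr mulr0.
have hn := enorm_gt0 h0.
have [L L0 hL] := test_taylor h tpsi.
have [b bE] : exists b : R, m B = b%:E.
  by exists (fine (m B)); rewrite fineK// ge0_fin_numE.
have b0 : 0 <= b by rewrite -lee_fin -bE.
apply/ler_addgt0Pr => e e0.
(* The sum approximates the increment with error L/N at each point, hence L b/N after integration
   over a set of measure b; N makes this at most e. *)
pose N := (Num.truncn (L * b / e)).+1.
have N0 : 0 < N%:R :> R by [].
have iN : 0 <= N%:R^-1 :> R by rewrite invr_ge0 ltW.
have Ne : L * b / N%:R <= e.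
  rewrite ler_pdivrMr// -ler_pdivrMl// mulrC.
  exact/ltW/truncnS_gt.
(* A Riemann sum of [psi] along [- h], times [h]: the divergence of this field is
   nearly the difference quotient of [psi]. *)
pose a k : V := - (k%:R / N%:R) *: h.
pose g x := \sum_(k < N) (N%:R^-1 * psi (x + a k)).
have tg : test_function g.
  by apply: test_sum => k; apply: test_scale; exact: test_shift.
have dpsi := smooth_differentiable (test_smooth tpsi).
have dg := smooth_differentiable (test_smooth tg).
have Dg x : 'D_h g x = \sum_(k < N) N%:R^-1 * 'D_h psi (x + a k).
  have dk (k : 'I_N) y : differentiable (fun x => psi (x + a k)) y.
    exact: smooth_differentiable (test_smooth (test_shift (a k) tpsi)) y.
  rewrite (_ : g = \sum_(k < N) (N%:R^-1 \*o (fun x => psi (x + a k)))); last first.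
    by apply/funext => y; rewrite fct_sumE.
  rewrite derive_sum => [|k]; last first.
    by apply: derivableM; [exact: derivable_cst|exact: diff_derivable].
  apply: eq_bigr => k _; rewrite deriveMl; last exact: diff_derivable.
  congr (_ * _).
  rewrite (_ : (fun x => _) = fun x => psi (a k + 1 *: x)); last first.
    by apply/funext => y; rewrite scale1r addrC.
  by rewrite derive_affine// mul1r scale1r addrC.
pose X (x : V) : V := (- (enorm h)^-1 * g x) *: h.
have tX : test_field X.
  split.
  - move=> i; rewrite (_ : (fun y => _) = fun y => (- (enorm h)^-1 * h ord0 i) * g y).
      by apply: Ck_mul; [exact: Ck_cst|exact: (test_smooth tg)].
    by apply/funext => y; rewrite mxE mulrAC.
  - have [r r0 hr] := (compactly_supportedP _).1 tg.2.
    by apply/compactly_supportedP; exists r => // x /hr; rewrite /X => ->; rewrite mulr0 scale0r.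
  - move=> x; rewrite enormZ normrM normrN normfV (gtr0_norm hn) mulrAC mulVf ?gt_eqF// mul1r.
    apply: le_trans (ler_norm_sum _ _ _) _.
    apply: (@le_trans _ _ (\sum_(k < N) N%:R^-1)).
      apply: ler_sum => k _; rewrite normrM (ger0_norm iN).
      by rewrite ler_piMr // psi1.
    by rewrite sumr_const card_ord -[_ *+ _]mulr_natl divff// gt_eqF.
have divX x : divergence X x = - (enorm h)^-1 * 'D_h g x.
  rewrite derive_partial// mulr_sumr; apply: eq_bigr => i _.
  rewrite /partial (_ : (fun y => _) = (- (enorm h)^-1 * h ord0 i) \*o g); last first.
    by apply/funext => y; rewrite /= mxE mulrAC.
  by rewrite deriveMl ?mulrA//; exact: diff_derivable.
have key x : psi (x - h) - psi x <= enorm h * divergence X x + L / N%:R.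
  rewrite divX mulrA mulrN mulfV ?gt_eqF// mulN1r Dg.
  have -> : psi (x - h) - psi x = \sum_(k < N) (psi (x + a k.+1) - psi (x + a k)).
    rewrite -(big_mkord xpredT (fun k => psi (x + a k.+1) - psi (x + a k))) telescope_sumr//.
    by rewrite /a mul0r oppr0 scale0r addr0 divff ?gt_eqF// scaleN1r.
  rewrite addrC -lerBlDr opprK -big_split/=.
  (* The increment telescopes along the points [x + a k]. Each piece is a Taylor expansion with step
     -1/N and error L/N^2, and there are N of them. *)
  apply: (@le_trans _ _ (\sum_(k < N) L * N%:R ^- 2)).
    apply: ler_sum => k _.
    have := hL (x + a k) (- N%:R^-1).
    rewrite sqrrN -exprVn (_ : x + a k + - N%:R^-1 *: h = x + a k.+1).
      by rewrite mulNr opprK => /(le_trans (ler_norm _)).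
    rewrite -addrA; congr (_ + _); rewrite /a -scalerDl; congr (_ *: _).
    by rewrite -addn1 natrD mulrDl mul1r opprD.
  rewrite sumr_const card_ord -mulr_natl le_eqVlt; apply/orP; left; apply/eqP.
  by field; rewrite gt_eqF.
have [mX [M M0 hM]] := test_field_divergence tX.
have idiv := integrable_indicM mB Bfin mX hM.
have ic : m.-integrable setT (fun x => (\1_B x * (L / N%:R))%:E).
  exact: (@integrable_indicM _ _ `|L / N%:R|).
have ih : m.-integrable setT (fun x => (\1_B x * (psi (x - h) - psi x))%:E).
  apply: (@integrable_indicM _ _ 2) => //.
    by apply: measurable_funB; [exact: test_measurable (test_shift (- h) tpsi)|exact: test_measurable].
  by move=> x; apply: le_trans (ler_normB _ _) _; have := psi1 (x - h); have := psi1 x; lra.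
apply: (@le_trans _ _ (\int[m]_x (enorm h * (\1_B x * divergence X x) + \1_B x * (L / N%:R)))).
  apply: le_Rintegral => //.
    exact: (integrableD measurableT (integrableZl measurableT (enorm h) idiv) ic).
  move=> x _; have := key x; rewrite indicE; case: (_ \in _) => /=; rewrite ?mul1r//.
  by rewrite !mul0r mulr0 addr0.
rewrite RintegralD//; last exact: (integrableZl measurableT (enorm h) idiv).
rewrite RintegralZl//; apply: lerD.
  apply: ler_wpM2l; first exact: ltW.
  by rewrite -lee_fin; apply: le_trans Bp; exact: perimeter_ge.
rewrite -Rintegral_indic Rintegral_cst// [X in fine X]bE/=; apply: le_trans Ne.
by rewrite mulrAC.
Qed.

(** Duality: the L^1 norm of the translation difference is obtained by pairing it with nearly its
    own sign. A change of variables moves the translation from [B] to the test function, where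
    [perimeter_test] applies. *)
Lemma perimeter_translation (B : set V) (h : V) (p : R) :
  measurable B -> (m B < +oo)%E -> (perimeter B <= p%:E)%E ->
  (\int[m]_x `|\1_B (x + h)%R - \1_B x|%:E <= (enorm h * p)%:E)%E.
Proof.
move=> mB Bfin Bp; apply/lee_addgt0Pr => e e0.
have e2 : 0 < e / 2 by rewrite divr_gt0.
have ms : measurable_fun [set: V] (fun x : V => x + h).
  by apply: measurable_rowD => //; exact: measurable_cst.
pose C := (fun x : V => x + h) @^-1` B.
have mC : measurable C by rewrite -[C]setTI; exact: ms.
have CE x : \1_B (x + h) = \1_C x :> R by rewrite !indicE.
have mi (A : set V) : measurable A -> measurable_fun [set: V] (fun x => (\1_A x : R)%:E).
  by move=> mA; apply/measurable_EFinP; exact: measurable_indic.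
have Cfin : (m C < +oo)%E.
  rewrite -(setIT C) -integral_indic//; under eq_integral do rewrite -CE.
  by rewrite (integral_shift h (mi _ mB)) integral_indic// setIT.
have [f [tf f01 hf]] := test_density mC Cfin e2.
have [g [tg g01 hg]] := test_density mB Bfin e2.
(* Nearly the sign of chi_C - chi_B. It is bounded by 1 because [f] and [g] take values in
   [0, 1]. *)
pose psi x := f x + (-1) * g x.
have tpsi : test_function psi by apply: test_add => //; exact: test_scale.
have psi1 x : `|psi x| <= 1.
  by rewrite ler_norml /psi; have := f01 x; have := g01 x; lra.
have hpsi := perimeter_test h mB Bfin Bp tpsi psi1.
have mpsi := test_measurable tpsi.
have mpsih : measurable_fun [set: V] (fun x => psi (x - h)).
  exact: test_measurable (test_shift (- h) tpsi).
have iB := integrable_indicM mB Bfin mpsi psi1.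
have iC := integrable_indicM mC Cfin mpsi psi1.
have iBh := integrable_indicM mB Bfin mpsih (fun x => psi1 (x - h)).
have E1 : \int[m]_x (\1_C x * psi x) = \int[m]_x (\1_B x * psi (x - h)).
  rewrite /Rintegral; congr fine.
  rewrite -(integral_shift h (f := fun x => (\1_B x * psi (x - h))%:E)).
    by apply: eq_integral => x _; rewrite addrK CE.
  by apply/measurable_EFinP; apply: measurable_funM => //; exact: measurable_indic.
have hE : \int[m]_x (\1_C x * psi x - \1_B x * psi x) <= enorm h * p.
  rewrite RintegralB// E1 -RintegralB//; apply: le_trans hpsi.
  by rewrite le_eqVlt; apply/orP; left; apply/eqP; apply: eq_Rintegral => x _; rewrite mulrBr.
have iCB : m.-integrable setT (EFin \o (fun x => \1_C x * psi x - \1_B x * psi x)).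
  exact: (integrableB measurableT iC iB).
have md (A : set V) (u : V -> R) : measurable A -> test_function u ->
    measurable_fun [set: V] (fun x => `|\1_A x - u x|).
  move=> mA tu; apply: measurableT_comp => //; apply: measurable_funB; first exact: measurable_indic.
  exact: test_measurable.
have I1 (A : set V) (u : V -> R) : measurable A -> test_function u ->
    (\int[m]_x `|\1_A x - u x|%:E <= (e / 2)%:E)%E ->
    m.-integrable setT (EFin \o (fun x => `|\1_A x - u x|)).
  move=> mA tu hu; apply/integrableP; split; first by apply/measurable_EFinP; exact: md.
  apply: le_lt_trans (ltry (e / 2)); apply: le_trans hu.
  by under eq_integral do rewrite /= normr_id.
have IC := I1 _ _ mC tf hf; have IB := I1 _ _ mB tg hg.
(* A difference of two indicators takes the values -1, 0 and 1, so its modulus is its square; one of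
   the two factors can then be replaced by [psi] at the cost of the two approximation errors. *)
have -> : (\int[m]_x `|\1_B (x + h)%R - \1_B x|%:E = \int[m]_x ((\1_C x - \1_B x)^+2)%:E)%E.
  apply: eq_integral => x _; rewrite CE !indicE; congr (_%:E).
  by do 2 case: (_ \in _) => /=; rewrite ?subrr ?subr0 ?sub0r ?normrN ?normr1 ?normr0 ?expr0n ?sqrrN ?expr1n.
apply: (@le_trans _ _ (\int[m]_x ((\1_C x * psi x - \1_B x * psi x)%:E + (`|\1_C x - f x|%:E + `|\1_B x - g x|%:E)))%E).
  apply: ge0_le_integral => //.
  - by move=> x _; rewrite lee_fin sqr_ge0.
  - apply/measurable_EFinP; apply: measurable_funX.
    by apply: measurable_funB; exact: measurable_indic.
  - apply: emeasurable_funD; first exact: measurable_int iCB.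
    by apply: emeasurable_funD; apply/measurable_EFinP; exact: md.
  - move=> x _; rewrite -!EFinD lee_fin /psi !indicE.
    have /andP[f0 f1] := f01 x; have /andP[g0 g1] := g01 x.
    do 2 case: (_ \in _) => /=.
    + by rewrite !ger0_norm; lra.
    + by rewrite (ger0_norm (x := 1 - f x)) ?sub0r ?normrN ?(ger0_norm g0); lra.
    + by rewrite (ger0_norm (x := 1 - g x)) ?sub0r ?normrN ?(ger0_norm f0); lra.
    + by rewrite !sub0r !normrN !ger0_norm//; lra.
rewrite integralD//; last exact: integrableD.
rewrite integralD//; apply: leeD; last first.
  by apply: le_trans (leeD hf hg) _; rewrite -EFinD lee_fin; lra.
rewrite -lee_fin in hE; apply: le_trans hE; rewrite fineK//.
exact: integrable_fin_num.
Qed.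

(** One field that beats [b] on [B] still does so on every [C] close to [B]: passing from [B] to [C]
    changes the integral of its divergence by at most M ||chi_C - chi_B||_1, where M bounds the
    divergence. Hence the radius (I - b)/(M + 1). *)
Lemma perimeter_lsc (B : set V) (b : R) : measurable B -> (m B < +oo)%E -> (b%:E < perimeter B)%E ->
  exists2 d : R, 0 < d & forall C : set V, measurable C -> (m C < +oo)%E ->
    (\int[m]_x `|\1_C x - \1_B x|%:E <= d%:E)%E -> (b%:E <= perimeter C)%E.
Proof.
move=> mB Bfin; rewrite perimeterE// => /ereal_sup_gt[_ [X tX <-]].
rewrite lte_fin => bX.
have [mX [M M0 hM]] := test_field_divergence tX.
set I := (\int[m]_x _)%R in bX.
exists ((I - b) / (M + 1)); first by rewrite divr_gt0 ?subr_gt0// ltr_wpDl.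
move=> C mC Cfin hC; apply: le_trans (perimeter_ge mC tX); rewrite lee_fin.
have iB := integrable_indicM mB Bfin mX hM.
have iC := integrable_indicM mC Cfin mX hM.
have mD : measurable_fun [set: V] (fun x => `|\1_C x - \1_B x| : R).
  by apply: measurableT_comp => //; apply: measurable_funB; exact: measurable_indic.
have iD : m.-integrable setT (EFin \o (fun x => `|\1_C x - \1_B x|)).
  apply/integrableP; split; first exact/measurable_EFinP.
  by apply: le_lt_trans (ltry _); apply: le_trans hC; under eq_integral do rewrite /= normr_id.
have hC' : \int[m]_x `|\1_C x - \1_B x| <= (I - b) / (M + 1).
  by rewrite -lee_fin fineK//; exact: integrable_fin_num iD.
have : I - \int[m]_x (\1_C x * divergence X x) <= M * \int[m]_x `|\1_C x - \1_B x|.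
  rewrite -RintegralB// -RintegralZl//; apply: le_Rintegral => //.
  - exact: (integrableB measurableT iB iC).
  - exact: (integrableZl measurableT M iD).
  move=> x _; rewrite -mulrBl; apply: le_trans (ler_norm _) _.
  by rewrite normrM mulrC distrC ler_wpM2r.
have : M * \int[m]_x `|\1_C x - \1_B x| <= I - b.
  apply: (@le_trans _ _ (M * ((I - b) / (M + 1)))); first exact: ler_wpM2l.
  have Ib : 0 <= I - b by rewrite subr_ge0 ltW.
  have M1 : M / (M + 1) <= 1 by rewrite ler_pdivrMr ?ltr_wpDl// mul1r; lra.
  by rewrite mulrCA ler_piMr.
lra.
Qed.

End perimeter.

(** * Nonlocal energies and convolutions *)

Section nonlocal.
Context {R : realType} {n : nat}.
Local Notation V := 'rV[R]_n.
Local Notation m := (borel_lebesgue R n).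
Implicit Types (u v kap : V -> R).
Local Open Scope ereal_scope.

Definition dist1 u (h : V) : \bar R := \int[m]_x `|u (x + h)%R - u x|%:E.

(** For the kernel [kern s] and the indicator of a set this is twice the fractional perimeter. *)
Definition nonlocal kap u : \bar R :=
  \int[m]_x \int[m]_y (`|u x - u y| * kap (x - y))%:E.

Lemma measurable_addV : measurable_fun [set: V * V] (fun z : V * V => z.1 + z.2)%R.
Proof. by apply: measurable_rowD; [exact: measurable_fst|exact: measurable_snd]. Qed.

Lemma measurable_subV : measurable_fun [set: V * V] (fun z : V * V => z.1 - z.2)%R.
Proof. by apply: measurable_rowB; [exact: measurable_fst|exact: measurable_snd]. Qed.

Lemma measurable_comp1 u : measurable_fun setT u -> measurable_fun [set: V * V] (fun z => u z.1).
Proof. by move=> mu; exact: (measurableT_comp mu measurable_fst). Qed.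

Lemma measurable_comp2 u : measurable_fun setT u -> measurable_fun [set: V * V] (fun z => u z.2).
Proof. by move=> mu; exact: (measurableT_comp mu measurable_snd). Qed.

Lemma measurable_compD u : measurable_fun setT u -> measurable_fun [set: V * V] (fun z => u (z.1 + z.2)%R).
Proof. by move=> mu; exact: (measurableT_comp mu measurable_addV). Qed.

Lemma measurable_compB u : measurable_fun setT u -> measurable_fun [set: V * V] (fun z => u (z.1 - z.2)%R).
Proof. by move=> mu; exact: (measurableT_comp mu measurable_subV). Qed.

Lemma measurable_shift u h : measurable_fun setT u -> measurable_fun [set: V] (fun x => u (x + h)%R).
Proof.
move=> mu; apply: (measurableT_comp mu).
by apply: measurable_rowD => //; exact: measurable_cst.
Qed.

Lemma measurable_refl u h : measurable_fun setT u -> measurable_fun [set: V] (fun x => u (h - x)%R).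
Proof.
move=> mu; apply: (measurableT_comp mu).
by apply: measurable_rowB => //; exact: measurable_cst.
Qed.

Lemma tonelli_shift (G : V * V -> \bar R) : measurable_fun setT G -> (forall z, 0 <= G z) ->
  \int[m]_x \int[m]_y G (x, y) = \int[m]_h \int[m]_x G (x, x + h)%R.
Proof.
move=> mG G0.
transitivity (\int[m]_x \int[m]_h G (x, x + h)%R).
  apply: eq_integral => x _.
  rewrite -(integral_shift x (f := fun y => G (x, y))); last first.
    exact: (measurableT_comp mG (pair1_measurable _)).
  by apply: eq_integral => h _; rewrite addrC.
apply: (fubini_tonelli (fun z : V * V => G (z.1, z.1 + z.2)%R)) => //.
apply: (measurableT_comp mG).
apply: (measurable_fun_pair (f := fun z : V * V => z.1) (g := fun z : V * V => (z.1 + z.2)%R)).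
  exact: measurable_fst.
exact: measurable_addV.
Qed.

Lemma measurable_dist1 u : measurable_fun setT u -> measurable_fun setT (dist1 u).
Proof.
move=> mu; apply: (measurable_fun_fubini_tonelli_F (fun z : V * V => `|u (z.2 + z.1)%R - u z.2|%:E)) => //.
apply/measurable_EFinP; apply: measurableT_comp => //; apply: measurable_funB; last exact: measurable_comp2.
rewrite (_ : (fun z : V * V => _) = fun z : V * V => u (z.1 + z.2)%R); first exact: measurable_compD.
by apply/funext => z; rewrite addrC.
Qed.

Lemma dist1_ge0 u h : 0 <= dist1 u h.
Proof. by apply: integral_ge0 => x _; rewrite lee_fin. Qed.

(** Put y = x + h and exchange the integrals. The energy becomes the average of the L^1 moduli of
    [u] against the kernel, so any comparison of moduli or of kernels carries over to energies. *)
Lemma nonlocal_shift kap u : measurable_fun setT kap -> (forall h, (0 <= kap h)%R) ->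
  (forall h, kap (- h)%R = kap h) -> measurable_fun setT u ->
  nonlocal kap u = \int[m]_h ((kap h)%:E * dist1 u h).
Proof.
move=> mk k0 kN mu; rewrite /nonlocal.
rewrite (tonelli_shift (G := fun z : V * V => (`|u z.1 - u z.2| * kap (z.1 - z.2))%:E)); last 2 first.
- apply/measurable_EFinP; apply: measurable_funM; last exact: measurable_compB.
  apply: measurableT_comp => //; apply: measurable_funB; first exact: measurable_comp1.
  exact: measurable_comp2.
- by move=> z; rewrite lee_fin mulr_ge0.
apply: eq_integral => h _; rewrite /dist1 -ge0_integralZl_EFin//; last first.
  apply/measurable_EFinP; apply: measurableT_comp => //; apply: measurable_funB => //.
  exact: measurable_shift.
apply: eq_integral => x _ /=; rewrite -EFinM opprD addrA subrr sub0r kN.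
by rewrite distrC mulrC.
Qed.

Section monotonicity.
Variables (kap kap' : V -> R) (u v : V -> R).
Hypotheses (mk : measurable_fun setT kap) (k0 : forall h, (0 <= kap h)%R)
  (kN : forall h, kap (- h)%R = kap h) (mu : measurable_fun setT u).
Hypotheses (mk' : measurable_fun setT kap') (k0' : forall h, (0 <= kap' h)%R)
  (kN' : forall h, kap' (- h)%R = kap' h) (mv : measurable_fun setT v).

Let mkd w : measurable_fun setT w -> measurable_fun [set: V] (fun h => (kap h)%:E * dist1 w h).
Proof. by move=> mw; apply: emeasurable_funM; [exact/measurable_EFinP|exact: measurable_dist1]. Qed.

Lemma le_nonlocal : (forall h, (kap h <= kap' h)%R) -> (forall h, dist1 u h <= dist1 v h) ->
  nonlocal kap u <= nonlocal kap' v.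
Proof.
move=> kk uv; rewrite (nonlocal_shift mk k0 kN mu) (nonlocal_shift mk' k0' kN' mv); apply: ge0_le_integral => //.
- by move=> h _; rewrite mule_ge0 ?lee_fin// dist1_ge0.
- exact: mkd.
- by apply: emeasurable_funM; [exact/measurable_EFinP|exact: measurable_dist1].
- by move=> h _; rewrite lee_pmul ?lee_fin// dist1_ge0.
Qed.

Lemma nonlocalD : nonlocal (fun h => kap h + kap' h)%R u = nonlocal kap u + nonlocal kap' u.
Proof.
rewrite !nonlocal_shift//; last 3 first.
- exact: measurable_funD.
- by move=> h; rewrite addr_ge0.
- by move=> h; rewrite kN kN'.
rewrite -ge0_integralD//.
- by apply: eq_integral => h _; rewrite EFinD ge0_muleDl ?lee_fin.
- by move=> h _; rewrite mule_ge0 ?lee_fin// dist1_ge0.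
- exact: mkd.
- by move=> h _; rewrite mule_ge0 ?lee_fin// dist1_ge0.
- by apply: emeasurable_funM; [exact/measurable_EFinP|exact: measurable_dist1].
Qed.

Lemma nonlocal_le_cst (C : \bar R) : 0 <= C -> (forall h, dist1 u h <= dist1 v h + C) ->
  nonlocal kap u <= nonlocal kap v + \int[m]_h (kap h)%:E * C.
Proof.
move=> C0 uv; rewrite !nonlocal_shift// -ge0_integralZr//; last 2 first.
- exact/measurable_EFinP.
- by move=> h _; rewrite lee_fin.
rewrite -ge0_integralD//; last 4 first.
- by move=> h _; rewrite mule_ge0 ?lee_fin// dist1_ge0.
- exact: mkd.
- by move=> h _; rewrite mule_ge0 ?lee_fin.
- by apply: emeasurable_funM => //; exact/measurable_EFinP.
apply: ge0_le_integral => //.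
- by move=> h _; rewrite mule_ge0 ?lee_fin// dist1_ge0.
- exact: mkd.
- apply: emeasurable_funD; first exact: mkd.
  by apply: emeasurable_funM => //; exact/measurable_EFinP.
- move=> h _; rewrite -ge0_muleDr ?dist1_ge0//.
  by rewrite lee_wpmul2l ?lee_fin.
Qed.

End monotonicity.

(** The discrepancy between [B] and [C] enters twice, at [x] and at [x + h], and translation
    invariance makes the two contributions equal. *)
Lemma dist1_indic_le (B C : set V) h : measurable B -> measurable C ->
  dist1 \1_B h <= dist1 \1_C h + 2%:E * \int[m]_x `|\1_B x - \1_C x|%:E.
Proof.
move=> mB mC.
have mD : measurable_fun [set: V] (fun x => `|\1_B x - \1_C x| : R)%R.
  by apply: measurableT_comp => //; apply: measurable_funB; exact: measurable_indic.
have mDh : measurable_fun [set: V] (fun x => `|\1_B (x + h)%R - \1_C (x + h)%R| : R)%R.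
  exact: (measurable_shift h mD).
have m1 (A : set V) : measurable A -> measurable_fun [set: V] (fun x => `|\1_A (x + h)%R - \1_A x| : R)%R.
  move=> mA; apply: measurableT_comp => //; apply: measurable_funB; last exact: measurable_indic.
  by apply: (measurable_shift h (u := \1_A)); exact: measurable_indic.
have e0 (f : V -> R) x : (0 <= `|f x|%:E) by rewrite lee_fin.
apply: (@le_trans _ _ (\int[m]_x (`|\1_C (x + h)%R - \1_C x|%:E + (`|\1_B (x + h)%R - \1_C (x + h)%R|%:E + `|\1_B x - \1_C x|%:E)))).
  apply: ge0_le_integral => //.
  - by apply/measurable_EFinP; exact: m1.
  - apply: emeasurable_funD; first by apply/measurable_EFinP; exact: m1.
    by apply: emeasurable_funD; exact/measurable_EFinP.
  - move=> x _; rewrite -!EFinD lee_fin.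
    set a := \1_B (x + h)%R; set b := \1_B x; set c := \1_C (x + h)%R; set d := \1_C x.
    rewrite (_ : a - b = (c - d) + ((a - c) - (b - d)))%R; last by ring.
    apply: le_trans (ler_normD _ _) _; rewrite lerD2l; exact: ler_normB.
rewrite ge0_integralD//; last 3 first.
- by apply/measurable_EFinP; exact: m1.
- by move=> x _; rewrite adde_ge0.
- by apply: emeasurable_funD; exact/measurable_EFinP.
rewrite ge0_integralD//; last 2 first.
- exact/measurable_EFinP.
- exact/measurable_EFinP.
rewrite (integral_shift h (f := fun x => `|\1_B x - \1_C x|%:E)); last exact/measurable_EFinP.
by rewrite (mule_natl _ 2) mule2n.
Qed.

End nonlocal.

(** * Convolution with a symmetric kernel of finite mass *)

Section convolution.
Context {R : realType} {n : nat}.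
Local Notation V := 'rV[R]_n.
Local Notation m := (borel_lebesgue R n).
Implicit Types (u v f g : V -> R).

Definition bmeas u := measurable_fun [set: V] u /\ exists M : R, forall x, `|u x| <= M.

Lemma bmeasB u v : bmeas u -> bmeas v -> bmeas (fun x => u x - v x).
Proof.
move=> [mu [M hM]] [mv [N hN]]; split; first exact: measurable_funB.
by exists (M + N) => x; apply: le_trans (ler_normB _ _) _; exact: lerD.
Qed.

Lemma bmeas_norm u : bmeas u -> bmeas (fun x => `|u x|).
Proof.
move=> [mu [M hM]]; split; first exact: measurableT_comp.
by exists M => x; rewrite normr_id.
Qed.

Lemma bmeas_cst (c : R) : bmeas (fun=> c).
Proof. by split; [exact: measurable_cst|exists `|c|]. Qed.

Lemma bmeas_shift u h : bmeas u -> bmeas (fun x => u (x + h)).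
Proof. by move=> [mu [M hM]]; split; [exact: measurable_shift|exists M]. Qed.

Lemma bmeas_indic (B : set V) : measurable B -> bmeas \1_B.
Proof.
move=> mB; split; first exact: measurable_indic.
by exists 1 => x; rewrite indicE; case: (_ \in _); rewrite /= ?normr0 ?normr1.
Qed.

Lemma ge0_integrable_EFin f (c : \bar R) : measurable_fun setT f -> (forall x, 0 <= f x) ->
  (\int[m]_x (f x)%:E = c)%E -> (c < +oo)%E -> m.-integrable setT (EFin \o f).
Proof.
move=> mf f0 fc coo; apply/integrableP; split; first exact/measurable_EFinP.
rewrite (eq_integral (fun x : V => (f x)%:E)) ?fc// => x _.
by rewrite /= ger0_norm.
Qed.

Lemma integrable_indic_fin (B : set V) : measurable B -> (m B < +oo)%E ->
  m.-integrable setT (EFin \o (\1_B : V -> R)).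
Proof.
move=> mB; apply: ge0_integrable_EFin; first exact: measurable_indic.
  by move=> x; rewrite indicE.
by rewrite integral_indic// setIT.
Qed.

Lemma integrable_bmeasM f u : m.-integrable setT (EFin \o f) -> bmeas u ->
  m.-integrable setT (fun x : V => (f x * u x)%:E).
Proof.
move=> fi [mu [M hM]].
apply: (integrableMl measurableT fi mu).
exists M; split; first exact: num_real.
by move=> N MN x _; apply: le_trans (hM x) (ltW MN).
Qed.

Variables (kap : V -> R) (k : R).
Hypotheses (mk : measurable_fun setT kap) (k0 : forall h, 0 <= kap h)
  (kN : forall h, kap (- h) = kap h) (ki : (\int[m]_h (kap h)%:E = k%:E)%E).

Lemma mass_ge0 : 0 <= k.
Proof. by rewrite -lee_fin -ki; apply: integral_ge0 => x _; rewrite lee_fin. Qed.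

Let mkx x : measurable_fun [set: V] (fun y => kap (x - y)).
Proof. exact: measurable_refl. Qed.

Let ikx x : (\int[m]_y (kap (x - y))%:E = k%:E)%E.
Proof.
rewrite -ki -(integral_reflect x (f := fun y => (kap y)%:E))//.
exact/measurable_EFinP.
Qed.

Let ikx' x : (\int[m]_y (kap (y - x))%:E = k%:E)%E.
Proof. by rewrite -(ikx x); apply: eq_integral => y _; rewrite -kN opprB. Qed.

Lemma integrable_kernel x : m.-integrable setT (fun y : V => (kap (x - y))%:E).
Proof.
exact: (ge0_integrable_EFin (mkx x) (fun y => k0 _) (ikx x) (ltry k)).
Qed.

Definition kconv u x : R := \int[m]_y (kap (x - y) * u y).

Lemma integrable_conv u x : bmeas u -> m.-integrable setT (fun y : V => (kap (x - y) * u y)%:E).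
Proof. by move=> bu; apply: integrable_bmeasM => //; exact: integrable_kernel. Qed.

Lemma EFin_conv u x : bmeas u -> ((kconv u x)%:E = \int[m]_y (kap (x - y) * u y)%:E)%E.
Proof. by move=> bu; rewrite fineK//; apply: integrable_fin_num => //; exact: integrable_conv. Qed.

Lemma convB u v x : bmeas u -> bmeas v -> kconv (fun y => u y - v y) x = kconv u x - kconv v x.
Proof.
move=> bu bv; rewrite /kconv -RintegralB//; try exact: integrable_conv.
by apply: eq_Rintegral => y _; rewrite mulrBr.
Qed.

Lemma conv_cst c x : kconv (fun=> c) x = c * k.
Proof.
rewrite /kconv RintegralZr//; last exact: integrable_kernel.
by rewrite mulrC; congr (_ * _); rewrite /Rintegral ikx.
Qed.

Lemma le_conv u v x : bmeas u -> bmeas v -> (forall y, u y <= v y) -> kconv u x <= kconv v x.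
Proof.
move=> bu bv uv; apply: le_Rintegral => //; try exact: integrable_conv.
by move=> y _; rewrite ler_wpM2l.
Qed.

Lemma conv_ge0 u x : (forall y, 0 <= u y) -> 0 <= kconv u x.
Proof. by move=> u0; apply: Rintegral_ge0 => y _; rewrite mulr_ge0. Qed.

Lemma norm_conv u x : bmeas u -> `|kconv u x| <= kconv (fun y => `|u y|) x.
Proof.
move=> bu; apply: le_trans (le_normr_Rintegral _ _) _ => //; first exact: integrable_conv.
rewrite le_eqVlt; apply/orP; left; apply/eqP; apply: eq_Rintegral => y _.
by rewrite normrM ger0_norm.
Qed.

Let measurable_conv0 u : bmeas u -> (forall x, 0 <= u x) -> measurable_fun [set: V] (kconv u).
Proof.
move=> bu u0; apply/measurable_EFinP.
rewrite (_ : EFin \o _ = fun x => \int[m]_y (kap (x - y) * u y)%:E)%E; last first.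
  by apply/funext => x; rewrite -EFin_conv.
apply: (measurable_fun_fubini_tonelli_F (fun z : V * V => (kap (z.1 - z.2) * u z.2)%:E)).
  apply/measurable_EFinP; apply: measurable_funM; first exact: measurable_compB.
  exact: (measurable_comp2 bu.1).
by move=> z; rewrite lee_fin mulr_ge0.
Qed.

Lemma bmeas_conv u : bmeas u -> bmeas (kconv u).
Proof.
move=> bu; have [_ [M hM]] := bu; split; last first.
  exists (M * k) => x; apply: le_trans (norm_conv x bu) _; rewrite -(conv_cst _ x).
  by apply: le_conv => //; [exact: bmeas_norm|exact: bmeas_cst].
(* Adding a bound [M] makes the function nonnegative, where Tonelli gives measurability; the
   convolution of the added constant is explicit. *)
have bM : bmeas (fun x => u x - (- M)) by apply: bmeasB => //; exact: bmeas_cst.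
rewrite (_ : kconv u = fun x => kconv (fun x => u x - (- M)) x - M * k).
  apply: measurable_funB => //; apply: measurable_conv0 => // x.
  by have := hM x; rewrite ler_norml; lra.
apply/funext => x; rewrite convB//; last exact: bmeas_cst.
by rewrite conv_cst mulNr opprK addrK.
Qed.

Lemma conv_shift u h x : bmeas u -> kconv (fun y => u (y + h)) x = kconv u (x + h).
Proof.
move=> bu; rewrite /kconv /Rintegral; congr fine.
rewrite -[RHS](integral_shift h (f := fun y => (kap (x + h - y) * u y)%:E)); last first.
  by apply/measurable_EFinP; apply: measurable_funM => //; exact: bu.1.
by apply: eq_integral => y _; rewrite opprD addrACA subrr addr0.
Qed.

Lemma integral_conv u : bmeas u -> (forall x, 0 <= u x) ->
  (\int[m]_x (kconv u x)%:E = k%:E * \int[m]_x (u x)%:E)%E.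
Proof.
move=> bu u0; under eq_integral do rewrite EFin_conv//.
rewrite (fubini_tonelli (fun z : V * V => (kap (z.1 - z.2) * u z.2)%:E)); last 2 first.
- apply/measurable_EFinP; apply: measurable_funM; first exact: measurable_compB.
  exact: (measurable_comp2 bu.1).
- by move=> z; rewrite lee_fin mulr_ge0.
rewrite -ge0_integralZl_EFin ?mass_ge0//; last 2 first.
- by move=> x _; rewrite lee_fin.
- by apply/measurable_EFinP; exact: bu.1.
apply: eq_integral => y _ /=.
under eq_integral do rewrite EFinM.
rewrite ge0_integralZr//; last 3 first.
- by apply/measurable_EFinP; exact: measurable_shift.
- by move=> x _; rewrite lee_fin.
- by rewrite lee_fin.
by rewrite ikx'.
Qed.

(** Fubini and the symmetry of the kernel. The double integral converges absolutely because the
    inner one is at most |f(x)| times the bound of [g] times the mass. *)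
Lemma conv_dual f g : m.-integrable setT (EFin \o f) -> bmeas f -> bmeas g ->
  \int[m]_x (f x * kconv g x) = \int[m]_x (kconv f x * g x).
Proof.
move=> fi bf bg.
have [_ [M hM]] := bg.
have M0 : 0 <= M := le_trans (normr_ge0 _) (hM 0).
pose F (z : V * V) := (f z.1 * (kap (z.1 - z.2) * g z.2))%:E.
have mF : measurable_fun setT F.
  apply/measurable_EFinP; apply: measurable_funM; first exact: (measurable_comp1 bf.1).
  by apply: measurable_funM; [exact: measurable_compB|exact: (measurable_comp2 bg.1)].
have iF : (m \x m)%E.-integrable setT F.
  apply/integrable12ltyP => //.
  apply: (@le_lt_trans _ _ (\int[m]_x (`|f x| * (M * k))%:E)%E).
    apply: ge0_le_integral => //.
    - by move=> x _; apply: integral_ge0.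
    - apply: (measurable_fun_fubini_tonelli_F (fun z => `|F z|)%E) => //.
      exact: measurableT_comp.
    - apply/measurable_EFinP; apply: measurable_funM => //.
      by apply: measurableT_comp => //; exact: bf.1.
    - move=> x _; rewrite EFinM -(conv_cst M x) EFin_conv; last exact: bmeas_cst.
      rewrite -ge0_integralZl_EFin//.
      + apply: ge0_le_integral => //.
        * exact: measurableT_comp (measurableT_comp mF (pair1_measurable x)).
        * by apply: measurable_funeM; apply/measurable_EFinP; apply: measurable_funM.
        * move=> y _; rewrite /F/= lee_fin !normrM ler_wpM2l// ler_pM//.
          by rewrite ger0_norm.
      + by move=> y _; rewrite lee_fin mulr_ge0.
      + by apply/measurable_EFinP; apply: measurable_funM.
  under eq_integral do rewrite EFinM.
  rewrite ge0_integralZr//; last 2 first.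
  - by apply/measurable_EFinP; apply: measurableT_comp => //; exact: bf.1.
  - by rewrite lee_fin mulr_ge0// mass_ge0.
  move/integrableP : fi => [_ fi].
  apply: lte_mul_pinfty; [exact: integral_ge0| |exact: ltry].
  by rewrite ge0_fin_numE//; exact: integral_ge0.
have := Fubini iF; rewrite /fubini_F /fubini_G /= => FE.
rewrite /Rintegral; congr fine; rewrite (eq_integral (fun x : V => \int[m]_y F (x, y)))%E; last first.
  move=> x _; rewrite EFinM EFin_conv// -integralZl//; last exact: integrable_conv.
rewrite FE; apply: eq_integral => y _.
rewrite mulrC EFinM EFin_conv// -integralZl//; last exact: integrable_conv.
apply: eq_integral => x _; rewrite /F/=; congr (_%:E).
by rewrite -(kN (x - y)) opprB; ring.
Qed.

(* On integrating the hypothesis, the mass of the kernel cancels [beta * k]. *)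
Lemma kconv_contraction (beta : R) (u : V -> R) (g : V -> \bar R) : 0 <= beta -> bmeas u ->
  (\int[m]_x `|u x|%:E < +oo)%E -> measurable_fun setT g -> (forall x, 0 <= g x)%E ->
  (forall x, ((1 + beta * k) * `|u x|)%:E <= g x + (beta * kconv (fun y => `|u y|) x)%:E)%E ->
  (\int[m]_x `|u x|%:E <= \int[m]_x g x)%E.
Proof.
move=> b0 bu ufin mg g0 h.
have bn := bmeas_norm bu; have bc := bmeas_conv bn.
have mn : measurable_fun [set: V] (fun x => `|u x|%:E) by apply/measurable_EFinP; exact: bn.1.
have c0 x : 0 <= kconv (fun y => `|u y|) x by exact: conv_ge0.
have bk : 0 <= beta * k by rewrite mulr_ge0// mass_ge0.
have : (\int[m]_x ((1 + beta * k) * `|u x|)%:E <= \int[m]_x (g x + (beta * kconv (fun y => `|u y|) x)%:E))%E.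
  apply: ge0_le_integral => //.
  - by move=> x _; rewrite lee_fin mulr_ge0// addr_ge0.
  - by apply/measurable_EFinP; apply: measurable_funM => //; exact: bn.1.
  - apply: emeasurable_funD => //; apply/measurable_EFinP; apply: measurable_funM => //; exact: bc.1.
under eq_integral do rewrite EFinM.
rewrite ge0_integralZl_EFin ?addr_ge0//.
rewrite ge0_integralD//; last 2 first.
- by move=> x _; rewrite lee_fin mulr_ge0.
- by apply/measurable_EFinP; apply: measurable_funM => //; exact: bc.1.
under [X in (_ <= _ + X)%E -> _]eq_integral do rewrite EFinM.
rewrite ge0_integralZl_EFin//; last 2 first.
- by move=> x _; rewrite lee_fin.
- by apply/measurable_EFinP; exact: bc.1.
rewrite integral_conv//.
set I := (\int[m]_x `|u x|%:E)%E in ufin *.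
(* Finiteness of this integral is what permits cancelling the term with [beta * k] on both sides. *)
have Ifin : I \is a fin_num by rewrite ge0_fin_numE//; exact: integral_ge0.
rewrite EFinD muleDl// mul1e muleA -EFinM.
have bIfin : ((beta * k)%:E * I)%E \is a fin_num by rewrite fin_numM.
by rewrite leeD2rE.
Qed.

End convolution.

(** * The equation with an integrable kernel *)

Section resolvent.
Context {R : realType} {n : nat}.
Local Notation V := 'rV[R]_n.
Local Notation m := (borel_lebesgue R n).

(* [phi + beta * (k * phi - kconv kap phi) = \1_B], solved for the diagonal term. *)
Definition resolvent (kap : V -> R) (k beta : R) (B : set V) (phi : V -> R) :=
  [/\ bmeas phi, forall x, 0 <= phi x <= 1,
      (\int[m]_x (phi x)%:E <= m B)%E
    & forall x, (1 + beta * k) * phi x = \1_B x + beta * kconv kap phi x].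

Variables (kap : V -> R) (k beta : R) (B : set V).
Hypotheses (mk : measurable_fun setT kap) (k0 : forall h, 0 <= kap h)
  (kN : forall h, kap (- h) = kap h) (ki : (\int[m]_h (kap h)%:E = k%:E)%E)
  (b0 : 0 <= beta) (mB : measurable B) (Bfin : (m B < +oo)%E).

Let kk0 : 0 <= k. Proof. exact: mass_ge0 k0 ki. Qed.
Let d0 : 0 < 1 + beta * k. Proof. by rewrite ltr_pwDl// mulr_ge0. Qed.
Let bk0 : 0 <= beta * k. Proof. exact: mulr_ge0. Qed.

Let bB : bmeas (\1_B : V -> R). Proof. exact: bmeas_indic. Qed.

Let mI : measurable_fun [set: V] (fun x => (\1_B x : R)%:E).
Proof. by apply/measurable_EFinP; exact: measurable_indic. Qed.

Let intB : (\int[m]_x (\1_B x : R)%:E = m B)%E.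
Proof. by rewrite integral_indic// setIT. Qed.

Fixpoint picard (j : nat) (x : V) : R :=
  if j is j'.+1 then (\1_B x + beta * kconv kap (picard j') x) / (1 + beta * k) else 0.

Let indic01 x : 0 <= (\1_B x : R) <= 1.
Proof. by rewrite indicE; case: (_ \in _); rewrite /= ?lexx ?ler01. Qed.

Let picard_bd j : bmeas (picard j) /\ forall x, 0 <= picard j x <= 1.
Proof.
elim: j => [|j [bj j01]] /=; first by split; [exact: bmeas_cst|move=> x; rewrite lexx ler01].
have h x : 0 <= (\1_B x + beta * kconv kap (picard j) x) / (1 + beta * k) <= 1.
  have c0 : 0 <= kconv kap (picard j) x by apply: conv_ge0 => // y; have /andP[] := j01 y.
  have c1 : kconv kap (picard j) x <= k.
    rewrite -[leRHS]mul1r -(conv_cst mk k0 ki 1 x); apply: (le_conv mk k0 ki x bj (bmeas_cst 1)).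
    by move=> y; have /andP[] := j01 y.
  have /andP[i0 i1] := indic01 x.
  rewrite divr_ge0 ?(ltW d0)//= ?addr_ge0 ?mulr_ge0//.
  by rewrite ler_pdivrMr// mul1r lerD// ler_wpM2l.
split => //; split; last first.
  by exists 1 => x; have /andP[p0 p1] := h x; rewrite ger0_norm.
apply: measurable_funM => //; apply: measurable_funD; first exact: measurable_indic.
by apply: measurable_funM => //; have [] := bmeas_conv mk k0 ki bj.
Qed.

Let picard_nd x : {homo picard^~ x : i j / (i <= j)%N >-> i <= j}.
Proof.
apply/nondecreasing_seqP => j; elim: j x => [|j IH] x.
  by have [_ /(_ x)/andP[]] := picard_bd 1.
rewrite /= ler_pM2r ?invr_gt0// lerD2l ler_wpM2l//.
exact: (le_conv mk k0 ki x (picard_bd j).1 (picard_bd j.+1).1).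
Qed.

(** Integrating the recursion gives (1 + beta k) I_(j+1) = m(B) + beta k I_j, an affine recursion
    with fixed point m(B) and starting value 0. *)
Let picard_int j : (\int[m]_x (picard j x)%:E <= m B)%E.
Proof.
elim: j => [|j IH]; first by rewrite integral0.
have [bj j01] := picard_bd j; have [bj1 j101] := picard_bd j.+1.
have p0 x : (0 <= (picard j x)%:E)%E by rewrite lee_fin; have /andP[] := j01 x.
have c0 x : 0 <= kconv kap (picard j) x by apply: conv_ge0 => // y; have /andP[] := j01 y.
have E : ((1 + beta * k)%:E * \int[m]_x (picard j.+1 x)%:E = m B + (beta * k)%:E * \int[m]_x (picard j x)%:E)%E.
  rewrite -ge0_integralZl_EFin ?(ltW d0)//; last 2 first.
  - by move=> x _; rewrite lee_fin; have /andP[] := j101 x.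
  - by apply/measurable_EFinP; exact: bj1.1.
  rewrite (eq_integral (fun x : V => (\1_B x)%:E + beta%:E * (kconv kap (picard j) x)%:E))%E; last first.
    by move=> x _; rewrite -!EFinM -EFinD; congr (_%:E); rewrite /= mulrC divfK ?gt_eqF.
  have mc : measurable_fun [set: V] (fun x => (kconv kap (picard j) x)%:E).
    by apply/measurable_EFinP; have [] := bmeas_conv mk k0 ki bj.
  rewrite ge0_integralD//; last 2 first.
  - by move=> x _; rewrite mule_ge0 ?lee_fin.
  - exact: measurable_funeM.
  rewrite ge0_integralZl_EFin//; last by move=> x _; rewrite lee_fin.
  rewrite (integral_conv mk k0 kN ki bj); last by move=> x; have /andP[] := j01 x.
  by rewrite intB muleA -EFinM.
rewrite -(@lee_pmul2l _ (1 + beta * k)%:E)// ?lte_fin// E EFinD ge0_muleDl ?lee_fin//.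
by rewrite mul1e leeD2l// lee_wpmul2l ?lee_fin.
Qed.

(** The iterates start at 0, increase, and stay below 1. Monotone convergence carries the bound on
    the integral to the limit, and dominated convergence, with the kernel as majorant, carries the
    equation. *)
Lemma resolvent_exists : exists phi, resolvent kap k beta B phi.
Proof.
have cv x : cvgn (picard^~ x).
  apply: nondecreasing_is_cvgn; first exact: picard_nd.
  by exists 1 => _ [j _ <-]; have [_ /(_ x)/andP[]] := picard_bd j.
pose phi x := limn (picard^~ x).
have pc x : picard^~ x @ \oo --> phi x by exact: cv.
have p01 x : 0 <= phi x <= 1.
  apply/andP; split.
    by apply: limr_ge => //; apply: nearW => j; have [_ /(_ x)/andP[]] := picard_bd j.
  by apply: limr_le => //; apply: nearW => j; have [_ /(_ x)/andP[]] := picard_bd j.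
have mphi : measurable_fun [set: V] phi.
  apply: (@measurable_fun_cvg _ _ _ _ picard) => // j.
  by have [[]] := picard_bd j.
have bphi : bmeas phi.
  by split => //; exists 1 => x; have /andP[h0 h1] := p01 x; rewrite ger0_norm.
exists phi; split => //.
  have mp j : measurable_fun [set: V] (fun x => (picard j x)%:E).
    by apply/measurable_EFinP; have [[]] := picard_bd j.
  have pp j x : [set: V] x -> (0 <= (picard j x)%:E)%E.
    by move=> _; rewrite lee_fin; have [_ /(_ x)/andP[]] := picard_bd j.
  have pn x : [set: V] x -> {homo (fun j => (picard j x)%:E) : i j / (i <= j)%N >-> (i <= j)%E}.
    by move=> _ i j ij; rewrite lee_fin; exact: picard_nd.
  have := @monotone_convergence _ V R m setT measurableT (fun j x => (picard j x)%:E) mp pp pn.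
  rewrite (eq_integral (fun x : V => (phi x)%:E)) => [->|x _]; last first.
    by apply/cvg_lim => //; apply: cvg_EFin (pc x); exact: nearW.
  apply: lime_le; last by apply: nearW => j; exact: picard_int.
  apply: ereal_nondecreasing_is_cvgn => i j ij; apply: ge0_le_integral => //.
  - by move=> x _; exact: pp.
  - by move=> x _; exact: pn.
move=> x.
have h1 : picard j.+1 x @[j --> \oo] --> phi x by rewrite (@cvg_shiftS _ (picard^~ x)).
have h2 : kconv kap (picard j) x @[j --> \oo] --> kconv kap phi x.
  have := @dominated_cvg _ V R m setT measurableT (fun j y => (kap (x - y) * picard j y)%:E)
    (fun y => (kap (x - y) * phi y)%:E) (fun y => (kap (x - y))%:E).
  have q1 j : measurable_fun [set: V] (fun y : V => (kap (x - y) * picard j y)%:E).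
    apply/measurable_EFinP; apply: measurable_funM; first exact: measurable_refl.
    by have [[]] := picard_bd j.
  have q2 y : [set: V] y -> (kap (x - y) * picard j y)%:E @[j --> \oo] --> (kap (x - y) * phi y)%:E.
    by move=> _; apply: cvg_EFin; [exact: nearW|apply: cvgM (pc y); exact: cvg_cst].
  have q3 j y : [set: V] y -> (`|(kap (x - y) * picard j y)%:E| <= (kap (x - y))%:E)%E.
    move=> _; rewrite abse_EFin lee_fin normrM ger0_norm// ler_piMr//.
    by have [_ /(_ y)/andP[h0' h1']] := picard_bd j; rewrite ger0_norm.
  move=> /(_ q1 q2 (fun _ _ => isT) (integrable_kernel mk k0 ki x) q3).
  rewrite -(EFin_conv mk k0 ki x bphi).
  rewrite (_ : (fun j => _) = EFin \o (fun j => kconv kap (picard j) x)); last first.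
    by apply/funext => j; rewrite /= (EFin_conv mk k0 ki x (picard_bd j).1).
  by move=> h; exact: (fine_cvg h).
have h3 : (\1_B x + beta * kconv kap (picard j) x) / (1 + beta * k) @[j --> \oo] --> (\1_B x + beta * kconv kap phi x) / (1 + beta * k).
  apply: cvgM; last exact: cvg_cst.
  by apply: cvgD; [exact: cvg_cst|apply: cvgM => //; exact: cvg_cst].
have -> : phi x = (\1_B x + beta * kconv kap phi x) / (1 + beta * k).
  exact: (cvg_unique (@Rhausdorff R) h1 h3).
by rewrite mulrC divfK// gt_eqF.
Qed.

Variable phi : V -> R.
Hypothesis rphi : resolvent kap k beta B phi.

Let bphi : bmeas phi. Proof. by case: rphi. Qed.
Let p0 x : 0 <= phi x. Proof. by case: rphi => _ /(_ x)/andP[]. Qed.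
Let p1 x : phi x <= 1. Proof. by case: rphi => _ /(_ x)/andP[]. Qed.

Lemma resolvent_L1 : (\int[m]_x `|phi x|%:E <= m B)%E.
Proof.
case: rphi => _ _ + _; apply: le_trans.
by rewrite le_eqVlt; apply/orP; left; apply/eqP; apply: eq_integral => x _; rewrite ger0_norm.
Qed.

Lemma resolvent_integrable : m.-integrable setT (EFin \o phi).
Proof.
apply/integrableP; split; first by apply/measurable_EFinP; exact: bphi.1.
exact: le_lt_trans resolvent_L1 Bfin.
Qed.

(** The equation is translation invariant, so phi(. + h) - phi solves it with right-hand side
    chi_B(. + h) - chi_B, and the L^1 contraction applies with constant 1. *)
Lemma resolvent_dist1 h : (dist1 phi h <= dist1 \1_B h)%E.
Proof.
have bs := bmeas_shift h bphi; have bd := bmeasB bs bphi.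
rewrite /dist1; apply: (kconv_contraction mk k0 kN ki (g := fun x => `|\1_B (x + h) - \1_B x|%:E) b0 bd).
- apply: (@le_lt_trans _ _ (\int[m]_x (`|phi (x + h)|%:E + `|phi x|%:E))%E).
    apply: ge0_le_integral => //.
    + by apply/measurable_EFinP; have [] := bmeas_norm bd.
    + apply: emeasurable_funD; apply/measurable_EFinP.
        by have [] := bmeas_norm bs.
      by have [] := bmeas_norm bphi.
    + by move=> x _; rewrite -EFinD lee_fin; exact: ler_normB.
  rewrite ge0_integralD//; last 2 first.
  + by apply/measurable_EFinP; have [] := bmeas_norm bs.
  + by apply/measurable_EFinP; have [] := bmeas_norm bphi.
  rewrite (integral_shift h (f := fun x => `|phi x|%:E)); last first.
    by apply/measurable_EFinP; have [] := bmeas_norm bphi.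
  by rewrite lte_add_pinfty//; apply: le_lt_trans resolvent_L1 Bfin.
- apply/measurable_EFinP; apply: measurableT_comp => //; apply: measurable_funB; last exact: bB.1.
  exact: measurable_shift bB.1.
- by move=> x; rewrite lee_fin.
move=> x; rewrite -EFinD lee_fin.
have [_ _ _ eqn] := rphi.
rewrite -[X in X * _](gtr0_norm d0) -normrM mulrBr !eqn.
rewrite (_ : _ - _ = (\1_B (x + h) - \1_B x) + beta * (kconv kap phi (x + h) - kconv kap phi x)); last by ring.
apply: le_trans (ler_normD _ _) _; rewrite lerD2l normrM (ger0_norm b0) ler_wpM2l//.
rewrite -(conv_shift mk h x bphi) -(convB mk k0 ki x bs bphi).
exact: (norm_conv mk k0 ki x bd).
Qed.

End resolvent.

Lemma eq_RintegralT {R : realType} {n : nat} (f g : 'rV[R]_n -> R) : f =1 g ->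
  \int[borel_lebesgue R n]_x f x = \int[borel_lebesgue R n]_x g x.
Proof. by move=> fg; apply: eq_Rintegral => x _; exact: fg. Qed.

Section deviation.
Context {R : realType} {n : nat}.
Local Notation V := 'rV[R]_n.
Local Notation m := (borel_lebesgue R n).
Implicit Types (u kap : V -> R).

(** A pointwise majorant of |k u - kap * u| whose integral is [nonlocal kap u]. Unlike the
    convolution it is also meaningful for kernels of infinite mass such as [knear]. *)
Definition deviation kap u (x : V) : \bar R := (\int[m]_y (`|u x - u y| * kap (x - y))%:E)%E.

Lemma deviation_ge0 kap u x : (forall h, 0 <= kap h) -> (0 <= deviation kap u x)%E.
Proof. by move=> k0; apply: integral_ge0 => y _; rewrite lee_fin mulr_ge0. Qed.

Lemma measurable_deviation kap u : measurable_fun setT kap -> (forall h, 0 <= kap h) ->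
  measurable_fun setT u -> measurable_fun setT (deviation kap u).
Proof.
move=> mk k0 mu.
apply: (measurable_fun_fubini_tonelli_F (fun z : V * V => (`|u z.1 - u z.2| * kap (z.1 - z.2))%:E)).
  apply/measurable_EFinP; apply: measurable_funM; last exact: measurable_compB.
  apply: measurableT_comp => //; apply: measurable_funB; first exact: measurable_comp1.
  exact: measurable_comp2.
by move=> z; rewrite lee_fin mulr_ge0.
Qed.

Lemma kconv_deviation kap k u x : measurable_fun setT kap -> (forall h, 0 <= kap h) ->
  (\int[m]_h (kap h)%:E = k%:E)%E -> bmeas u ->
  (`|k * u x - kconv kap u x|%:E <= deviation kap u x)%E.
Proof.
move=> mk k0 ki bu.
have bc : bmeas (fun _ : V => u x) by exact: bmeas_cst.
have bd := bmeasB bc bu.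
rewrite mulrC -(conv_cst mk k0 ki (u x) x) -(convB mk k0 ki x bc bu).
apply: (@le_trans _ _ (kconv kap (fun y => `|u x - u y|) x)%:E).
  by rewrite lee_fin; exact: (norm_conv mk k0 ki x bd).
rewrite (EFin_conv mk k0 ki x (bmeas_norm bd)) le_eqVlt; apply/orP; left; apply/eqP.
by apply: eq_integral => y _; rewrite mulrC.
Qed.

End deviation.

(** * Energy identities and bounds for the truncated equation *)

Section compare.
Context {R : realType} {n : nat}.
Local Notation V := 'rV[R]_n.
Local Notation m := (borel_lebesgue R n).
Variables (kap : V -> R) (k beta : R) (B : set V) (phi : V -> R).
Hypotheses (mk : measurable_fun setT kap) (k0 : forall h, 0 <= kap h)
  (kN : forall h, kap (- h) = kap h) (ki : (\int[m]_h (kap h)%:E = k%:E)%E)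
  (b0 : 0 <= beta) (mB : measurable B) (Bfin : (m B < +oo)%E).
Hypothesis rphi : resolvent kap k beta B phi.

Let bphi : bmeas phi. Proof. by case: rphi. Qed.
Let p0 x : 0 <= phi x. Proof. by case: rphi => _ /(_ x)/andP[]. Qed.
Let p1 x : phi x <= 1. Proof. by case: rphi => _ /(_ x)/andP[]. Qed.
Let bB : bmeas (\1_B : V -> R). Proof. exact: bmeas_indic. Qed.
Let kk0 : 0 <= k. Proof. exact: mass_ge0 k0 ki. Qed.
Let iphi := resolvent_integrable Bfin rphi.

Let iB : m.-integrable setT (EFin \o (\1_B : V -> R)).
Proof. exact: integrable_indic_fin. Qed.

(** The equation reads chi_B - phi = beta (k phi - kap * phi). Integrating the pointwise majorant
    gives the nonlocal energy of [phi], which is at most that of the indicator because translation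
    differences do not grow. *)
Lemma resolvent_dist : (\int[m]_x `|\1_B x - phi x|%:E <= beta%:E * nonlocal kap \1_B)%E.
Proof.
apply: (@le_trans _ _ (beta%:E * nonlocal kap phi)%E); last first.
  apply: lee_wpmul2l; first by rewrite lee_fin.
  apply: (le_nonlocal mk k0 kN bphi.1 mk k0 kN bB.1) => // h.
  exact: (resolvent_dist1 mk k0 kN ki b0 mB Bfin rphi).
rewrite /nonlocal -ge0_integralZl_EFin//; last 2 first.
- by move=> x _; exact: (@deviation_ge0 R n kap phi x k0).
- exact: (measurable_deviation mk k0 bphi.1).
apply: ge0_le_integral => //.
- by apply/measurable_EFinP; have [] := bmeas_norm (bmeasB bB bphi).
- by apply: measurable_funeM; exact: (measurable_deviation mk k0 bphi.1).
move=> x _; have [_ _ _ /(_ x) eqn] := rphi.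
rewrite (_ : \1_B x - phi x = beta * (k * phi x - kconv kap phi x)); last by lra.
rewrite normrM (ger0_norm b0) EFinM; apply: lee_wpmul2l; first by rewrite lee_fin.
exact: kconv_deviation.
Qed.

Lemma resolvent_weak (psi : V -> R) : bmeas psi -> m.-integrable setT (EFin \o psi) ->
  \int[m]_x (phi x * (psi x + beta * (k * psi x - kconv kap psi x))) = \int[m]_x (\1_B x * psi x).
Proof.
move=> bpsi ipsi; have [_ _ _ eqn] := rphi.
have bc := bmeas_conv mk k0 ki bpsi; have bcp := bmeas_conv mk k0 ki bphi.
have D := conv_dual mk k0 kN ki ipsi bpsi bphi.
have i1 : m.-integrable setT (EFin \o (fun x => \1_B x * psi x)) by exact: (integrable_bmeasM iB bpsi).
have i2 : m.-integrable setT (EFin \o (fun x => psi x * kconv kap phi x)) by exact: (integrable_bmeasM ipsi bcp).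
have i3 : m.-integrable setT (EFin \o (fun x => phi x * kconv kap psi x)) by exact: (integrable_bmeasM iphi bc).
have i2' := integrableZl measurableT beta i2.
have i3' := integrableZl measurableT beta i3.
have E x : phi x * (psi x + beta * (k * psi x - kconv kap psi x)) =
   (\1_B x * psi x + beta * (psi x * kconv kap phi x)) - beta * (phi x * kconv kap psi x).
  have := eqn x => e.
  rewrite (_ : \1_B x * psi x + beta * (psi x * kconv kap phi x) = psi x * (\1_B x + beta * kconv kap phi x)); last by ring.
  by rewrite -e; ring.
rewrite (eq_RintegralT (g := fun x : V => (\1_B x * psi x + beta * (psi x * kconv kap phi x)) - beta * (phi x * kconv kap psi x))); last exact: E.
rewrite RintegralB//; last exact: (integrableD measurableT i1 i2').
rewrite RintegralD// !RintegralZl// D.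
rewrite (eq_RintegralT (g := fun x : V => kconv kap psi x * phi x) (f := fun x : V => phi x * kconv kap psi x)); last by move=> x; exact: mulrC.
ring.
Qed.

(** The interaction of [B] with its complement: k m(B) minus the double integral of the kernel over
    B x B is the integral of kap(x - y) over x in B and y outside B. *)
Definition overlap := \int[m]_x (k * \1_B x - \1_B x * kconv kap \1_B x).

Lemma nonlocal_indicE : nonlocal kap \1_B = (2 * overlap)%:E.
Proof.
have bc := bmeas_conv mk k0 ki bB.
have i1 : m.-integrable setT (EFin \o (fun x => \1_B x * kconv kap \1_B x)) by exact: (integrable_bmeasM iB bc).
have ik := integrableZl measurableT k iB.
have c0 x : 0 <= kconv kap \1_B x by apply: conv_ge0 => // y; rewrite indicE.
have ic : m.-integrable setT (EFin \o kconv kap \1_B).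
  apply/integrableP; split; first by apply/measurable_EFinP; exact: bc.1.
  rewrite (eq_integral (fun x : V => (kconv kap \1_B x)%:E)); last first.
    by move=> x _; rewrite /= ger0_norm.
  rewrite (integral_conv mk k0 kN ki bB); last by move=> x; rewrite indicE.
  by rewrite integral_indic// setIT lte_mul_pinfty// lee_fin.
have Ec : \int[m]_x (kconv kap \1_B x) = k * \int[m]_x (\1_B x).
  rewrite /Rintegral (integral_conv mk k0 kN ki bB); last by move=> x; rewrite indicE.
  by rewrite fineM// integral_indic// setIT ge0_fin_numE.
have iD : m.-integrable setT (EFin \o (fun x => k * \1_B x + kconv kap \1_B x)).
  exact: (integrableD measurableT ik ic).
have i2 := integrableZl measurableT 2 i1.
have iF : m.-integrable setT (EFin \o (fun x => k * \1_B x + kconv kap \1_B x - 2 * (\1_B x * kconv kap \1_B x))).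
  exact: (integrableB measurableT iD i2).
(* Here |a - b| = a + b - 2ab for a and b in {0, 1}, integrated in y for each fixed x. *)
transitivity (\int[m]_x (k * \1_B x + kconv kap \1_B x - 2 * (\1_B x * kconv kap \1_B x)))%:E.
  rewrite /Rintegral fineK; last exact: (integrable_fin_num measurableT iF).
  apply: eq_integral => x _.
  have bx : bmeas (fun y => \1_B x - (- \1_B y) - (2 * \1_B x) * \1_B y).
    apply: bmeasB; first by apply: bmeasB; [exact: bmeas_cst|rewrite (_ : (fun y => _) = fun y => 0 - \1_B y);
      [apply: bmeasB => //; exact: bmeas_cst|apply/funext => y; rewrite sub0r]].
    split; first by apply: measurable_funM => //; exact: bB.1.
    exists (`|2 * \1_B x|) => y; rewrite normrM ler_piMr// indicE.
    by case: (_ \in _); rewrite /= ?normr0 ?normr1.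
  transitivity (kconv kap (fun y => `|\1_B x - \1_B y|) x)%:E.
    rewrite (EFin_conv mk k0 ki); first by apply: eq_integral => y _; rewrite mulrC.
    by apply: bmeas_norm; apply: bmeasB => //; exact: bmeas_cst.
  congr (_%:E); rewrite indicE; case: (x \in B) => /=.
    rewrite (_ : (fun y => _) = fun y => 1 - \1_B y).
      by rewrite (convB mk k0 ki)// ?(conv_cst mk k0 ki)//; [lra|exact: bmeas_cst].
    apply/funext => y; rewrite indicE; case: (_ \in _) => /=; rewrite ?subrr ?subr0 ?normr0 ?normr1//.
  rewrite (_ : (fun y => _) = \1_B); first lra.
  by apply/funext => y; rewrite indicE; case: (_ \in _) => /=; rewrite ?subrr ?sub0r ?normrN ?normr0 ?normr1.
congr (_%:E); rewrite RintegralB// RintegralD// !RintegralZl// Ec /overlap RintegralB// RintegralZl//.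
ring.
Qed.

(** On [B] the equation gives 1 - phi = beta (k phi - kap * phi); the symmetry of the kernel then
    moves the convolution onto the indicator. *)
Lemma resolvent_energy :
  \int[m]_x (\1_B x * (1 - phi x)) = beta * \int[m]_x (k * (\1_B x * phi x) - kconv kap \1_B x * phi x).
Proof.
have bc := bmeas_conv mk k0 ki bB; have bcp := bmeas_conv mk k0 ki bphi.
have [_ _ _ eqn] := rphi.
have i1 : m.-integrable setT (EFin \o (fun x => \1_B x * phi x)) by exact: (integrable_bmeasM iB bphi).
have i2 : m.-integrable setT (EFin \o (fun x => \1_B x * kconv kap phi x)) by exact: (integrable_bmeasM iB bcp).
have i3 : m.-integrable setT (EFin \o (fun x => kconv kap \1_B x * phi x)).
  apply: eq_integrable (integrable_bmeasM iphi bc) => // x _; congr (_%:E); exact: mulrC.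
have ik := integrableZl measurableT k i1.
rewrite (eq_RintegralT (g := fun x : V => beta * (k * (\1_B x * phi x) - \1_B x * kconv kap phi x))); last first.
  move=> x; have := eqn x; rewrite indicE; case: (x \in B) => /= e; last by rewrite !mul0r; ring.
  by rewrite !mul1r; lra.
rewrite RintegralZl//; last exact: (integrableB measurableT ik i2).
by rewrite !RintegralB// (conv_dual mk k0 kN ki iB bB bphi).
Qed.

(** Pointwise comparison with the integrand of [overlap]: on [B] the factor k - kap * chi_B is
    nonnegative and phi <= 1, and outside [B] the left integrand is nonpositive. *)
Lemma resolvent_energy_le : \int[m]_x (\1_B x * (1 - phi x)) <= beta * overlap.
Proof.
rewrite resolvent_energy; apply: ler_wpM2l => //.
have bc := bmeas_conv mk k0 ki bB.
have i1 : m.-integrable setT (EFin \o (fun x => \1_B x * phi x)) by exact: (integrable_bmeasM iB bphi).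
have i3 : m.-integrable setT (EFin \o (fun x => kconv kap \1_B x * phi x)).
  apply: eq_integrable (integrable_bmeasM iphi bc) => // x _; congr (_%:E); exact: mulrC.
have i4 : m.-integrable setT (EFin \o (fun x => \1_B x * kconv kap \1_B x)) by exact: (integrable_bmeasM iB bc).
apply: le_Rintegral => //.
- exact: (integrableB measurableT (integrableZl measurableT k i1) i3).
- exact: (integrableB measurableT (integrableZl measurableT k iB) i4).
move=> x _.
have c0 : 0 <= kconv kap \1_B x by apply: conv_ge0 => // y; rewrite indicE.
have ck : kconv kap \1_B x <= k.
  rewrite -[leRHS]mul1r -(conv_cst mk k0 ki 1 x); apply: (le_conv mk k0 ki x bB (bmeas_cst 1)).
  by move=> y; rewrite indicE; case: (_ \in _).
have := p0 x; have := p1 x; rewrite indicE; case: (x \in B) => /= h1 h0; nra.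
Qed.

(** The gap is beta times the integral of (k chi_B - kap * chi_B)(chi_B - phi). In the first factor
    the part from [kap1] is at most its mass and meets the small L^1 distance [v]; the part from
    [kap2] is integrated against a factor at most 1. With [kap1] far and [kap2] near at a fixed
    radius, the bound is uniform in the truncation of [kap]. *)
Lemma resolvent_energy_ge (kap1 kap2 : V -> R) (k1 v N2 : R) :
  measurable_fun setT kap1 -> (forall h, 0 <= kap1 h) -> (\int[m]_h (kap1 h)%:E = k1%:E)%E ->
  measurable_fun setT kap2 -> (forall h, 0 <= kap2 h) ->
  (forall h, kap h <= kap1 h + kap2 h) ->
  (\int[m]_x `|\1_B x - phi x|%:E <= v%:E)%E -> (nonlocal kap2 \1_B <= N2%:E)%E ->
  beta * overlap - \int[m]_x (\1_B x * (1 - phi x)) <= beta * (k1 * v + N2).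
Proof.
move=> mk1 k10 ki1 mk2 k20 k12 hv hN.
rewrite resolvent_energy -mulrBr; apply: ler_wpM2l => //.
have bc := bmeas_conv mk k0 ki bB.
have i1 : m.-integrable setT (EFin \o (fun x => \1_B x * phi x)) by exact: (integrable_bmeasM iB bphi).
have i3 : m.-integrable setT (EFin \o (fun x => kconv kap \1_B x * phi x)).
  apply: eq_integrable (integrable_bmeasM iphi bc) => // x _; congr (_%:E); exact: mulrC.
have i4 : m.-integrable setT (EFin \o (fun x => \1_B x * kconv kap \1_B x)) by exact: (integrable_bmeasM iB bc).
have j1 : m.-integrable setT (EFin \o (fun x => k * (\1_B x * phi x) - kconv kap \1_B x * phi x)).
  exact: (integrableB measurableT (integrableZl measurableT k i1) i3).
have j2 : m.-integrable setT (EFin \o (fun x => k * \1_B x - \1_B x * kconv kap \1_B x)).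
  exact: (integrableB measurableT (integrableZl measurableT k iB) i4).
rewrite /overlap -RintegralB// -lee_fin /Rintegral fineK; last first.
  exact: (integrable_fin_num measurableT (integrableB measurableT j2 j1)).
have mD : measurable_fun [set: V] (fun x => `|\1_B x - phi x|%:E).
  by apply/measurable_EFinP; have [] := bmeas_norm (bmeasB bB bphi).
have md2 := measurable_deviation mk2 k20 bB.1.
have k1_ge0 : 0 <= k1 by exact: mass_ge0 k10 ki1.
apply: (@le_trans _ _ (\int[m]_x (k1%:E * `|\1_B x - phi x|%:E + deviation kap2 \1_B x))%E); last first.
  rewrite ge0_integralD//; last 3 first.
  - by move=> x _; rewrite mule_ge0// lee_fin.
  - exact: measurable_funeM.
  - by move=> x _; exact: deviation_ge0.
  rewrite ge0_integralZl_EFin// EFinD EFinM.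
  by apply: leeD => //; apply: lee_wpmul2l => //; rewrite lee_fin.
apply: (@le_trans _ _ (\int[m]_x `|(k * \1_B x - \1_B x * kconv kap \1_B x) - (k * (\1_B x * phi x) - kconv kap \1_B x * phi x)|%:E)%E).
  apply: le_integral => //; first exact: (integrableB measurableT j2 j1).
    exact: (integrable_norm (integrableB measurableT j2 j1)).
  by move=> x _; rewrite lee_fin; exact: ler_norm.
apply: ge0_le_integral => //.
- apply/measurable_EFinP; apply: measurableT_comp => //.
  by apply/measurable_EFinP; exact: measurable_int (integrableB measurableT j2 j1).
- by apply: emeasurable_funD => //; exact: measurable_funeM.
move=> x _.
(* The factorization uses that an indicator equals its own square. *)
have -> : (k * \1_B x - \1_B x * kconv kap \1_B x) - (k * (\1_B x * phi x) - kconv kap \1_B x * phi x) =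
   (k * \1_B x - kconv kap \1_B x) * (\1_B x - phi x).
  by rewrite indicE; case: (x \in B) => /=; ring.
rewrite normrM EFinM.
have d1 : `|\1_B x - phi x| <= 1.
  by have := p0 x; have := p1 x; rewrite indicE ler_norml; case: (x \in B) => /=; lra.
apply: (@le_trans _ _ (deviation kap \1_B x * `|\1_B x - phi x|%:E)%E).
  by apply: lee_wpmul2r; [rewrite lee_fin|exact: kconv_deviation].
have dv1 : (deviation kap1 \1_B x <= k1%:E)%E.
  rewrite -(mul1r k1) -(conv_cst mk1 k10 ki1 1 x) (EFin_conv mk1 k10 ki1 x (bmeas_cst 1)).
  apply: ge0_le_integral => //.
  - by move=> y _; rewrite lee_fin mulr_ge0.
  - apply/measurable_EFinP; apply: measurable_funM; last exact: measurable_refl.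
    by apply: measurableT_comp => //; apply: measurable_funB => //; exact: bB.1.
  - by apply/measurable_EFinP; apply: measurable_funM => //; exact: measurable_refl.
  - move=> y _; rewrite lee_fin mulrC ler_wpM2l// !indicE.
    by do 2 case: (_ \in _); rewrite /= ?subrr ?subr0 ?sub0r ?normrN ?normr0 ?normr1.
have dv : (deviation kap \1_B x <= deviation kap1 \1_B x + deviation kap2 \1_B x)%E.
  have mm (q : V -> R) : measurable_fun setT q -> measurable_fun [set: V] (fun y : V => (`|\1_B x - \1_B y| * q (x - y))%:E).
    move=> mq; apply/measurable_EFinP; apply: measurable_funM; last exact: measurable_refl.
    by apply: measurableT_comp => //; apply: measurable_funB => //; exact: bB.1.
  rewrite /deviation -ge0_integralD//; last 4 first.
  - by move=> y _; rewrite lee_fin mulr_ge0.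
  - exact: mm.
  - by move=> y _; rewrite lee_fin mulr_ge0.
  - exact: mm.
  apply: ge0_le_integral => //.
  - by move=> y _; rewrite lee_fin mulr_ge0.
  - exact: mm.
  - by apply: emeasurable_funD; exact: mm.
  - by move=> y _; rewrite -EFinD -mulrDr lee_fin ler_wpM2l.
have d20 : (0 <= deviation kap2 \1_B x)%E by exact: deviation_ge0.
have d10 : (0 <= deviation kap1 \1_B x)%E by exact: deviation_ge0.
apply: (@le_trans _ _ ((deviation kap1 \1_B x + deviation kap2 \1_B x) * `|\1_B x - phi x|%:E)%E).
  by apply: lee_wpmul2r => //; rewrite lee_fin.
rewrite ge0_muleDl//; apply: leeD; first by apply: lee_wpmul2r => //; rewrite lee_fin.
rewrite -[leRHS]mule1; apply: lee_wpmul2l => //.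
Qed.

End compare.

Section resolvent_compare.
Context {R : realType} {n : nat}.
Local Notation V := 'rV[R]_n.
Local Notation m := (borel_lebesgue R n).
Variables (kap kap' : V -> R) (k k' beta : R) (B : set V) (phi phi' : V -> R).
Hypotheses (mk : measurable_fun setT kap) (k0 : forall h, 0 <= kap h)
  (kN : forall h, kap (- h) = kap h) (ki : (\int[m]_h (kap h)%:E = k%:E)%E)
  (mk' : measurable_fun setT kap') (k0' : forall h, 0 <= kap' h)
  (kN' : forall h, kap' (- h) = kap' h) (ki' : (\int[m]_h (kap' h)%:E = k'%:E)%E)
  (kk' : forall h, kap h <= kap' h)
  (b0 : 0 <= beta) (mB : measurable B) (Bfin : (m B < +oo)%E).
Hypothesis rphi : resolvent kap k beta B phi.
Hypothesis rphi' : resolvent kap' k' beta B phi'.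

Let bphi : bmeas phi. Proof. by case: rphi. Qed.
Let bphi' : bmeas phi'. Proof. by case: rphi'. Qed.

Let dk h := kap' h - kap h.
Let mdk : measurable_fun [set: V] dk. Proof. exact: measurable_funB. Qed.
Let dk0 h : 0 <= dk h. Proof. by rewrite subr_ge0. Qed.
Let dkN h : dk (- h) = dk h. Proof. by rewrite /dk kN kN'. Qed.

Let dki : (\int[m]_h (dk h)%:E = (k' - k)%:E)%E.
Proof.
rewrite /dk; under eq_integral do rewrite EFinB.
have i := ge0_integrable_EFin mk k0 ki (ltry k).
have i' := ge0_integrable_EFin mk' k0' ki' (ltry k').
by rewrite integralB_EFin// ki ki'.
Qed.

(** The difference phi - phi' solves the equation for the smaller kernel [kap] with source beta
    times the operator of the kernel difference applied to phi'. The contraction bounds it by the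
    energy of phi' for that kernel difference, hence by the energy of the indicator. *)
Lemma resolvent_compare :
  (\int[m]_x `|phi x - phi' x|%:E <= beta%:E * nonlocal (fun h => (kap' h - kap h)%R) \1_B)%E.
Proof.
have bd := bmeasB bphi bphi'.
apply: (@le_trans _ _ (beta%:E * nonlocal dk phi')%E); last first.
  apply: lee_wpmul2l; first by rewrite lee_fin.
  apply: (le_nonlocal mdk dk0 dkN bphi'.1 mdk dk0 dkN (bmeas_indic mB).1) => // h.
  exact: (resolvent_dist1 mk' k0' kN' ki' b0 mB Bfin rphi').
have md := measurable_deviation mdk dk0 bphi'.1.
have d_ge0 x := @deviation_ge0 R n dk phi' x dk0.
rewrite /nonlocal -ge0_integralZl_EFin//; last by move=> x _; exact: d_ge0.
apply: (kconv_contraction mk k0 kN ki (g := fun x => (beta%:E * deviation dk phi' x)%E) b0 bd).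
- apply: (@le_lt_trans _ _ (\int[m]_x (`|phi x|%:E + `|phi' x|%:E))%E).
    apply: ge0_le_integral => //.
    + by apply/measurable_EFinP; have [] := bmeas_norm bd.
    + by apply: emeasurable_funD; apply/measurable_EFinP; [have [] := bmeas_norm bphi|have [] := bmeas_norm bphi'].
    + by move=> x _; rewrite -EFinD lee_fin; exact: ler_normB.
  rewrite ge0_integralD//; last 2 first.
  + by apply/measurable_EFinP; have [] := bmeas_norm bphi.
  + by apply/measurable_EFinP; have [] := bmeas_norm bphi'.
  by apply: lte_add_pinfty; apply: le_lt_trans Bfin; [exact: resolvent_L1 rphi|exact: resolvent_L1 rphi'].
- exact: measurable_funeM.
- by move=> x; rewrite mule_ge0.
move=> x.
have [_ _ _ /(_ x) e] := rphi; have [_ _ _ /(_ x) e'] := rphi'.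
have bk : 0 < 1 + beta * k by rewrite ltr_pwDl// mulr_ge0//; exact: mass_ge0 k0 ki.
have cd : kconv dk phi' x = kconv kap' phi' x - kconv kap phi' x.
  rewrite /kconv -RintegralB//; try exact: (integrable_conv mk k0 ki x bphi');
    try exact: (integrable_conv mk' k0' ki' x bphi').
  by apply: eq_RintegralT => y; rewrite mulrBl.
rewrite -[X in X * _](gtr0_norm bk) -normrM mulrBr e.
rewrite (_ : _ - _ = beta * (kconv kap phi x - kconv kap phi' x) + beta * ((k' - k) * phi' x - kconv dk phi' x)); last first.
  by rewrite cd; lra.
apply: (@le_trans _ _ (`|beta * (kconv kap phi x - kconv kap phi' x)| + `|beta * ((k' - k) * phi' x - kconv dk phi' x)|)%:E).
  by rewrite lee_fin ler_normD.
rewrite addrC EFinD; apply: leeD.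
  rewrite normrM (ger0_norm b0) EFinM; apply: lee_wpmul2l; first by rewrite lee_fin.
  exact: (kconv_deviation x mdk dk0 dki bphi').
rewrite lee_fin normrM (ger0_norm b0) ler_wpM2l//.
rewrite -(convB mk k0 ki x bphi bphi').
exact: (norm_conv mk k0 ki x bd).
Qed.

End resolvent_compare.

(** * Limits of geometrically Cauchy sequences in L^1 *)

Section L1_completeness.
Context {R : realType} {n : nat}.
Local Notation V := 'rV[R]_n.
Local Notation m := (borel_lebesgue R n).

(** The limit is taken to be the pointwise limsup, which is Borel and in [0, 1] at every point, so
    that no exceptional null set has to be chosen. The factor 2 is the sum of the geometric
    series. *)
Lemma L1_geometric_limit (u : nat -> V -> R) : (forall j, measurable_fun [set: V] (u j)) ->
  (forall j x, 0 <= u j x <= 1) ->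
  (forall j, (\int[m]_x `|u j x - u j.+1 x|%:E <= (2^-1 ^+ j)%:E)%E) ->
  exists phi : V -> R, [/\ measurable_fun [set: V] phi, forall x, 0 <= phi x <= 1 &
    forall j, (\int[m]_x `|u j x - phi x|%:E <= (2 * 2^-1 ^+ j)%:E)%E].
Proof.
move=> mu u01 hu.
pose f j x : \bar R := (u j x)%:E.
pose L x := limn_esup (f^~ x).
have mf j : measurable_fun [set: V] (f j) by exact/measurable_EFinP.
have mL : measurable_fun [set: V] L by exact: (measurable_fun_limn_esup mf).
have bd x (k : nat) (a b : \bar R) : (forall i, (k <= i)%N -> (a <= f i x <= b)%E) -> (a <= L x <= b)%E.
  move=> h; rewrite /L limn_esup_lim; apply/andP; split.
    apply: lime_ge; first exact: is_cvg_esups.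
    exists k => // i /= ki; have /andP[ai _] := h _ ki.
    by apply: le_trans ai _; apply: ereal_sup_ubound; exists i => /=.
  apply: lime_le; first exact: is_cvg_esups.
  exists k => // i /= ki; apply: ge_ereal_sup => _ [j /= ij <-].
  by have /andP[] := h _ (leq_trans ki ij).
have L01 x : (0 <= L x <= 1)%E.
  by apply: (bd x 0%N) => i _; rewrite !lee_fin.
have Lfin x : L x \is a fin_num.
  have /andP[h0 h1] := L01 x; rewrite ge0_fin_numE//; exact: le_lt_trans h1 (ltry _).
pose phi x := fine (L x).
have phiE x : (phi x)%:E = L x by rewrite fineK.
have mphi : measurable_fun [set: V] phi.
  by apply/measurable_EFinP; rewrite (_ : EFin \o phi = L)//; apply/funext => x; exact: phiE.
exists phi; split => // [x|k].
  by have := L01 x; rewrite -phiE !lee_fin.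
have md j : measurable_fun [set: V] (fun x => `|u j x - u j.+1 x|%:E).
  by apply/measurable_EFinP; apply: measurableT_comp => //; exact: measurable_funB.
pose S x := (\sum_(i <oo) `|u (k + i)%N x - u (k + i).+1 x|%:E)%E.
have S0 x : (0 <= S x)%E by apply: nneseries_ge0 => i _ _; rewrite lee_fin.
have hS x i : (`|u k x - u (k + i)%N x|%:E <= S x)%E.
  apply: (@le_trans _ _ (\sum_(0 <= l < i) `|u (k + l)%N x - u (k + l).+1 x|%:E)%E); last first.
    by apply: nneseries_lim_ge => l _ _; rewrite lee_fin.
  rewrite sumEFin lee_fin; elim: i => [|i IH]; first by rewrite addn0 subrr normr0 big_nil.
  rewrite big_nat_recr//= addnS; apply: le_trans (lerD IH (lexx _)).
  exact: ler_distD.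
apply: (@le_trans _ _ (\int[m]_x S x)%E).
  apply: ge0_le_integral => //.
  - by apply/measurable_EFinP; apply: measurableT_comp => //; exact: measurable_funB.
  - by apply: ge0_emeasurable_sum => // i x _ _; rewrite lee_fin.
  (* Where the sum of increments is infinite the bound is trivial. Where it is a real t, all terms
     from index k on lie within t of u_k, hence so does their limsup. *)
  move=> x _; move: (S0 x) (hS x); case: (S x) => [t| |]; [|by move=> _ _; exact: leey|by []].
  rewrite lee_fin => t0 ht; rewrite lee_fin.
  have : ((u k x - t)%:E <= L x <= (u k x + t)%:E)%E.
    apply: (bd x k) => i ki; have := ht (i - k)%N; rewrite subnKC// !lee_fin ler_norml; lra.
  by rewrite -phiE !lee_fin ler_norml; lra.
rewrite integral_nneseries//.
apply: (@le_trans _ _ (\sum_(i <oo) (2^-1 ^+ k * 2^-1 ^+ i)%:E)%E).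
  apply: lee_nneseries => i _; first by move=> _; apply: integral_ge0 => x _; rewrite lee_fin.
  by rewrite -exprD; exact: hu.
apply: le_trans (nneseries_geometric_le _ _) _.
- by rewrite exprn_ge0.
- by rewrite invr_ge0 ler0n/= invf_lt1// ltr1n.
- by rewrite lee_fin le_eqVlt; apply/orP; left; apply/eqP; field.
Qed.

End L1_completeness.

(** * The fractional Laplacian on test functions *)

Lemma kfarE {R : realType} {n : nat} (s r : R) (h : 'rV[R]_n) :
  kfar s r h = if r < enorm h then (enorm h `^ (n%:R + s))^-1 else 0.
Proof. by []. Qed.

Lemma kernN {R : realType} {n : nat} (s : R) (h : 'rV[R]_n) : kern s (- h) = kern s h.
Proof. by rewrite /kern enormN. Qed.

Lemma knearN {R : realType} {n : nat} (s r : R) (h : 'rV[R]_n) : knear s r (- h) = knear s r h.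
Proof. by rewrite /knear kernN enormN. Qed.

Lemma Rintegral_leb {R : realType} {n : nat} (f : 'rV[R]_n -> R) : measurable_fun setT f ->
  \int[leb]_(x in [set: lebRn R n]) f x = \int[borel_lebesgue R n]_x f x.
Proof. by move=> mf; congr fine; apply: (@integral_leb R n (EFin \o f)); exact/measurable_EFinP. Qed.

(** * Mass of the far kernel and smallness of the near kernel *)

Section near_far.
Context {R : realType} {n : nat}.
Local Notation V := 'rV[R]_n.
Local Notation m := (borel_lebesgue R n).
Variable s : R.
Hypotheses (n_gt0 : (0 < n)%N) (s_gt0 : 0 < s) (s_lt1 : s < 1).

Local Notation kern := (@kern R n s).
Local Notation kfar := (@kfar R n s).
Local Notation knear := (@knear R n s).
Local Notation kc := (@knear_cst R n s).

Definition far_mass r : R := fine (\int[m]_h (kfar r h)%:E)%E.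

Lemma far_massE r : 0 < r -> (\int[m]_h (kfar r h)%:E = (far_mass r)%:E)%E.
Proof.
move=> r0; rewrite /far_mass fineK// ge0_fin_numE; first exact: kfar_lty.
by apply: integral_ge0 => h _; rewrite lee_fin kfar_ge0.
Qed.

Lemma far_mass_ge0 r : 0 <= far_mass r.
Proof. by apply: fine_ge0; apply: integral_ge0 => h _; rewrite lee_fin kfar_ge0. Qed.

Lemma knear_cst_ge0 : 0 <= kc.
Proof.
have := knear_moment_le s_gt0 n_gt0 s_lt1 (@ltr01 R).
rewrite powR1 mulr1 -lee_fin; apply: le_trans; apply: integral_ge0 => h _.
by rewrite lee_fin mulr_ge0 ?knear_ge0// enorm_ge0.
Qed.

(** A modulus linear in |h| turns the near energy into the first moment of the near kernel. For a
    set of finite perimeter [p] is the perimeter. *)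
Lemma nonlocal_knear_le (u : V -> R) (p r : R) : measurable_fun setT u -> 0 <= p -> 0 < r ->
  (forall h, dist1 u h <= (p * enorm h)%:E)%E ->
  (nonlocal (knear r) u <= (p * (kc * r `^ (1 - s)))%:E)%E.
Proof.
move=> mu p0 r0 hp.
rewrite (nonlocal_shift (measurable_knear s r) (knear_ge0 s r) (knearN s r) mu).
apply: (@le_trans _ _ (\int[m]_h (p%:E * (knear r h * enorm h)%:E))%E); last first.
  rewrite ge0_integralZl_EFin//.
  - by rewrite EFinM lee_wpmul2l ?lee_fin//; exact: knear_moment_le.
  - by move=> h _; rewrite lee_fin mulr_ge0 ?knear_ge0 ?enorm_ge0.
  - apply/measurable_EFinP; apply: measurable_funM; first exact: measurable_knear.
    exact: measurable_enorm.
apply: ge0_le_integral => //.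
- by move=> h _; rewrite mule_ge0 ?lee_fin ?knear_ge0// dist1_ge0.
- apply: emeasurable_funM; last exact: measurable_dist1.
  by apply/measurable_EFinP; exact: measurable_knear.
- apply: measurable_funeM; apply/measurable_EFinP; apply: measurable_funM; first exact: measurable_knear.
  exact: measurable_enorm.
move=> h _; rewrite -EFinM mulrCA EFinM; apply: lee_wpmul2l; first by rewrite lee_fin knear_ge0.
exact: hp.
Qed.

(** The pointwise counterpart of [nonlocal_knear_le], with a Lipschitz constant in place of the L^1
    modulus. *)
Lemma deviation_knear_le (u : V -> R) (L r : R) (x : V) : measurable_fun setT u -> 0 <= L -> 0 < r ->
  (forall x v, `|u (x + v) - u x| <= L * enorm v) ->
  (deviation (knear r) u x <= (L * (kc * r `^ (1 - s)))%:E)%E.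
Proof.
move=> mu L0 r0 hL.
have mg : measurable_fun [set: V] (fun h => knear r h * enorm h).
  by apply: measurable_funM; [exact: measurable_knear|exact: measurable_enorm].
apply: (@le_trans _ _ (\int[m]_y (L%:E * (knear r (x - y) * enorm (x - y))%:E))%E); last first.
  rewrite ge0_integralZl_EFin//.
  - rewrite EFinM lee_wpmul2l ?lee_fin//.
    rewrite (integral_reflect x (f := fun h : V => (knear r h * enorm h)%:E)); last exact/measurable_EFinP.
    exact: knear_moment_le.
  - by move=> h _; rewrite lee_fin mulr_ge0 ?knear_ge0 ?enorm_ge0.
  - by apply/measurable_EFinP; exact: (measurable_refl x mg).
apply: ge0_le_integral => //.
- by move=> h _; rewrite lee_fin mulr_ge0 ?knear_ge0.
- apply/measurable_EFinP; apply: measurable_funM; last by apply: measurable_refl; exact: measurable_knear.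
  by apply: measurableT_comp => //; apply: measurable_funB.
- by apply: measurable_funeM; apply/measurable_EFinP; exact: (measurable_refl x mg).
move=> y _; rewrite -EFinM lee_fin mulrA (mulrC L) -mulrA [leRHS]mulrC -(mulrC (knear _ _)) (mulrC (knear _ _)).
apply: ler_wpM2r; first exact: knear_ge0.
by rewrite enorm_distC distrC; have := hL x (y - x); rewrite (addrC x) subrK.
Qed.

Lemma powR_small (C e : R) : 0 <= C -> 0 < e -> exists2 r, 0 < r & C * r `^ (1 - s) <= e.
Proof.
move=> C0 e0; exists ((e / (C + 1)) `^ (1 - s)^-1).
  by rewrite powR_gt0// divr_gt0// ltr_wpDl.
rewrite -powRrM mulVf ?gt_eqF ?subr_gt0// powRr1; last by rewrite divr_ge0 ?addr_ge0// ltW.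
have C1 : 0 < C + 1 by rewrite ltr_wpDl.
by rewrite mulrA ler_pdivrMr// mulrC ler_wpM2l ?ltW// ltrDl.
Qed.

End near_far.

Section frac_laplacian.
Context {R : realType} {n : nat}.
Local Notation V := 'rV[R]_n.
Local Notation m := (borel_lebesgue R n).
Variable s : R.
Hypotheses (n_gt0 : (0 < n)%N) (s_gt0 : 0 < s) (s_lt1 : s < 1).

Local Notation kern := (@kern R n s).
Local Notation kfar := (@kfar R n s).
Local Notation knear := (@knear R n s).
Local Notation kc := (@knear_cst R n s).
Local Notation far_mass := (@far_mass R n s).

Definition lap_far r (u : V -> R) (x : V) : R := far_mass r * u x - kconv (kfar r) u x.

(* [(- Delta)^(s/2)] without its constant; see [frac_laplacianE]. *)
Definition lap (u : V -> R) (x : V) : R := \int[m]_y ((u x - u y) * kern (x - y)).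

Lemma bmeas_lap_far r u : 0 < r -> bmeas u -> bmeas (lap_far r u).
Proof.
move=> r0 bu; apply: bmeasB.
  case: bu => mu [M hM]; split; first exact: measurable_funM.
  by exists (far_mass r * M) => x; rewrite normrM ger0_norm ?far_mass_ge0// ler_wpM2l// far_mass_ge0.
exact: (bmeas_conv (measurable_kfar s r) (kfar_ge0 s r) (far_massE s_gt0 r0) bu).
Qed.

Let integrable_far r u x : 0 < r -> bmeas u ->
  m.-integrable setT (fun y : V => ((u x - u y) * kfar r (x - y))%:E).
Proof.
move=> r0 bu.
have bx : bmeas (fun y => u x - u y) by apply: bmeasB => //; exact: bmeas_cst.
apply: eq_integrable (integrable_conv (measurable_kfar s r) (kfar_ge0 s r) (far_massE s_gt0 r0) x bx) => //.
by move=> y _; rewrite mulrC.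
Qed.

Lemma lap_farE r u x : 0 < r -> bmeas u ->
  lap_far r u x = \int[m]_y ((u x - u y) * kfar r (x - y)).
Proof.
move=> r0 bu.
have bc : bmeas (fun _ : V => u x) by exact: bmeas_cst.
have mk := measurable_kfar (n := n) s r; have k0 := kfar_ge0 (n := n) s r; have ki := far_massE (n := n) s_gt0 r0.
rewrite /lap_far mulrC -(conv_cst mk k0 ki (u x) x) -(convB mk k0 ki x bc bu).
by apply: eq_RintegralT => y; rewrite mulrC.
Qed.

Section test.
Variables (u : V -> R) (L : R).
Hypotheses (bu : bmeas u) (L0 : 0 <= L) (hL : forall x v, `|u (x + v) - u x| <= L * enorm v).

Let mker x (q : V -> R) : measurable_fun setT q -> measurable_fun [set: V] (fun y => (u x - u y) * q (x - y)).
Proof.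
move=> mq; apply: measurable_funM; last exact: measurable_refl.
by apply: measurable_funB => //; exact: bu.1.
Qed.

Let integrable_near r x : 0 < r ->
  m.-integrable setT (fun y : V => ((u x - u y) * knear r (x - y))%:E).
Proof.
move=> r0; apply/integrableP; split.
  by apply/measurable_EFinP; apply: mker; exact: measurable_knear.
apply: le_lt_trans (ltry (L * (kc * r `^ (1 - s)))).
apply: le_trans (deviation_knear_le n_gt0 s_gt0 s_lt1 x bu.1 L0 r0 hL).
rewrite le_eqVlt; apply/orP; left; apply/eqP; apply: eq_integral => y _.
by rewrite /= normrM (ger0_norm (knear_ge0 s r (x - y))).
Qed.

Lemma lap_dev r x : 0 < r -> (`|lap u x - lap_far r u x|%:E <= deviation (knear r) u x)%E.
Proof.
move=> r0; rewrite lap_farE// /lap.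
have ifar := integrable_far x r0 bu; have inear := integrable_near x r0.
rewrite (eq_RintegralT (g := fun y : V => (u x - u y) * kfar r (x - y) + (u x - u y) * knear r (x - y))); last first.
  by move=> y; rewrite -mulrDr -kern_split.
rewrite RintegralD// addrAC subrr add0r.
apply: (@le_trans _ _ (\int[m]_y `|(u x - u y) * knear r (x - y)|)%:E).
  by rewrite lee_fin; exact: le_normr_Rintegral.
rewrite /Rintegral fineK; last exact: (integrable_fin_num measurableT (integrable_norm inear)).
rewrite le_eqVlt; apply/orP; left; apply/eqP; apply: eq_integral => y _.
by rewrite normrM (ger0_norm (knear_ge0 s r (x - y))).
Qed.

Lemma lap_dist r x : 0 < r -> `|lap u x - lap_far r u x| <= L * (kc * r `^ (1 - s)).
Proof.
move=> r0; rewrite -lee_fin; apply: le_trans (lap_dev x r0) _.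
exact: (deviation_knear_le n_gt0 s_gt0 s_lt1 x bu.1 L0 r0 hL).
Qed.

(** For s < 1 and a bounded Lipschitz function the singular integral converges absolutely, so the
    principal value is an ordinary integral; the remainder is O(r^(1-s)). *)
Lemma lap_far_cvg x : lap_far r u x @[r --> 0^'+] --> lap u x.
Proof.
have LC : 0 <= L * kc by rewrite mulr_ge0// knear_cst_ge0.
have s1 : 0 < 1 - s by rewrite subr_gt0.
have h0 : cst (L * kc) @ (0 : R)^'+ --> L * kc by exact: cvg_cst.
have h1 : (fun r : R => (L * kc) * r `^ (1 - s)) @ 0^'+ --> (0 : R).
  by rewrite -[X in _ --> X](mulr0 (L * kc)); exact: (cvgM h0 (powR_cvg0 s1)).
apply/cvgrPdist_le => e e0.
near=> r.
apply: le_trans (lap_dist x _) _ => //.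
near: r.
have /cvgrPdist_le/(_ e e0) := h1; apply: filterS => r.
by rewrite sub0r normrN /= mulrA; apply: le_trans; exact: ler_norm.
Unshelve. all: end_near. Qed.

Lemma frac_laplacianE x : frac_laplacian s u x = frac_const (n := n) s * lap u x.
Proof.
rewrite /frac_laplacian; congr (_ * _); apply: cvg_lim => //.
apply: (cvg_trans _ (@lap_far_cvg x)).
apply: near_eq_cvg; near=> r.
have r0 : 0 < r by [].
rewrite lap_farE// -Rintegral_leb; last by apply: mker; exact: measurable_kfar.
rewrite [RHS]Rintegral_mkcond; apply: eq_Rintegral => y _; rewrite patchE.
have -> : (y \in [set y : lebRn R n | r < enorm (x - y)]) = (r < enorm (x - y)).
  by apply/idP/idP; rewrite inE.
by rewrite kfarE; case: ifP; rewrite ?mulr0.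
Unshelve. all: end_near. Qed.

Lemma bmeas_lap : bmeas (lap u).
Proof.
have r0 (j : nat) : 0 < j.+1%:R^-1 :> R by rewrite invr_gt0.
split.
  apply: (@measurable_fun_cvg _ _ _ _ (fun j => lap_far j.+1%:R^-1 u)) => [j|x _].
    by have [] := bmeas_lap_far (r0 j) bu.
  have /cvg_at_rightP := @lap_far_cvg x; apply; split => //.
  exact: cvg_harmonic.
have [_ [M hM]] := bmeas_lap_far (@ltr01 R) bu.
exists (L * (kc * 1 `^ (1 - s)) + M) => x.
rewrite -[lap u x](subrK (lap_far 1 u x)); apply: le_trans (ler_normD _ _) _.
by apply: lerD => //; exact: lap_dist.
Qed.

Lemma lap_dist_L1 p r : 0 <= p -> 0 < r -> (forall h, dist1 u h <= (p * enorm h)%:E)%E ->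
  (\int[m]_x `|lap u x - lap_far r u x|%:E <= (p * (kc * r `^ (1 - s)))%:E)%E.
Proof.
move=> p0 r0 hp; apply: le_trans (nonlocal_knear_le n_gt0 s_gt0 s_lt1 bu.1 p0 r0 hp).
apply: ge0_le_integral => //.
- apply/measurable_EFinP; have [] := bmeas_norm (bmeasB bmeas_lap (bmeas_lap_far r0 bu)); by [].
- exact: (measurable_deviation (measurable_knear s r) (knear_ge0 s r) bu.1).
by move=> x _; exact: lap_dev.
Qed.

End test.
End frac_laplacian.

(** * Existence of the potential *)

Section estimates.
Context {R : realType} {n : nat}.
Local Notation V := 'rV[R]_n.
Local Notation m := (borel_lebesgue R n).

Lemma le_geometric (a b c : R) : (forall j, a <= b + c * 2^-1 ^+ j) -> a <= b.
Proof.
move=> h.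
have h0 : cst c @ \oo --> c by exact: cvg_cst.
have hz : `|2^-1 : R| < 1 by rewrite ger0_norm// invf_lt1// ltr1n.
have hb : cst b @ \oo --> b by exact: cvg_cst.
have h2 : (fun j => b + c * 2^-1 ^+ j) @ \oo --> b.
  rewrite -[X in _ --> X]addr0 -(mulr0 c).
  by apply: (@cvgD _ _ _ _ _ (cst b) (fun j => c * 2^-1 ^+ j)) => //; exact: (cvgM h0 (cvg_expr hz)).
apply: (cvgr_to_ge h2); exact: nearW.
Qed.

Lemma norm_Rintegral_le (f : V -> R) (c : R) : measurable_fun setT f ->
  (\int[m]_x `|f x|%:E <= c%:E)%E ->
  m.-integrable setT (EFin \o f) /\ `|\int[m]_x f x| <= c.
Proof.
move=> mf fc.
have fi : m.-integrable setT (EFin \o f).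
  apply/integrableP; split; first exact/measurable_EFinP.
  exact: le_lt_trans fc (ltry _).
split => //; apply: (@le_trans _ _ (\int[m]_x `|f x|)); first exact: le_normr_Rintegral.
by rewrite -lee_fin /Rintegral fineK//; exact: (integrable_fin_num measurableT (integrable_norm fi)).
Qed.

Lemma le_integral_bounded (f u : V -> R) (M : R) (c : \bar R) : measurable_fun setT f -> measurable_fun setT u ->
  0 <= M -> (forall x, `|u x| <= M) -> (\int[m]_x `|f x|%:E <= c)%E ->
  (\int[m]_x `|f x * u x|%:E <= M%:E * c)%E.
Proof.
move=> mf mu M0 hM fc.
apply: (@le_trans _ _ (M%:E * \int[m]_x `|f x|%:E)%E); last by rewrite lee_wpmul2l ?lee_fin.
have mn : measurable_fun [set: V] (fun x => `|f x|%:E).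
  by apply/measurable_EFinP; exact: measurableT_comp.
rewrite -ge0_integralZl_EFin//; apply: ge0_le_integral => //.
- apply/measurable_EFinP; apply: measurableT_comp => //; exact: measurable_funM.
- exact: measurable_funeM.
- by move=> x _; rewrite -EFinM lee_fin normrM mulrC ler_wpM2r.
Qed.

End estimates.

Section existence.
Context {R : realType} {n : nat}.
Local Notation V := 'rV[R]_n.
Local Notation m := (borel_lebesgue R n).
Variable s : R.
Hypotheses (n_gt0 : (0 < n)%N) (s_gt0 : 0 < s) (s_lt1 : s < 1).
Local Notation kc := (@knear_cst R n s).
Local Notation far_mass := (@far_mass R n s).
Local Notation kfar := (@kfar R n s).

Variables (B : set V) (p : R).
Hypotheses (mB : measurable B) (Bfin : (m B < +oo)%E) (p0 : 0 <= p)
  (hp : forall h, (dist1 \1_B h <= (p * enorm h)%:E)%E).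

Let bB : bmeas (\1_B : V -> R). Proof. exact: bmeas_indic. Qed.

Lemma nonlocal_split (r : R) : 0 < r ->
  nonlocal (kern s) \1_B = (nonlocal (kfar r) \1_B + nonlocal (knear s r) \1_B)%E.
Proof.
move=> r0; rewrite [X in nonlocal X](_ : _ = fun h => kfar r h + knear s r h); last first.
  by apply/funext => h; exact: kern_split.
exact: (nonlocalD (measurable_kfar s r) (kfar_ge0 s r) (kfarN s r) bB.1
  (measurable_knear s r) (knear_ge0 s r) (knearN s r)).
Qed.

Lemma nonlocal_kfarE (r : R) : 0 < r ->
  nonlocal (kfar r) \1_B = (2 * overlap (kfar r) (far_mass r) B)%:E.
Proof.
move=> r0; exact: (nonlocal_indicE (measurable_kfar s r) (kfar_ge0 s r) (kfarN s r) (far_massE s_gt0 r0)).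
Qed.

Lemma nonlocal_kern_fin : nonlocal (kern s) \1_B \is a fin_num.
Proof.
rewrite (nonlocal_split (@ltr01 R)) nonlocal_kfarE//.
rewrite fin_numD /= ge0_fin_numE; last first.
  apply: integral_ge0 => x _; apply: integral_ge0 => y _; rewrite lee_fin mulr_ge0//; exact: knear_ge0.
apply: le_lt_trans (ltry (p * (kc * 1 `^ (1 - s)))).
exact: (nonlocal_knear_le n_gt0 s_gt0 s_lt1 bB.1 p0 (@ltr01 R) hp).
Qed.

Variable (beta : R).
Hypothesis (b0 : 0 <= beta).

(* The truncation radii [d j] make consecutive truncated solutions differ by at
   most [2^-1 ^+ j] in L^1. *)
Let C : R := beta * (p + 1) * kc.
Let kc0 : 0 <= kc. Proof. exact: knear_cst_ge0. Qed.
Let C0 : 0 <= C. Proof. by apply: mulr_ge0 => //; apply: mulr_ge0 => //; exact: addr_ge0. Qed.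

Let d (j : nat) : R := (2^-1 ^+ j / (C + 1)) `^ (1 - s)^-1.

Let e0 (j : nat) : 0 < 2^-1 ^+ j / (C + 1).
Proof. by rewrite divr_gt0 ?ltr_wpDl// exprn_gt0. Qed.

Let d0 j : 0 < d j. Proof. by rewrite powR_gt0. Qed.

Let d_dec j : d j.+1 <= d j.
Proof.
rewrite /d; apply: ge0_ler_powR.
- by rewrite invr_ge0 subr_ge0 ltW.
- by rewrite nnegrE ltW.
- by rewrite nnegrE ltW.
rewrite ler_pM2r ?invr_gt0 ?ltr_wpDl// exprS ler_piMl ?exprn_ge0//.
by rewrite invf_le1// ler1n.
Qed.

Let hd j : C * d j `^ (1 - s) <= 2^-1 ^+ j.
Proof.
rewrite /d -powRrM mulVf ?gt_eqF ?subr_gt0// powRr1; last exact: ltW.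
have C1 : 0 < C + 1 by rewrite ltr_wpDl.
by rewrite mulrA ler_pdivrMr// mulrC ler_wpM2l ?exprn_ge0// lerDl.
Qed.

(** The factor [p + 1] in [C] lets one radius serve two purposes: factor 1 here, for the operator on
    a Lipschitz function, and factor [p] in [hdp], for the near energy of the set. *)
Let hd1 j : beta * (kc * d j `^ (1 - s)) <= 2^-1 ^+ j.
Proof.
apply: le_trans (hd j); rewrite /C.
have q0 : 0 <= beta * (kc * d j `^ (1 - s)) by do ?[apply: mulr_ge0 => //]; exact: powR_ge0.
rewrite (_ : _ * _ * _ = beta * (kc * d j `^ (1 - s)) + p * (beta * (kc * d j `^ (1 - s)))); last by ring.
by rewrite lerDl mulr_ge0.
Qed.

Let hdp j : beta * (p * (kc * d j `^ (1 - s))) <= 2^-1 ^+ j.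
Proof.
apply: le_trans (hd j); rewrite /C.
have q0 : 0 <= beta * (kc * d j `^ (1 - s)) by do ?[apply: mulr_ge0 => //]; exact: powR_ge0.
rewrite (_ : _ * _ * _ = beta * (p * (kc * d j `^ (1 - s))) + beta * (kc * d j `^ (1 - s))); last by ring.
by rewrite lerDl.
Qed.

(** Each property is first obtained for the truncated solutions, with constants free of the
    truncation, and passes to the limit because all errors decay like 2^(-j). Half of
    [nonlocal (kern s)] is the fractional perimeter, and [beta] stands for eps^s c. The equation is
    stated for Lipschitz functions because this is all that its passage to the limit uses. *)
Lemma potential_exists : exists phi : V -> R,
  [/\ measurable_fun [set: V] phi, forall x, 0 <= phi x <= 1,
      forall (u : V -> R) (L : R), bmeas u -> m.-integrable setT (EFin \o u) -> 0 <= L ->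
        (forall x v, `|u (x + v) - u x| <= L * enorm v) ->
        \int[m]_x (phi x * (u x + beta * lap s u x)) = \int[m]_x (\1_B x * u x),
      \int[m]_x (\1_B x * (1 - phi x)) <= beta * (fine (nonlocal (kern s) \1_B) / 2)
    & forall r, 0 < r ->
      beta * (fine (nonlocal (kern s) \1_B) / 2) - \int[m]_x (\1_B x * (1 - phi x)) <=
      beta * (far_mass r * (beta * fine (nonlocal (kern s) \1_B)) + p * (kc * r `^ (1 - s)))].
Proof.
have mk j := measurable_kfar (n := n) s (d j).
have k0 j := kfar_ge0 (n := n) s (d j).
have kN j := kfarN (n := n) s (d j).
have ki j := far_massE (n := n) s_gt0 (d0 j).
have /choice[f rf] : forall j, exists phi, resolvent (kfar (d j)) (far_mass (d j)) beta B phi.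
  by move=> j; exact: (resolvent_exists (mk j) (k0 j) (kN j) (ki j) b0 mB).
have bf j : bmeas (f j) by case: (rf j).
have f01 j x : 0 <= f j x <= 1 by case: (rf j).
set J := fine _.
have JE : nonlocal (kern s) \1_B = J%:E by rewrite /J fineK// nonlocal_kern_fin.
have Jfar j : (nonlocal (kfar (d j)) \1_B <= J%:E)%E.
  rewrite -JE; apply: (le_nonlocal (mk j) (k0 j) (kN j) bB.1 (measurable_kern s) (kern_ge0 s) (kernN s) bB.1) => //.
  by move=> h; exact: kfar_le_kern.
have ff j : (\int[m]_x `|f j x - f j.+1 x|%:E <= (2^-1 ^+ j)%:E)%E.
  apply: le_trans (resolvent_compare (mk j) (k0 j) (kN j) (ki j) (mk j.+1) (k0 j.+1) (kN j.+1) (ki j.+1)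
    (fun h => le_kfar s h (d_dec j)) b0 mB Bfin (rf j) (rf j.+1)) _.
  apply: (@le_trans _ _ (beta%:E * nonlocal (knear s (d j)) \1_B)%E).
    apply: lee_wpmul2l; first by rewrite lee_fin.
    have mdk := measurable_funB (mk j.+1) (mk j).
    have dk0 h : 0 <= kfar (d j.+1) h - kfar (d j) h by rewrite subr_ge0; exact: le_kfar.
    have dkN h : kfar (d j.+1) (- h) - kfar (d j) (- h) = kfar (d j.+1) h - kfar (d j) h by rewrite !kN.
    exact: (le_nonlocal mdk dk0 dkN bB.1 (measurable_knear s (d j)) (knear_ge0 s (d j)) (knearN s (d j)) bB.1
      (fun h => kfar_diff s h (d_dec j)) (fun h => lexx _)).
  apply: (@le_trans _ _ (beta%:E * (p * (kc * d j `^ (1 - s)))%:E)%E).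
    apply: lee_wpmul2l; first by rewrite lee_fin.
    exact: (nonlocal_knear_le n_gt0 s_gt0 s_lt1 bB.1 p0 (d0 j) hp).
  by rewrite -EFinM lee_fin.
have [phi [mphi phi01 hphi]] := L1_geometric_limit (fun j => (bf j).1) f01 ff.
have bphi : bmeas phi.
  by split => //; exists 1 => x; have /andP[h0 h1] := phi01 x; rewrite ger0_norm.
pose q j := \int[m]_x (\1_B x * (1 - f j x)).
pose Q := \int[m]_x (\1_B x * (1 - phi x)).
have iB := integrable_indic_fin mB Bfin.
have b1 u : bmeas u -> bmeas (fun x : V => 1 - u x) by apply: bmeasB; exact: bmeas_cst.
(* The energy term depends on the solution only through its L^1 distance to the limit on [B]. *)
have qQ j : `|q j - Q| <= 2 * 2^-1 ^+ j.
  have [] := @norm_Rintegral_le R n (fun x => \1_B x * (1 - f j x) - \1_B x * (1 - phi x)) (2 * 2^-1 ^+ j).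
  - apply: measurable_funB; apply: measurable_funM; try exact: bB.1.
      exact: (b1 _ (bf j)).1.
    exact: (b1 _ bphi).1.
  - apply: le_trans (hphi j); apply: ge0_le_integral => //.
    + apply/measurable_EFinP; apply: measurableT_comp => //.
      apply: measurable_funB; apply: measurable_funM; try exact: bB.1.
        exact: (b1 _ (bf j)).1.
      exact: (b1 _ bphi).1.
    + by apply/measurable_EFinP; have [] := bmeas_norm (bmeasB (bf j) bphi).
    + move=> x _; rewrite -mulrBr lee_fin indicE; case: (_ \in _); rewrite /= ?mul0r ?normr0// mul1r.
      by rewrite (_ : _ - _ = - (f j x - phi x)) ?normrN//; ring.
  by move=> _; rewrite RintegralB//; [exact: (integrable_bmeasM iB (b1 _ (bf j)))|exact: (integrable_bmeasM iB (b1 _ bphi))].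
have ov j : 2 * overlap (kfar (d j)) (far_mass (d j)) B <= J.
  by rewrite -lee_fin -nonlocal_kfarE.
exists phi; split => //.
- move=> u L bu iu L0 hL.
  have bl := bmeas_lap n_gt0 s_gt0 s_lt1 bu L0 hL.
  pose g x := u x + beta * lap s u x.
  pose g' j x := u x + beta * lap_far s (d j) u x.
  have bZ w : bmeas w -> bmeas (fun x : V => beta * w x).
    move=> [mw [M hM]]; split; first exact: measurable_funM.
    by exists (beta * M) => x; rewrite normrM (ger0_norm b0) ler_wpM2l.
  have bD w1 w2 : bmeas w1 -> bmeas w2 -> bmeas (fun x : V => w1 x + w2 x).
    move=> [m1 [M1 h1]] [m2 [M2 h2]]; split; first exact: measurable_funD.
    by exists (M1 + M2) => x; apply: le_trans (ler_normD _ _) _; exact: lerD.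
  have bg : bmeas g by apply: bD => //; exact: bZ.
  have bg' j : bmeas (g' j) by apply: bD => //; apply: bZ; exact: (bmeas_lap_far s_gt0 (d0 j) bu).
  have [mg [M hM]] := bg.
  have M0 : 0 <= M by apply: le_trans (hM 0).
  (* Two errors: replacing [phi] by [f j] costs the bound [M] of [g] times the L^1 distance, and
     replacing [lap] by its truncation costs the uniform bound [L * 2^-1 ^+ j] times the L^1 norm of
     [f j], at most the measure of [B]. *)
  suff h j : `|\int[m]_x (phi x * g x) - \int[m]_x (\1_B x * u x)| <= 0 + (M * 2 + L * fine (m B)) * 2^-1 ^+ j.
    by apply/eqP; rewrite -subr_eq0 -normr_le0; exact: (le_geometric h).
  have <- : \int[m]_x (f j x * g' j x) = \int[m]_x (\1_B x * u x).
    exact: (resolvent_weak (mk j) (k0 j) (kN j) (ki j) mB Bfin (rf j) bu iu).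
  have if_ : m.-integrable setT (EFin \o f j) by exact: (resolvent_integrable Bfin (rf j)).
  have E1 : (\int[m]_x `|(f j x - phi x) * g x|%:E <= (M * (2 * 2^-1 ^+ j))%:E)%E.
    by rewrite EFinM; apply: le_integral_bounded => //; exact: (bmeasB (bf j) bphi).1.
  have bgg : bmeas (fun x => g x - g' j x) by exact: bmeasB.
  have E2 : (\int[m]_x `|f j x * (g x - g' j x)|%:E <= (L * 2^-1 ^+ j * fine (m B))%:E)%E.
    rewrite EFinM fineK ?ge0_fin_numE//; apply: le_integral_bounded.
    + exact: (bf j).1.
    + exact: bgg.1.
    + by rewrite mulr_ge0// exprn_ge0.
    + move=> x; rewrite /g /g' opprD addrACA subrr add0r -mulrBr normrM (ger0_norm b0).
      apply: (@le_trans _ _ (beta * (L * (kc * d j `^ (1 - s))))).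
        rewrite ler_wpM2l//; exact: (lap_dist n_gt0 s_gt0 s_lt1 bu L0 hL x (d0 j)).
      by rewrite mulrCA ler_wpM2l.
    + apply: le_trans (resolvent_L1 (rf j)).
      rewrite le_eqVlt; apply/orP; left; apply/eqP; apply: eq_integral => x _.
      by have /andP[h0 _] := f01 j x; rewrite ger0_norm.
  have [I1 N1] := norm_Rintegral_le (measurable_funM (bmeasB (bf j) bphi).1 mg) E1.
  have [I2 N2] := norm_Rintegral_le (measurable_funM (bf j).1 bgg.1) E2.
  have I3 : m.-integrable setT (EFin \o (fun x => f j x * g' j x)) by exact: (integrable_bmeasM if_ (bg' j)).
  have I32 : m.-integrable setT (EFin \o (fun x => f j x * g' j x + f j x * (g x - g' j x))) by exact: (integrableD measurableT I3 I2).
  rewrite (eq_RintegralT (f := fun x => phi x * g x) (g := fun x => (f j x * g' j x + f j x * (g x - g' j x)) - (f j x - phi x) * g x)); last first.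
    by move=> x; ring.
  rewrite RintegralB// RintegralD//.
  rewrite (_ : _ - _ - _ = \int[m]_x (f j x * (g x - g' j x)) - \int[m]_x ((f j x - phi x) * g x)); last by ring.
  apply: le_trans (ler_normB _ _) _.
  by rewrite add0r mulrDl addrC; apply: lerD; [apply: le_trans N1 _; rewrite mulrA|apply: le_trans N2 _; rewrite mulrAC].
- apply: (@le_geometric _ _ _ 2) => j.
  have := qQ j; rewrite ler_norml -/Q => /andP[h1 _].
  have h2 : q j <= beta * overlap (kfar (d j)) (far_mass (d j)) B.
    exact: (resolvent_energy_le (mk j) (k0 j) (kN j) (ki j) b0 mB Bfin (rf j)).
  have h3 : beta * overlap (kfar (d j)) (far_mass (d j)) B <= beta * (J / 2).
    by rewrite ler_wpM2l// ler_pdivlMr// mulrC.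
  lra.
(* The constant 3 is 2 from the distance between [q j] and [Q], plus 1 from replacing [J / 2] by the
   truncated overlap. The radius [r] stays fixed while [j] grows. *)
- move=> r r0; apply: (@le_geometric _ _ _ 3) => j.
  have := qQ j; rewrite ler_norml -/Q => /andP[_ h1].
  have v1 : (\int[m]_x `|\1_B x - f j x|%:E <= (beta * J)%:E)%E.
    apply: le_trans (resolvent_dist (mk j) (k0 j) (kN j) (ki j) b0 mB Bfin (rf j)) _.
    by rewrite EFinM; apply: lee_wpmul2l => //; rewrite lee_fin.
  have Nr := nonlocal_knear_le n_gt0 s_gt0 s_lt1 bB.1 p0 r0 hp.
  have h2 := resolvent_energy_ge (mk j) (k0 j) (kN j) (ki j) b0 mB Bfin (rf j)
    (measurable_kfar s r) (kfar_ge0 s r) (far_massE s_gt0 r0) (measurable_knear s r) (knear_ge0 s r)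
    (fun h => le_trans (kfar_le_kern s (d j) h) (eq_ind _ (fun z => kern s h <= z) (lexx _) _ (kern_split s r h))) v1 Nr.
  rewrite -/(q j) in h2.
  have h3 : beta * (J / 2) <= beta * overlap (kfar (d j)) (far_mass (d j)) B + 2^-1 ^+ j.
    have : J <= 2 * overlap (kfar (d j)) (far_mass (d j)) B + p * (kc * d j `^ (1 - s)).
      rewrite -lee_fin -JE (nonlocal_split (d0 j)) nonlocal_kfarE// EFinD leeD2l//.
      exact: (nonlocal_knear_le n_gt0 s_gt0 s_lt1 bB.1 p0 (d0 j) hp).
    move=> /(ler_wpM2l b0); have := hdp j.
    have : 0 <= beta * (p * (kc * d j `^ (1 - s))) by do ?[apply: mulr_ge0 => //]; exact: powR_ge0.
    by rewrite mulrDr mulrCA; lra.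
  lra.
Qed.

End existence.

(** * Uniqueness of the potential *)

Section test_integrability.
Context {R : realType} {n : nat}.
Local Notation V := 'rV[R]_n.
Local Notation m := (borel_lebesgue R n).

Lemma bmeas_test (f : V -> R) : test_function f -> bmeas f.
Proof.
by move=> tf; have [K _ hK] := test_bounded tf; split; [exact: test_measurable|exists K].
Qed.

Lemma test_integrable (f : V -> R) : test_function f -> m.-integrable setT (EFin \o f).
Proof.
move=> tf; have bf := bmeas_test tf.
have [r r0 hr] := (compactly_supportedP f).1 tf.2.
have mb : measurable (box r : set V) by exact: measurable_box.
have ib : m.-integrable setT (EFin \o (\1_(box r) : V -> R)).
  by apply: integrable_indic_fin => //; rewrite borel_lebesgue_box// ltry.
apply: eq_integrable (integrable_bmeasM ib bf) => // x _ /=.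
rewrite indicE; case: (boolP (x \in _)) => [|/negP xb]; rewrite ?mul1r// mul0r hr//.
by move=> bx; apply: xb; exact: mem_set.
Qed.

End test_integrability.

Section pairing.
Context {R : realType} {n : nat}.
Local Notation V := 'rV[R]_n.
Local Notation m := (borel_lebesgue R n).
(* [mu] will be the completed measure and [g] the identity. *)
Context d (T : measurableType d) (mu : {sigma_finite_measure set T -> \bar R}).
Variables (g : T -> V) (w : T -> R) (M : R).
Hypotheses (mg : measurable_fun setT g)
  (gmu : forall f : V -> \bar R, measurable_fun setT f -> (forall x, 0 <= f x)%E ->
    (\int[mu]_t f (g t) = \int[m]_x f x)%E)
  (mw : measurable_fun setT w) (M0 : 0 <= M) (wM : forall t, `|w t| <= M).

Definition pairing (f : V -> R) : R := \int[mu]_t (w t * f (g t)).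

Let mwf (f : V -> R) : measurable_fun setT f -> measurable_fun setT (fun t => w t * f (g t)).
Proof. by move=> mf; apply: measurable_funM => //; exact: measurableT_comp. Qed.

Lemma pairing_integral_le (f : V -> R) (c : \bar R) : measurable_fun setT f ->
  (\int[m]_x `|f x|%:E <= c)%E ->
  (\int[mu]_t `|w t * f (g t)|%:E <= M%:E * c)%E.
Proof.
move=> mf fc.
have mn : measurable_fun [set: V] (fun x => `|f x|%:E).
  by apply/measurable_EFinP; exact: measurableT_comp.
have mn' : measurable_fun [set: V] (fun x => (M%:E * `|f x|%:E)%E) by exact: measurable_funeM.
apply: (@le_trans _ _ (\int[mu]_t (M%:E * `|f (g t)|%:E))%E).
  apply: ge0_le_integral => //.
  - by apply/measurable_EFinP; apply: measurableT_comp => //; exact: mwf.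
  - exact: (measurableT_comp mn').
  - by move=> x _; rewrite -EFinM lee_fin normrM ler_wpM2r.
rewrite (gmu mn') ?ge0_integralZl_EFin//; last by move=> x; rewrite mule_ge0.
by rewrite lee_wpmul2l ?lee_fin.
Qed.

Lemma integrable_pairing (f : V -> R) : m.-integrable setT (EFin \o f) ->
  mu.-integrable setT (fun t => (w t * f (g t))%:E).
Proof.
move=> fi; have mf : measurable_fun setT f by apply/measurable_EFinP; exact: measurable_int fi.
have /integrableP[_ fin] := fi.
apply/integrableP; split; first by apply/measurable_EFinP; exact: mwf.
apply: (@le_lt_trans _ _ (M%:E * \int[m]_x `|f x|%:E)%E); first exact: pairing_integral_le.
have f0 : (0 <= \int[m]_x `|f x|%:E)%E by apply: integral_ge0 => x _; rewrite lee_fin.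
by rewrite -[X in (_ * X)%E]fineK ?ge0_fin_numE// -EFinM ltry.
Qed.

Lemma pairing_le (f : V -> R) (c : R) : measurable_fun setT f ->
  (\int[m]_x `|f x|%:E <= c%:E)%E -> `|pairing f| <= M * c.
Proof.
move=> mf fc; have [fi _] := norm_Rintegral_le mf fc.
have iw := integrable_pairing fi.
apply: (@le_trans _ _ (\int[mu]_t `|w t * f (g t)|)).
  exact: le_normr_Rintegral.
rewrite -lee_fin /Rintegral fineK; first by rewrite EFinM; exact: pairing_integral_le.
exact: (integrable_fin_num measurableT (integrable_norm iw)).
Qed.

Lemma pairingD (f f2 : V -> R) : m.-integrable setT (EFin \o f) -> m.-integrable setT (EFin \o f2) ->
  pairing (fun x => f x + f2 x) = pairing f + pairing f2.
Proof.
move=> fi gi; rewrite /pairing -(RintegralD _ (integrable_pairing fi) (integrable_pairing gi))//.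
by apply: eq_Rintegral => x _; rewrite mulrDr.
Qed.

Lemma pairingZ (f : V -> R) (c : R) : m.-integrable setT (EFin \o f) ->
  pairing (fun x => c * f x) = c * pairing f.
Proof.
move=> fi; rewrite /pairing -(RintegralZl c measurableT (integrable_pairing fi)).
by apply: eq_Rintegral => x _; rewrite mulrCA.
Qed.

(** Fubini on the product of [V] and [T], after a reflection in the inner convolution. Writing W(x)
    for the pairing with f(. + x), the kernel acting on the test function becomes the same kernel
    acting on W, so that the weak equation can be read pointwise as an equation for W. *)
Lemma pairing_conv (kap f : V -> R) (k : R) (x : V) : measurable_fun setT kap -> (forall h, 0 <= kap h) ->
  (\int[m]_h (kap h)%:E = k%:E)%E -> bmeas f -> m.-integrable setT (EFin \o f) ->
  m.-integrable setT (fun h : V => (kap h * pairing (fun y => f (y + (x - h))))%:E) /\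
  pairing (kconv kap (fun y => f (y + x))) = \int[m]_h (kap h * pairing (fun y => f (y + (x - h)))).
Proof.
move=> mk k0 ki bf fi; have /integrableP[_ fin] := fi; have mf := bf.1.
pose a := fine (\int[m]_x `|f x|%:E)%E.
have fa : (\int[m]_x `|f x|%:E = a%:E)%E.
  by rewrite /a fineK// ge0_fin_numE//; apply: integral_ge0 => y _; rewrite lee_fin.
have shiftE h : (\int[m]_y `|f (y + h)|%:E = a%:E)%E.
  rewrite -fa (integral_shift h (f := fun y : V => `|f y|%:E))//.
  by apply/measurable_EFinP; exact: measurableT_comp.
have shift_i h : m.-integrable setT (EFin \o (fun y => f (y + h))).
  have [] // := norm_Rintegral_le (measurable_shift h mf) (c := a).
  by rewrite shiftE.
pose F (z : V * T) : \bar R := (kap z.1 * (w z.2 * f (g z.2 + (x - z.1))))%:E.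
have mF : measurable_fun setT F.
  apply/measurable_EFinP; apply: measurable_funM; first exact: (measurableT_comp mk measurable_fst).
  apply: measurable_funM; first exact: (measurableT_comp mw measurable_snd).
  apply: (measurableT_comp mf); apply: measurable_rowD.
    exact: (measurableT_comp mg measurable_snd).
  by apply: measurable_rowB; [exact: measurable_cst|exact: measurable_fst].
have iF : (m \x mu)%E.-integrable setT F.
  apply: (integrable12ltyP _ _ _).2 => //.
  apply: (@le_lt_trans _ _ (\int[m]_h ((kap h)%:E * (M * a)%:E))%E).
    apply: ge0_le_integral => //.
    - by move=> h _; apply: integral_ge0.
    - apply: (measurable_fun_fubini_tonelli_F (fun z => `|F z|%E)) => //.
      exact: measurableT_comp.
    - by apply: emeasurable_funM => //; exact/measurable_EFinP.
    move=> h _; rewrite (eq_integral (fun t : T => ((kap h)%:E * `|w t * f (g t + (x - h))|%:E)%E)); last first.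
      by move=> y _; rewrite /F /= normrM (ger0_norm (k0 h)) EFinM.
    rewrite ge0_integralZl_EFin//; last first.
      apply/measurable_EFinP; apply: measurableT_comp => //.
      exact: (mwf (measurable_shift (x - h) mf)).
    apply: lee_wpmul2l; first by rewrite lee_fin.
    rewrite EFinM; apply: (pairing_integral_le (measurable_shift (x - h) mf)).
    by rewrite shiftE.
  rewrite ge0_integralZr//.
  - by rewrite ki -EFinM ltry.
  - exact/measurable_EFinP.
  - by move=> h _; rewrite lee_fin.
  - rewrite lee_fin mulr_ge0//; apply: fine_ge0; apply: integral_ge0 => y _; by rewrite lee_fin.
have FE h : (kap h * pairing (fun y => f (y + (x - h))))%:E = (\int[mu]_y F (h, y))%E.
  rewrite /F /pairing -(RintegralZl (kap h) measurableT (integrable_pairing (shift_i (x - h)))).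
  rewrite /Rintegral fineK//.
  apply: (integrable_fin_num measurableT).
  exact: (integrableZl measurableT (kap h) (integrable_pairing (shift_i (x - h)))).
have iG : m.-integrable setT (fun h : V => (kap h * pairing (fun y => f (y + (x - h))))%:E).
  by apply: eq_integrable (integrable_fubini_F iF) => // h _; rewrite /= FE.
split => //; rewrite {1}/pairing /Rintegral; congr fine.
rewrite [RHS](eq_integral (fun h => \int[mu]_y F (h, y))%E); last by move=> h _; exact: FE.
rewrite (Fubini iF); apply: eq_integral => t _.
rewrite /F /kconv /=.
set b := g t.
have ikap : m.-integrable setT (EFin \o kap) := ge0_integrable_EFin mk k0 ki (ltry k).
have bb : bmeas (fun h => f (b + (x - h))).
  have [_ [L hL]] := bf; split; last by exists L => h; exact: hL.
  rewrite (_ : (fun h => _) = (fun h => f ((b + x) - h))); first exact: measurable_refl.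
  by apply/funext => h; rewrite addrA.
have i1 : m.-integrable setT (EFin \o (fun h => kap h * f (b + (x - h)))) by exact: (integrable_bmeasM ikap bb).
have -> : \int[m]_z (kap (b - z) * f (z + x)) = \int[m]_h (kap h * f (b + (x - h))).
  rewrite /Rintegral -(integral_reflect b (measurable_int m i1)).
  by congr fine; apply: eq_integral => z _ /=; rewrite opprB addrA addrAC addrCA subrr addr0 addrC.
rewrite -(RintegralZl (w t) measurableT i1) /Rintegral fineK.
  by apply: eq_integral => h _; rewrite mulrCA.
exact: (integrable_fin_num measurableT (integrableZl measurableT (w t) i1)).
Qed.

Lemma pairingB (f f2 : V -> R) : m.-integrable setT (EFin \o f) -> m.-integrable setT (EFin \o f2) ->
  pairing (fun x => f x - f2 x) = pairing f - pairing f2.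
Proof.
move=> fi fi2; rewrite /pairing -(RintegralB _ (integrable_pairing fi) (integrable_pairing fi2))//.
by apply: eq_Rintegral => x _; rewrite mulrBr.
Qed.

Lemma integrable_kconv (kap f : V -> R) (k : R) : measurable_fun setT kap -> (forall h, 0 <= kap h) ->
  (forall h, kap (- h) = kap h) -> (\int[m]_h (kap h)%:E = k%:E)%E -> bmeas f ->
  m.-integrable setT (EFin \o f) -> m.-integrable setT (EFin \o kconv kap f).
Proof.
move=> mk k0 kN ki bf /integrableP[_ fin].
have bn := bmeas_norm bf.
apply/integrableP; split; first by apply/measurable_EFinP; exact: (bmeas_conv mk k0 ki bf).1.
apply: (@le_lt_trans _ _ (\int[m]_x (kconv kap (fun y => `|f y|) x)%:E)%E).
  apply: ge0_le_integral => //.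
  - by apply/measurable_EFinP; apply: measurableT_comp => //; exact: (bmeas_conv mk k0 ki bf).1.
  - by apply/measurable_EFinP; exact: (bmeas_conv mk k0 ki bn).1.
  - by move=> x _; rewrite lee_fin; exact: (norm_conv mk k0 ki x bf).
rewrite (integral_conv mk k0 kN ki bn)//.
have f0 : (0 <= \int[m]_x `|f x|%:E)%E by apply: integral_ge0 => x _; rewrite lee_fin.
by rewrite -[X in (_ * X)%E]fineK ?ge0_fin_numE// -EFinM ltry.
Qed.

Variables (s beta : R).
Hypotheses (n_gt0 : (0 < n)%N) (s_gt0 : 0 < s) (s_lt1 : s < 1) (b0 : 0 <= beta).
Hypothesis weq : forall psi : V -> R, test_function psi ->
  pairing (fun y => psi y + beta * lap s psi y) = 0.

(* At a near-maximum [x] of the convolution [W] of [w] with [rho] the far part of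
   the operator is almost nonnegative, and the near part is small uniformly in [x]. *)
Lemma pairing_le0 (rho : V -> R) : test_function rho -> pairing rho <= 0.
Proof.
move=> tr; have irho := test_integrable tr; have mr := (bmeas_test tr).1.
pose W x := pairing (fun y => rho (y + x)).
have W0 : pairing rho = W 0 by congr pairing; apply/funext => y; rewrite addr0.
have /integrableP[_ fin] := irho.
pose a := fine (\int[m]_x `|rho x|%:E)%E.
have fa : (\int[m]_x `|rho x|%:E = a%:E)%E.
  by rewrite /a fineK// ge0_fin_numE//; apply: integral_ge0 => y _; rewrite lee_fin.
have Wle x : `|W x| <= M * a.
  apply: pairing_le; first exact: measurable_shift.
  rewrite -fa (integral_shift x (f := fun y : V => `|rho y|%:E))//.
  by apply/measurable_EFinP; exact: measurableT_comp.
pose S := sup (range W).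
have hS : has_sup (range W).
  split; first by exists (W 0); exists 0.
  by exists (M * a) => _ [x _ <-]; apply: le_trans (Wle x); exact: ler_norm.
have WS x : W x <= S by apply: sup_upper_bound => //; exists x.
rewrite W0; apply: le_trans (WS 0) _.
apply/ler_addgt0Pr => e e0; rewrite add0r.
have [C C0 hC] := test_L1_lipschitz tr.
have kc0 := knear_cst_ge0 n_gt0 s_gt0 s_lt1.
have D0 : 0 <= beta * (M * (C * knear_cst (n := n) s)) by do !apply: mulr_ge0 => //.
have e2 : 0 < e / 2 by rewrite divr_gt0.
(* The near part contributes at most beta M C kc r^(1-s) to the equation, with a constant
   independent of the point; so [r] can be chosen before the near-maximum. *)
have [r r0 hr] := powR_small s_lt1 D0 e2.
pose k := far_mass (n := n) s r.
have k_ge0 : 0 <= k by exact: far_mass_ge0.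
have bk : 0 < 1 + beta * k by rewrite ltr_pwDl// mulr_ge0.
(* The precision is divided by [1 + beta * k] because the defect [S - W x] is multiplied by that
   number at the end; [k] depends on [r], hence this order of choices. *)
have [_ [x _ <-] hx] := sup_adherent (divr_gt0 e2 bk) hS.
rewrite -/S in hx.
have tpsi := test_shift x tr.
have bpsi := bmeas_test tpsi; have ipsi := test_integrable tpsi.
have [L L0 hL] := test_lipschitz tpsi.
set psi := fun y => rho (y + x) in tpsi bpsi ipsi hL.
have hdist h : (dist1 psi h <= (C * enorm h)%:E)%E.
  apply: le_trans (hC h); rewrite /dist1 /psi.
  have mh : measurable_fun [set: V] (fun y => `|rho (y + h) - rho y|%:E).
    by apply/measurable_EFinP; apply: measurableT_comp => //; apply: measurable_funB => //; exact: measurable_shift.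
  rewrite -(integral_shift x mh) le_eqVlt; apply/orP; left; apply/eqP.
  by apply: eq_integral => y _; rewrite addrAC.
have mk := measurable_kfar (n := n) s r; have k0 := kfar_ge0 (n := n) s r.
have kN := kfarN (n := n) s r; have ki := far_massE (n := n) s_gt0 r0.
have bl := bmeas_lap n_gt0 s_gt0 s_lt1 bpsi L0 hL.
have blf := bmeas_lap_far s_gt0 r0 bpsi.
have ikp := integrableZl measurableT k ipsi.
have ikc := integrable_kconv mk k0 kN ki bpsi ipsi.
have ifar : m.-integrable setT (EFin \o lap_far s r psi) by exact: (integrableB measurableT ikp ikc).
have dL1 := lap_dist_L1 n_gt0 s_gt0 s_lt1 bpsi L0 hL C0 r0 hdist.
have bd := bmeasB bl blf.
have [idiff _] := norm_Rintegral_le bd.1 dL1.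
have Pd := pairing_le bd.1 dL1.
have Plap : pairing (lap s psi) = pairing (lap_far s r psi) + pairing (fun y => lap s psi y - lap_far s r psi y).
  by rewrite -pairingD//; congr pairing; apply/funext => y; rewrite addrC subrK.
have ilap : m.-integrable setT (EFin \o lap s psi).
  apply: eq_integrable (integrableD measurableT ifar idiff) => // y _.
  by rewrite /= -EFinD addrC subrK.
have [iconv Pconv] := pairing_conv x mk k0 ki (bmeas_test tr) irho.
have Pfar : pairing (lap_far s r psi) = k * W x - pairing (kconv (kfar s r) psi).
  by rewrite /W -pairingZ// -pairingB.
have PS : pairing (kconv (kfar s r) psi) <= k * S.
  rewrite Pconv.
  have ikap : m.-integrable setT (EFin \o kfar s r) := ge0_integrable_EFin mk k0 ki (ltry k).
  have -> : k * S = \int[m]_h (S * kfar s r h).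
    by rewrite (RintegralZl S measurableT ikap) mulrC.
  apply: le_Rintegral => //; first exact: (integrableZl measurableT S ikap).
  by move=> h _; rewrite mulrC ler_wpM2r//; exact: WS.
have := weq tpsi; rewrite pairingD//; last exact: (integrableZl measurableT beta ilap).
rewrite pairingZ// -/(W x) Plap Pfar.
move: Pd; set P2 := pairing (fun y => _); set P1 := pairing _ => Pd E.
have h1 : - P2 <= M * (C * (knear_cst (n := n) s * r `^ (1 - s))).
  by apply: le_trans Pd; rewrite -normrN; exact: ler_norm.
have h2 : beta * - P2 <= e / 2.
  by apply: le_trans hr; rewrite -!mulrA; apply: ler_wpM2l => //; rewrite -!mulrA in h1 *.
(* The kernel average of [W] is at most [k * S], so the equation bounds [W x] by [beta * k] times
   the defect plus the near error. Adding the defect to both sides gives S < e. *)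
have h3 : W x <= beta * k * (S - W x) + e / 2.
  have := ler_wpM2l b0 PS; rewrite -/P1; move: E h2; clear -mg gmu mw M0 wM n_gt0 s_gt0 s_lt1 b0 weq; lra.
have h4 : S - W x < e / 2 / (1 + beta * k) by rewrite ltrBlDr -ltrBlDl.
have : (S - W x) * (1 + beta * k) < e / 2 by rewrite -ltr_pdivlMr.
move: h3; clear -mg gmu mw M0 wM n_gt0 s_gt0 s_lt1 b0 weq; lra.
Qed.

End pairing.

(** * From Lebesgue to Borel sets *)

Section null_modification.
Context {R : realType} {n : nat}.
Local Notation V := 'rV[R]_n.
Local Notation m := (borel_lebesgue R n).
Context d (T : measurableType d) (mu : {sigma_finite_measure set T -> \bar R}).
Variable g : T -> V.
Hypotheses (mg : measurable_fun setT g)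
  (gmu : forall f : V -> \bar R, measurable_fun setT f -> (forall x, 0 <= f x)%E ->
    (\int[mu]_t f (g t) = \int[m]_x f x)%E).

(** The Lebesgue set lives in [T] and the Borel set in [V]; comparing them through [g] keeps the two
    sigma-algebras on the same carrier apart. *)
Definition null_modification (E : set T) (B : set V) :=
  [/\ measurable E, measurable B & mu ((E `\` g @^-1` B) `|` (g @^-1` B `\` E)) = 0%E].

Section one_set.
Variables (E : set T) (B : set V).
Hypothesis EB : null_modification E B.

Let mE : measurable E. Proof. by case: EB. Qed.
Let mB : measurable B. Proof. by case: EB. Qed.
Let mgB : measurable (g @^-1` B). Proof. by rewrite -[X in measurable X]setTI; exact: mg. Qed.

Let ae_eq_of (F G : T -> \bar R) : (forall t, E t <-> B (g t) -> F t = G t) -> ae_eq mu setT F G.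
Proof.
move=> FG; exists ((E `\` g @^-1` B) `|` (g @^-1` B `\` E)); split.
- by apply: measurableU; exact: measurableD.
- by case: EB.
move=> t /= h; apply: contrapT => h'; apply: h => _; apply: FG; split => [Et|Bt].
  by apply: contrapT => nB; apply: h'; left.
by apply: contrapT => nE; apply: h'; right.
Qed.

Let indicEB t : E t <-> B (g t) -> \1_E t = \1_B (g t) :> R.
Proof.
move=> h; rewrite !indicE; congr (_%:R); congr nat_of_bool.
by apply/idP/idP; rewrite !inE => /h.
Qed.

Let mE1 : measurable_fun setT (\1_E : T -> R). Proof. exact: measurable_indic. Qed.
Let mB1 : measurable_fun setT (fun t => \1_B (g t) : R).
Proof. by apply: (measurableT_comp (f := \1_B : V -> R)) => //; exact: measurable_indic. Qed.

Lemma Rintegral_modification (F : T -> R) : measurable_fun setT F ->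
  \int[mu]_t (\1_E t * F t) = \int[mu]_t (\1_B (g t) * F t).
Proof.
move=> mF; congr fine; apply: ae_eq_integral => //.
- by apply/measurable_EFinP; exact: measurable_funM.
- by apply/measurable_EFinP; exact: measurable_funM.
by apply: ae_eq_of => t /indicEB ->.
Qed.

Lemma measure_modification : mu E = m B.
Proof.
rewrite -[E]setIT -[B]setIT -!integral_indic//.
rewrite -(gmu (f := fun x => (\1_B x : R)%:E)); last 2 first.
- by apply/measurable_EFinP; exact: measurable_indic.
- by move=> x; rewrite lee_fin.
apply: ae_eq_integral => //; try exact/measurable_EFinP.
by apply: ae_eq_of => t /indicEB ->.
Qed.

(** The exchange is made once in the inner integral, for each fixed t, and once in the outer one.
    The inner integral sees t only through the number chi_E(t) and the point g(t). *)
Lemma nonlocal_modification (kap : V -> R) : measurable_fun setT kap -> (forall h, 0 <= kap h) ->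
  (\int[mu]_t \int[mu]_u (`|\1_E t - \1_E u| * kap (g t - g u))%:E = nonlocal kap \1_B)%E.
Proof.
move=> mk k0.
(* Freezing the indicator value as a number [a] makes [H a] Borel; measurability along the Lebesgue
   set then follows by separating the cases [a = 0] and [a = 1]. *)
pose H (a : R) (x : V) : \bar R := (\int[m]_y (`|a - \1_B y| * kap (x - y))%:E)%E.
have bB : bmeas (\1_B : V -> R) := bmeas_indic mB.
have mi a x : measurable_fun [set: V] (fun y => (`|a - \1_B y| * kap (x - y))%:E).
  apply/measurable_EFinP; apply: measurable_funM; last exact: measurable_refl.
  by apply: measurableT_comp => //; apply: measurable_funB => //; exact: bB.1.
have H0 a x : (0 <= H a x)%E by apply: integral_ge0 => y _; rewrite lee_fin mulr_ge0.
have mH a : measurable_fun [set: V] (H a).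
  apply: (measurable_fun_fubini_tonelli_F (fun z : V * V => (`|a - \1_B z.2| * kap (z.1 - z.2))%:E)).
    apply/measurable_EFinP; apply: measurable_funM; last exact: measurable_compB.
    by apply: measurableT_comp => //; apply: measurable_funB => //; apply: measurable_comp2; exact: bB.1.
  by move=> z; rewrite lee_fin mulr_ge0.
have inner t : (\int[mu]_u (`|\1_E t - \1_E u| * kap (g t - g u))%:E = H (\1_E t) (g t))%E.
  rewrite /H -(gmu (mi (\1_E t) (g t))); last by move=> y; rewrite lee_fin mulr_ge0.
  have mgt : measurable_fun setT (fun u => kap (g t - g u)).
    exact: (measurableT_comp (measurable_refl (g t) mk) mg).
  apply: ae_eq_integral => //.
  - apply/measurable_EFinP; apply: measurable_funM => //.
    by apply: measurableT_comp => //; exact: measurable_funB.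
  - apply/measurable_EFinP; apply: measurable_funM => //.
    by apply: measurableT_comp => //; exact: measurable_funB.
  by apply: ae_eq_of => u /indicEB ->.
have HE (A : T -> R) t : A t = 0 \/ A t = 1 -> H (A t) (g t) = if A t == 1 then H 1 (g t) else H 0 (g t).
  by move=> [->|->]; rewrite ?eqxx// eq_sym oner_eq0.
have A01 (A : set T) t : \1_A t = 0 :> R \/ \1_A t = 1 :> R.
  by rewrite indicE; case: (_ \in _); [right|left].
have mHA (A : T -> R) : measurable_fun setT A -> (forall t, A t = 0 \/ A t = 1) ->
    measurable_fun setT (fun t => H (A t) (g t)).
  move=> mA A1; rewrite (_ : (fun t => _) = fun t => if A t == 1 then H 1 (g t) else H 0 (g t)); last first.
    by apply/funext => t; exact: HE.
  apply: measurable_fun_ifT.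
  - by apply: measurable_fun_eqr.
  - exact: (measurableT_comp (mH 1)).
  - exact: (measurableT_comp (mH 0)).
rewrite (eq_integral (fun t => H (\1_E t) (g t))); last by move=> t _; exact: inner.
have mHB : measurable_fun [set: V] (fun x => H (\1_B x) x).
  exact: (measurable_deviation mk k0 bB.1).
rewrite /nonlocal -(gmu mHB); last by move=> x; exact: H0.
apply: ae_eq_integral => //.
- by apply: mHA => // t; exact: A01.
- by apply: mHA => // t; exact: (A01 (g @^-1` B)).
by apply: ae_eq_of => t /indicEB ->.
Qed.

End one_set.

Lemma dist_modification (E E' : set T) (B B' : set V) : null_modification E B -> null_modification E' B' ->
  (\int[mu]_t `|\1_E t - \1_E' t|%:E = \int[m]_x `|\1_B x - \1_B' x|%:E)%E.
Proof.
move=> EB EB'.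
have [mE mB nE] := EB; have [mE' mB' nE'] := EB'.
have mgB (A : set V) : measurable A -> measurable (g @^-1` A).
  by move=> mA; rewrite -[X in measurable X]setTI; exact: mg.
rewrite -(gmu (f := fun x => `|\1_B x - \1_B' x|%:E)); last 2 first.
- by apply/measurable_EFinP; apply: measurableT_comp => //; apply: measurable_funB; exact: measurable_indic.
- by move=> x; rewrite lee_fin.
apply: ae_eq_integral => //.
- by apply/measurable_EFinP; apply: measurableT_comp => //; apply: measurable_funB; exact: measurable_indic.
- apply/measurable_EFinP; apply: measurableT_comp => //; apply: measurable_funB.
    by apply: (measurableT_comp (f := \1_B : V -> R)) => //; exact: measurable_indic.
  by apply: (measurableT_comp (f := \1_B' : V -> R)) => //; exact: measurable_indic.
pose D (A : set T) (C : set V) := (A `\` g @^-1` C) `|` (g @^-1` C `\` A).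
have mD (A : set T) (C : set V) : measurable A -> measurable C -> measurable (D A C).
  by move=> mA mC; apply: measurableU; apply: measurableD => //; exact: mgB.
have hD (A : set T) (C : set V) t : ~ D A C t -> \1_A t = \1_C (g t) :> R.
  move=> h; rewrite !indicE; congr (_%:R); congr nat_of_bool.
  by apply/idP/idP; rewrite !inE => ht; apply: contrapT => ht'; apply: h; [left|right].
exists (D E B `|` D E' B'); split.
- by apply: measurableU; exact: mD.
- by rewrite measureU0 //; exact: mD.
move=> t /= h; apply: contrapT => /not_orP[h1 h2]; apply: h => _.
by rewrite (hD _ _ _ h1) (hD _ _ _ h2).
Qed.

End null_modification.

Section lebesgue_sets.
Context {R : realType} {n : nat}.
Local Notation V := 'rV[R]_n.
Local Notation m := (borel_lebesgue R n).

(** The instance of [g]: the identity, read as a map from the Lebesgue to the Borel structure. *)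
Definition of_lebRn (x : lebRn R n) : V := x.

Lemma measurable_of_lebRn : measurable_fun setT of_lebRn.
Proof. exact: measurable_id_lebRn. Qed.

Lemma integral_of_lebRn (f : V -> \bar R) : measurable_fun setT f -> (forall x, 0 <= f x)%E ->
  (\int[leb]_t f (of_lebRn t) = \int[m]_x f x)%E.
Proof. by move=> mf f0; exact: (ge0_integral_leb measurableT). Qed.

Definition borel_representative (E B : set V) := null_modification (@leb R n) of_lebRn E B.

Lemma L1_set_measurable (E : set V) : L1_set E -> measurable (E : set (lebRn R n)) /\ (leb E < +oo)%E.
Proof.
move=> /integrableP[/measurable_EFinP mE fE].
have mEE : measurable (E : set (lebRn R n)).
  rewrite (_ : (E : set (lebRn R n)) = setT `&` (\1_E : lebRn R n -> R) @^-1` [set 1]).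
    exact: (mE measurableT).
  rewrite setTI; apply/seteqP; split => x /=; rewrite indicE; first by move=> /mem_set ->.
  by case: (boolP (x \in E)) => [/set_mem//|_ /eqP]; rewrite /= eq_sym oner_eq0.
split => //.
rewrite -[X in leb X]setIT -integral_indic//; apply: le_lt_trans fE.
rewrite le_eqVlt; apply/orP; left; apply/eqP; apply: eq_integral => x _ /=.
by rewrite ger0_norm.
Qed.

Lemma borel_representative_exists (E : set V) : L1_set E ->
  exists B : set V, borel_representative E B /\ (m B < +oo)%E.
Proof.
move=> /L1_set_measurable[mE Efin].
have [B mB EB] := borel_version mE Efin.
have r : borel_representative E B by split.
exists B; split => //.
by rewrite -(measure_modification measurable_of_lebRn integral_of_lebRn r).
Qed.

Section representative.
Variables (E B : set V).
Hypothesis EB : borel_representative E B.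

Lemma Rintegral_representative (F : V -> R) : measurable_fun [set: lebRn R n] (F : lebRn R n -> R) ->
  \int[leb]_(x in [set: lebRn R n]) (\1_E x * F x) = \int[leb]_(x in [set: lebRn R n]) (\1_B x * F x).
Proof. by move=> mF; exact: (Rintegral_modification measurable_of_lebRn EB mF). Qed.

Lemma perimeter_representative : perimeter E = perimeter B.
Proof.
rewrite /perimeter; congr ereal_sup; apply: eq_imagel => X tX.
have [mX _] := test_field_divergence tX.
congr (_%:E); transitivity (\int[leb]_(x in [set: lebRn R n]) (\1_E x * divergence X x)).
  exact: Rintegral_indic.
rewrite (Rintegral_representative (measurable_fun_lebRn mX)); symmetry; exact: Rintegral_indic.
Qed.

Lemma frac_perimeter_representative (s : R) :
  frac_perimeter s E = (2^-1%:E * nonlocal (kern s) \1_B)%E.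
Proof.
rewrite /frac_perimeter; congr (_ * _)%E.
exact: (nonlocal_modification measurable_of_lebRn integral_of_lebRn EB (measurable_kern s) (kern_ge0 s)).
Qed.

Lemma bounded_solution_representative (s eps : R) (phi : V -> R) :
  bounded_solution s eps E phi <-> bounded_solution s eps B phi.
Proof.
split => -[mphi bphi h]; split => // psi tpsi.
  by rewrite (h _ tpsi) (Rintegral_representative (measurable_fun_lebRn (test_measurable tpsi))).
by rewrite (h _ tpsi) (Rintegral_representative (measurable_fun_lebRn (test_measurable tpsi))).
Qed.

End representative.

Lemma dist_representative (E E' B B' : set V) : borel_representative E B -> borel_representative E' B' ->
  (\int[leb]_(x in [set: lebRn R n]) `|\1_E x - \1_E' x|%:E = \int[m]_x `|\1_B x - \1_B' x|%:E)%E.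
Proof. exact: (dist_modification measurable_of_lebRn integral_of_lebRn). Qed.

End lebesgue_sets.

(** * Sign of the constant and uniqueness of bounded solutions *)

Section solutions.
Context {R : realType} {n : nat}.
Local Notation V := 'rV[R]_n.
Local Notation m := (borel_lebesgue R n).
Variable s : R.
Hypotheses (n_gt0 : (0 < n)%N) (s_gt0 : 0 < s) (s_lt1 : s < 1).
Local Notation c := (frac_const (n := n) s).

Lemma euler_integral_ge0 (x : R) : 0 <= euler_integral x.
Proof.
by apply: fine_ge0; apply: integral_ge0 => u _; rewrite lee_fin mulr_ge0 ?powR_ge0// expR_ge0.
Qed.

(** In the numerator [Gamma] is evaluated at a positive number, where it is Euler's integral of a
    nonnegative function; the denominator is a power of pi times an absolute value. *)
Lemma frac_const_ge0 : 0 <= c.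
Proof.
apply: divr_ge0; apply: mulr_ge0; rewrite ?powR_ge0//.
rewrite /Gamma divr_gt0 ?ltr_wpDl//; exact: euler_integral_ge0.
Qed.

Lemma frac_laplacian_test (psi : V -> R) (x : V) : test_function psi ->
  frac_laplacian s psi x = c * lap s psi x.
Proof.
move=> tpsi; have [L L0 hL] := test_lipschitz tpsi.
exact: (frac_laplacianE n_gt0 s_gt0 s_lt1 (bmeas_test tpsi) L0 hL).
Qed.

(** The truncated operator maps test functions to integrable functions, and the remainder is bounded
    in L^1 through the translation modulus of the test function. *)
Lemma integrable_lap (psi : V -> R) : test_function psi -> m.-integrable setT (EFin \o lap s psi).
Proof.
move=> tpsi; have [L L0 hL] := test_lipschitz tpsi.
have bpsi := bmeas_test tpsi; have ipsi := test_integrable tpsi.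
have [C C0 hC] := test_L1_lipschitz tpsi.
have mk := measurable_kfar (n := n) s 1; have k0 := kfar_ge0 (n := n) s 1.
have kN := kfarN (n := n) s 1; have ki := far_massE (n := n) s_gt0 (@ltr01 R).
have dL1 := lap_dist_L1 n_gt0 s_gt0 s_lt1 bpsi L0 hL C0 (@ltr01 R) hC.
have bd := bmeasB (bmeas_lap n_gt0 s_gt0 s_lt1 bpsi L0 hL) (bmeas_lap_far s_gt0 (@ltr01 R) bpsi).
have [idiff _] := norm_Rintegral_le bd.1 dL1.
have ikp := integrableZl measurableT (far_mass (n := n) s 1) ipsi.
have ifar : m.-integrable setT (EFin \o lap_far s 1 psi).
  exact: (integrableB measurableT ikp (integrable_kconv mk k0 kN ki bpsi ipsi)).
apply: eq_integrable (integrableD measurableT ifar idiff) => // y _.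
by rewrite /= -EFinD addrC subrK.
Qed.

(** The difference of two solutions annihilates psi + beta lap psi for all test functions psi.
    Applying [pairing_le0] to rho and to -rho shows that it annihilates test functions, and their
    L^1 density carries this to the indicator of [B], which is what the energy integrates
    against. *)
Lemma solution_unique (eps : R) (E B : set V) (phi1 phi2 : V -> R) :
  0 <= eps -> borel_representative E B -> (m B < +oo)%E ->
  bounded_solution s eps E phi1 -> bounded_solution s eps E phi2 ->
  \int[leb]_(x in [set: lebRn R n]) (\1_E x * (1 - phi1 x)) =
  \int[leb]_(x in [set: lebRn R n]) (\1_E x * (1 - phi2 x)).
Proof.
move=> eps0 EB Bfin [m1 [M1 h1] w1] [m2 [M2 h2] w2].
have [_ mB _] := EB.
pose w x := phi1 x - phi2 x.
have M10 : 0 <= M1 by exact: le_trans (h1 0).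
have M20 : 0 <= M2 by exact: le_trans (h2 0).
have mw : measurable_fun setT (w : lebRn R n -> R) by exact: measurable_funB.
have M0 : 0 <= M1 + M2 by rewrite addr_ge0.
have wM x : `|w x| <= M1 + M2 by apply: le_trans (ler_normB _ _) _; exact: lerD.
have mg := @measurable_of_lebRn R n; have gmu := @integral_of_lebRn R n.
pose T := pairing leb of_lebRn w.
have TB (f : V -> R) : m.-integrable setT (EFin \o f) ->
    T f = pairing leb of_lebRn phi1 f - pairing leb of_lebRn phi2 f.
  move=> fi; have i1 := integrable_pairing mg gmu m1 M10 h1 fi.
  have i2 := integrable_pairing mg gmu m2 M20 h2 fi.
  rewrite /T /pairing -(RintegralB _ i1 i2)//.
  by apply: eq_Rintegral => x _; rewrite mulrBl.
have b0 : 0 <= eps `^ s * c by rewrite mulr_ge0 ?powR_ge0// frac_const_ge0.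
have weq psi : test_function psi -> T (fun y => psi y + (eps `^ s * c) * lap s psi y) = 0.
  move=> tpsi; rewrite TB; last first.
    exact: (integrableD measurableT (test_integrable tpsi) (integrableZl measurableT _ (integrable_lap tpsi))).
  apply/eqP; rewrite subr_eq0; apply/eqP.
  have e (phi : V -> R) : pairing leb of_lebRn phi (fun y => psi y + (eps `^ s * c) * lap s psi y) =
     \int[leb]_(x in [set: lebRn R n]) (phi x * (psi x + eps `^ s * frac_laplacian s psi x)).
    by apply: eq_Rintegral => x _; rewrite frac_laplacian_test// mulrA.
  by rewrite !e w1// w2.
have T0 rho : test_function rho -> T rho = 0.
  move=> tr; apply/eqP; rewrite eq_le (pairing_le0 mg gmu mw M0 wM n_gt0 s_gt0 s_lt1 b0 weq tr)/=.
  have tN : test_function (fun x => -1 * rho x) by exact: test_scale.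
  have := pairing_le0 mg gmu mw M0 wM n_gt0 s_gt0 s_lt1 b0 weq tN.
  by rewrite (pairingZ mg gmu mw M0 wM _ (test_integrable tr)) mulN1r oppr_le0.
have iB := integrable_indic_fin mB Bfin.
have TB0 : T \1_B = 0.
  apply/eqP; rewrite -normr_le0; apply/ler_addgt0Pr => e e0; rewrite add0r.
  have e1 : 0 < e / (M1 + M2 + 1) by rewrite divr_gt0// ltr_wpDl.
  have [rho [tr r01 hr]] := test_density mB Bfin e1.
  have ir := test_integrable tr.
  have := pairing_le mg gmu mw M0 wM (bmeasB (bmeas_indic mB) (bmeas_test tr)).1 hr.
  have -> : pairing leb of_lebRn w (fun x => \1_B x - rho x) = T \1_B.
    by rewrite (pairingB mg gmu mw M0 wM iB ir) [X in _ - X](T0 _ tr) subr0.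
  move=> h; apply: le_trans h _; rewrite mulrCA; apply: ler_piMr; first exact: ltW.
  by rewrite ler_pdivrMr ?ltr_wpDl// mul1r lerDl.
have mm (phi : lebRn R n -> R) : measurable_fun setT phi -> measurable_fun setT (fun x => 1 - phi x).
  by move=> mphi; exact: measurable_funB.
rewrite (Rintegral_representative EB (mm _ m1)) (Rintegral_representative EB (mm _ m2)).
have ip1 := integrable_pairing mg gmu m1 M10 h1 iB.
have ip2 := integrable_pairing mg gmu m2 M20 h2 iB.
have ileb := integrable_leb iB.
have e (phi : V -> R) : leb.-integrable [set: lebRn R n] (fun t => (phi t * \1_B t)%:E) ->
   \int[leb]_(x in [set: lebRn R n]) (\1_B x * (1 - phi x)) =
   \int[leb]_(x in [set: lebRn R n]) \1_B x - pairing leb of_lebRn phi \1_B.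
  move=> ip; rewrite /pairing -(RintegralB _ ileb ip)//.
  by apply: eq_Rintegral => x _; rewrite mulrBr mulr1 (mulrC (\1_B x)).
rewrite (e _ ip1) (e _ ip2); congr (_ - _); apply/eqP; rewrite -subr_eq0 -TB//.
exact/eqP.
Qed.

End solutions.

(** * Gamma-convergence *)

Section energy.
Context {R : realType} {n : nat}.
Local Notation V := 'rV[R]_n.
Local Notation m := (borel_lebesgue R n).
Variable s : R.
Hypotheses (n_gt0 : (0 < n)%N) (s_gt0 : 0 < s) (s_lt1 : s < 1).
Local Notation c := (frac_const (n := n) s).
Local Notation kc := (@knear_cst R n s).
Local Notation far_mass := (@far_mass R n s).

Lemma dist1_perimeter (B : set V) (p : R) : measurable B -> (m B < +oo)%E -> perimeter B = p%:E ->
  forall h, (dist1 \1_B h <= (p * enorm h)%:E)%E.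
Proof.
move=> mB Bfin Bp h; rewrite mulrC; apply: (perimeter_translation h mB Bfin).
by rewrite Bp.
Qed.

Lemma perimeter_real_ge0 (B : set V) (p : R) : perimeter B = p%:E -> 0 <= p.
Proof. by move=> Bp; rewrite -lee_fin -Bp; exact: perimeter_ge0. Qed.

Lemma frac_perimeter_fin (E : set V) (p : R) : L1_set E -> perimeter E = p%:E ->
  frac_perimeter s E \is a fin_num.
Proof.
move=> LE Ep; have [B [EB Bfin]] := borel_representative_exists LE; have [_ mB _] := EB.
have Bp : perimeter B = p%:E by rewrite -(perimeter_representative EB).
rewrite (frac_perimeter_representative EB).
have h := nonlocal_kern_fin n_gt0 s_gt0 s_lt1 mB Bfin (perimeter_real_ge0 Bp) (dist1_perimeter mB Bfin Bp).
by rewrite -(fineK h).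
Qed.

(** The bounds are known for the solution that [potential_exists] constructs. Its existence ensures
    that the chosen [potential] is a solution too, and uniqueness makes the two energy terms
    equal. *)
Lemma energy_estimate (eps : R) (E : set V) (p : R) : 0 < eps -> L1_set E -> perimeter E = p%:E ->
  let f := fine (frac_perimeter s E) in
  let q := \int[leb]_(x in [set: lebRn R n]) (\1_E x * (1 - potential s eps E x)) in
  q <= eps `^ s * c * f /\
  forall r, 0 < r -> eps `^ s * c * f - q <=
    eps `^ s * c * (far_mass r * (eps `^ s * c * (2 * f)) + p * (kc * r `^ (1 - s))).
Proof.
move=> eps0 LE Ep f q.
have [B [EB Bfin]] := borel_representative_exists LE; have [_ mB _] := EB.
have Bp : perimeter B = p%:E by rewrite -(perimeter_representative EB).
have p0 := perimeter_real_ge0 Bp.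
have hp := dist1_perimeter mB Bfin Bp.
have b0 : 0 <= eps `^ s * c by rewrite mulr_ge0 ?powR_ge0// frac_const_ge0.
have [phi [mphi phi01 weq hle hge]] := potential_exists n_gt0 s_gt0 s_lt1 mB Bfin p0 hp b0.
have fE : fine (nonlocal (kern s) \1_B) = 2 * f.
  rewrite /f (frac_perimeter_representative EB) fineM//; last first.
    exact: (nonlocal_kern_fin n_gt0 s_gt0 s_lt1 mB Bfin p0 hp).
  by rewrite /= mulrA divff// mul1r.
rewrite fE in hle hge.
have mphi' : measurable_fun [set: lebRn R n] (phi : lebRn R n -> R) by exact: measurable_fun_lebRn.
have bphi : bmeas phi.
  by split => //; exists 1 => x; have /andP[h0 h1] := phi01 x; rewrite ger0_norm.
have sol : bounded_solution s eps E phi.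
  apply/(bounded_solution_representative EB); split => //; first by case: bphi.
  move=> psi tpsi; have [L L0 hL] := test_lipschitz tpsi.
  have bpsi := bmeas_test tpsi; have bl := bmeas_lap n_gt0 s_gt0 s_lt1 bpsi L0 hL.
  have mB1 : measurable_fun [set: V] (\1_B : V -> R) by exact: measurable_indic.
  rewrite (Rintegral_leb (measurable_funM mB1 bpsi.1)) -(weq _ L bpsi (test_integrable tpsi) L0 hL).
  rewrite -(Rintegral_leb (measurable_funM mphi (measurable_funD bpsi.1 (measurable_funM (measurable_cst _) bl.1)))).
  by apply: eq_Rintegral => x _; rewrite frac_laplacian_test// mulrA.
have qE : q = \int[m]_x (\1_B x * (1 - phi x)).
  rewrite /q (solution_unique n_gt0 s_gt0 s_lt1 (ltW eps0) EB Bfin (phi2 := phi) _ sol); last exact: getI sol.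
  have m1 : measurable_fun [set: V] (fun x => 1 - phi x) by exact: measurable_funB.
  rewrite (Rintegral_representative EB (measurable_fun_lebRn m1)).
  by apply: Rintegral_leb; apply: measurable_funM => //; exact: measurable_indic.
rewrite qE; split.
  by apply: le_trans hle _; rewrite (mulrC 2) mulfK.
by move=> r r0; apply: le_trans (hge r r0); rewrite (mulrC 2) mulfK.
Qed.

End energy.

(** * Lower semicontinuity of the perimeter minus a multiple of the nonlocal energy *)

Section lower_semicontinuity.
Context {R : realType} {n : nat}.
Local Notation V := 'rV[R]_n.
Local Notation m := (borel_lebesgue R n).
Variable s : R.
Hypotheses (n_gt0 : (0 < n)%N) (s_gt0 : 0 < s) (s_lt1 : s < 1).
Local Notation kc := (@knear_cst R n s).
Local Notation far_mass := (@far_mass R n s).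

(** The far energy has an integrable kernel and is therefore L^1-Lipschitz, with factor 2 from
    [dist1_indic_le]; the near energy of [C] is paid for by its perimeter alone. *)
Lemma nonlocal_kern_le (B C : set V) (p r d : R) : measurable B -> (m B < +oo)%E ->
  measurable C -> (m C < +oo)%E -> perimeter C = p%:E -> 0 < r -> 0 <= d ->
  (\int[m]_x `|\1_C x - \1_B x|%:E <= d%:E)%E ->
  fine (nonlocal (kern s) \1_C) <=
    fine (nonlocal (kfar s r) \1_B) + 2 * far_mass r * d + p * (kc * r `^ (1 - s)).
Proof.
move=> mB Bfin mC Cfin Cp r0 d0 hd.
have p0 := perimeter_real_ge0 Cp; have hp := dist1_perimeter mC Cfin Cp.
have fC := nonlocal_kern_fin n_gt0 s_gt0 s_lt1 mC Cfin p0 hp.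
have ki := far_massE (n := n) s_gt0 r0.
have bB := bmeas_indic mB; have bC := bmeas_indic mC.
rewrite -lee_fin fineK// (nonlocal_split s mC r0) EFinD; apply: leeD; last first.
  exact: (nonlocal_knear_le n_gt0 s_gt0 s_lt1 bC.1 p0 r0 hp).
rewrite EFinD fineK; last by rewrite (nonlocal_kfarE s_gt0 mB Bfin r0).
apply: le_trans (nonlocal_le_cst (measurable_kfar s r) (kfar_ge0 s r) (kfarN s r) bC.1 bB.1 (C := (2 * d)%:E) _ _) _.
- by rewrite lee_fin mulr_ge0.
- move=> h; apply: le_trans (dist1_indic_le h mC mB) _.
  by rewrite leeD2l// EFinM lee_wpmul2l.
by rewrite leeD2l// ki -EFinM lee_fin mulrCA mulrA.
Qed.

Lemma perturbed_perimeter_lsc (lam b : R) (B : set V) : 0 <= lam -> measurable B -> (m B < +oo)%E ->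
  (perimeter B = +oo%E \/ exists2 p : R, perimeter B = p%:E & b < p - lam * fine (nonlocal (kern s) \1_B)) ->
  exists2 d : R, 0 < d & forall (C : set V) (p : R), measurable C -> (m C < +oo)%E ->
    (\int[m]_x `|\1_C x - \1_B x|%:E <= d%:E)%E -> perimeter C = p%:E ->
    b <= p - lam * fine (nonlocal (kern s) \1_C).
Proof.
move=> lam0 mB Bfin hB.
have kc0 := knear_cst_ge0 n_gt0 s_gt0 s_lt1.
have lk0 : 0 <= lam * kc by rewrite mulr_ge0.
(* Once [lam * (kc * r ^ (1 - s))] is at most 1, the functional at [C] is at least a nonnegative
   multiple of the perimeter of [C] minus far terms that depend only on [B], [r] and [d]; so a lower
   bound [b'] on the perimeter is enough. *)
have main r b' d : 0 < r -> 0 <= d -> lam * (kc * r `^ (1 - s)) <= 1 ->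
    b + lam * (fine (nonlocal (kfar s r) \1_B) + 2 * far_mass r * d) <= (1 - lam * (kc * r `^ (1 - s))) * b' ->
    forall (C : set V) (p : R), measurable C -> (m C < +oo)%E ->
    (\int[m]_x `|\1_C x - \1_B x|%:E <= d%:E)%E -> perimeter C = p%:E -> b' <= p ->
    b <= p - lam * fine (nonlocal (kern s) \1_C).
  move=> r0 d0 hr hb C p mC Cfin hd Cp bp.
  have h := nonlocal_kern_le mB Bfin mC Cfin Cp r0 d0 hd.
  have h1 := ler_wpM2l lam0 h.
  have h2 : (1 - lam * (kc * r `^ (1 - s))) * b' <= (1 - lam * (kc * r `^ (1 - s))) * p.
    by apply: ler_wpM2l => //; rewrite subr_ge0.
  move: h1 (le_trans hb h2); rewrite mulrDr mulrBl mul1r (mulrCA lam p) (mulrC p).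
  move: (lam * fine _) (lam * (_ + _)) (lam * _ * p) => x y z; clear -n_gt0 s_gt0 s_lt1; lra.
set far := fun r => fine (nonlocal (kfar s r) \1_B) in main.
have far0 r : 0 <= far r.
  apply: fine_ge0; apply: integral_ge0 => x _; apply: integral_ge0 => y _.
  by rewrite lee_fin mulr_ge0// kfar_ge0.
have fm0 r : 0 <= far_mass r by exact: far_mass_ge0.
case: hB => [Binf|[p Bp hb]].
  have half : 0 < 2^-1 :> R by rewrite invr_gt0.
  have [r r0] := powR_small s_lt1 lk0 half; rewrite -mulrA => hr.
  (* The radius keeps at least half of the perimeter, so twice the required amount suffices; the far
     error is counted with distance 1. *)
  pose b' := 2 * (`|b| + lam * (far r + 2 * far_mass r * 1)).
  have b'0 : 0 <= b'.
    by rewrite mulr_ge0// addr_ge0// mulr_ge0// addr_ge0// mulr1 mulr_ge0.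
  have [d d0 hd] := perimeter_lsc (b := b') mB Bfin (eq_ind_r (fun z => (b'%:E < z)%E) (ltry _) Binf).
  exists (Num.min 1 d); first by rewrite lt_min ltr01.
  move=> C p mC Cfin dC Cp.
  have r1 : lam * (kc * r `^ (1 - s)) <= 1 by lra.
  apply: (main r b' 1 r0 ler01 r1 _ C p mC Cfin) => //.
  - have h1 : b <= `|b| by exact: ler_norm.
    have h2 : b' * 2^-1 <= b' * (1 - lam * (kc * r `^ (1 - s))) by apply: ler_wpM2l => //; lra.
    rewrite [leRHS]mulrC; apply: le_trans h2.
    have -> : b' * 2^-1 = `|b| + lam * (far r + 2 * far_mass r * 1) by rewrite /b' mulrC mulKf.
    by rewrite lerD2r.
  - by apply: le_trans dC _; rewrite lee_fin ge_min lexx.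
  - rewrite -lee_fin -Cp; apply: hd => //; apply: le_trans dC _.
    by rewrite lee_fin ge_min lexx orbT.
have p0 := perimeter_real_ge0 Bp; have hp := dist1_perimeter mB Bfin Bp.
have fB := nonlocal_kern_fin n_gt0 s_gt0 s_lt1 mB Bfin p0 hp.
set J := fine _ in hb.
(* The gap to be spent: one quarter each for the drop of the perimeter, for the near energy X p, and
   for the change of the far energy; one quarter is left over. *)
pose g := p - lam * J - b.
have g0 : 0 < g by rewrite /g; lra.
have farJ r : 0 < r -> far r <= J.
  move=> r0; rewrite /far /J -lee_fin fineK ?(nonlocal_kfarE s_gt0 mB Bfin r0)// fineK//.
  rewrite (nonlocal_split s mB r0) (nonlocal_kfarE s_gt0 mB Bfin r0) leeDl//.
  apply: integral_ge0 => x _; apply: integral_ge0 => y _.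
  by rewrite lee_fin mulr_ge0// knear_ge0.
have D0 : 0 < 4 * (p + 1) + 2 * g by lra.
have e0 : 0 < g / (4 * (p + 1) + 2 * g) by rewrite divr_gt0.
(* The denominator is large enough to give both X p <= g/4 and X <= 1. *)
have [r r0] := powR_small s_lt1 lk0 e0; rewrite -mulrA; set X := lam * (kc * _) => hr.
have X0 : 0 <= X by rewrite /X mulrA mulr_ge0// powR_ge0.
have hX : X * (4 * (p + 1) + 2 * g) <= g by rewrite -ler_pdivlMr.
have Xp : X * p <= g / 4.
  have : 0 <= X * g by rewrite mulr_ge0// ltW.
  by move: hX; rewrite !mulrDr !mulr1; lra.
have X1 : X <= 1.
  by apply: le_trans hr _; rewrite ler_pdivrMr// mul1r; lra.
have bp : ((p - g / 4)%:E < perimeter B)%E by rewrite Bp lte_fin; lra.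
have [d d0 hd] := perimeter_lsc mB Bfin bp.
have lf0 : 0 <= lam * far_mass r by rewrite mulr_ge0.
have D1 : 0 < 8 * (lam * far_mass r + 1) by lra.
pose d1 := g / (8 * (lam * far_mass r + 1)).
have d10 : 0 < d1 by rewrite divr_gt0.
have hd1 : lam * (2 * far_mass r * d1) <= g / 4.
  have e1 : d1 * (8 * (lam * far_mass r + 1)) = g by rewrite /d1 divfK// gt_eqF.
  have : lam * (2 * far_mass r * d1) = 2 * (lam * far_mass r * d1) by ring.
  move: e1; clear -n_gt0 s_gt0 s_lt1 d10; lra.
exists (Num.min d1 d); first by rewrite lt_min d10.
move=> C q mC Cfin dC Cq.
apply: (main r (p - g / 4) d1 r0 (ltW d10) X1 _ C q mC Cfin) => //.
- rewrite -/X (_ : (1 - X) * _ = p - g / 4 - X * p + X * (g / 4)); last by ring.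
  rewrite (mulrDr lam); have h1 := ler_wpM2l lam0 (farJ r r0).
  have h2 : 0 <= X * (g / 4) by rewrite mulr_ge0// divr_ge0// ltW.
  apply: (@le_trans _ _ (b + (lam * J + g / 4))); first by rewrite lerD2l lerD.
  rewrite (_ : lam * J = p - b - g); last by rewrite /g; ring.
  clear -g0 Xp h2 n_gt0 s_gt0 s_lt1; lra.
- by apply: le_trans dC _; rewrite lee_fin ge_min lexx.
- rewrite -lee_fin -Cq; apply: hd => //; apply: le_trans dC _.
  by rewrite lee_fin ge_min lexx orbT.
Qed.

End lower_semicontinuity.

Section limits.
Context {R : realType}.
Implicit Types (f : R -> \bar R) (F : set (set R)) (A : set R) (b x y : \bar R).

Lemma limf_esup_le f F A b : F A -> (forall t, A t -> (f t <= b)%E) -> (limf_esup f F <= b)%E.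
Proof.
move=> FA h; apply: (@le_trans _ _ (ereal_sup (f @` A))).
  by apply: ereal_inf_lbound; exists A.
by apply: ge_ereal_sup => _ [t At <-]; exact: h.
Qed.

Lemma le_limf_einf f F A b : F A -> (forall t, A t -> (b <= f t)%E) -> (b <= limf_einf f F)%E.
Proof.
move=> FA h; rewrite /limf_einf leeNr; apply: (limf_esup_le FA) => t At.
by rewrite leeN2; exact: h.
Qed.

Lemma lee_of_lt_real x y : (forall b : R, (b%:E < x)%E -> (b%:E <= y)%E) -> (x <= y)%E.
Proof.
case: x => [r h| h|_]; last exact: leNye.
  apply/lee_subgt0Pr => e e0; rewrite -EFinB; apply: h.
  by rewrite lte_fin ltrBlDr ltrDl.
case: y h => [r h| |h]; [|by []|].
  by have := h (r + 1) (ltry _); rewrite lee_fin gerDl ler10.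
by have := h 0 (ltry _).
Qed.

End limits.

Section gamma.
Context {R : realType} {n : nat}.
Local Notation V := 'rV[R]_n.
Local Notation m := (borel_lebesgue R n).
Variables (s t : R).
Hypotheses (n_gt0 : (0 < n)%N) (s_gt0 : 0 < s) (s_lt1 : s < 1) (t_gt0 : 0 < t).
Local Notation c := (frac_const (n := n) s).

Let tc0 : 0 <= t * c. Proof. by apply: mulr_ge0; [exact: ltW|exact: frac_const_ge0]. Qed.

Lemma perimeter_fin (E : set V) : perimeter E != +oo%E -> perimeter E = (fine (perimeter E))%:E.
Proof. by move=> h; rewrite fineK// ge0_fin_numE ?perimeter_ge0// lt_neqAle h leey. Qed.

Lemma limit_energyE (E : set V) (p : R) : L1_set E -> perimeter E = p%:E ->
  limit_energy s t E = (p - t * c * fine (frac_perimeter s E))%:E.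
Proof.
move=> LE Ep; rewrite /limit_energy Ep (_ : (p%:E == +oo%E) = false)// EFinB (EFinM (t * c)) fineK//.
exact: (frac_perimeter_fin n_gt0 s_gt0 s_lt1 LE Ep).
Qed.

Lemma energyE (eps : R) (E : set V) (p : R) : perimeter E = p%:E ->
  energy s t eps E = (p - t * eps `^ (- s) *
    \int[leb]_(x in [set: lebRn R n]) (\1_E x * (1 - potential s eps E x)))%:E.
Proof. by move=> Ep; rewrite /energy Ep. Qed.

Lemma limit_energy_le (eps : R) (E : set V) : 0 < eps -> L1_set E ->
  (limit_energy s t E <= energy s t eps E)%E.
Proof.
move=> eps0 LE; have [Einf|/perimeter_fin Ep] := eqVneq (perimeter E) +oo%E.
  by rewrite /limit_energy /energy Einf eqxx.
rewrite (limit_energyE LE Ep) (energyE eps Ep) lee_fin lerB//.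
have [h _] := energy_estimate n_gt0 s_gt0 s_lt1 eps0 LE Ep.
have a0 : 0 < eps `^ s by rewrite powR_gt0.
rewrite powRN -!(mulrA t) ler_pM2l// -(ler_pM2l a0) mulVKf ?gt_eqF//.
by rewrite mulrA.
Qed.

(** Multiplying the energy estimate by t eps^(-s) leaves a near term independent of eps and a far
    term proportional to eps^s. First [r] makes the near term at most e/2; then, with [r] fixed,
    small eps does the same for the far one. *)
Lemma energy_le_near (E : set V) (p e : R) : L1_set E -> perimeter E = p%:E -> 0 < e ->
  \forall eps \near 0^'+, (energy s t eps E <= limit_energy s t E + e%:E)%E.
Proof.
move=> LE Ep e0; rewrite (limit_energyE LE Ep).
have p0 := perimeter_real_ge0 Ep.
set f := fine _.
have f0 : 0 <= f.
  apply: fine_ge0; apply: mule_ge0; first by rewrite lee_fin invr_ge0.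
  apply: integral_ge0 => x _; apply: integral_ge0 => y _.
  by rewrite lee_fin divr_ge0// powR_ge0.
have kc0 := knear_cst_ge0 n_gt0 s_gt0 s_lt1.
have D0 : 0 <= t * c * p * knear_cst (n := n) s by apply: mulr_ge0 => //; exact: mulr_ge0.
have e2 : 0 < e / 2 by rewrite divr_gt0.
have [r r0 hr] := powR_small s_lt1 D0 e2.
(* The coefficient of eps^s in the far term; it may blow up as [r] tends to 0. *)
pose K := t * c * far_mass (n := n) s r * (c * (2 * f)).
have K0 : 0 <= K.
  apply: mulr_ge0; first by apply: mulr_ge0 => //; exact: far_mass_ge0.
  by apply: mulr_ge0; [exact: frac_const_ge0|exact: mulr_ge0].
have hK : 0 < e / 2 / (K + 1) by rewrite divr_gt0// ltr_wpDl.
have /cvgrPdist_lt/(_ _ hK) := powR_cvg0 s_gt0.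
apply: filterS2 (nbhs_right_gt 0) => eps eps0.
rewrite sub0r normrN ger0_norm ?powR_ge0// => ha.
rewrite (energyE eps Ep) -EFinD lee_fin.
have [_ /(_ r r0)] := energy_estimate n_gt0 s_gt0 s_lt1 eps0 LE Ep.
rewrite -/f; set q := \int[leb]_(x in _) _ => h.
have a0 : 0 < eps `^ s by rewrite powR_gt0.
have h1 : t * (c * f) - t * eps `^ (- s) * q <=
    t * c * (far_mass (n := n) s r * (eps `^ s * c * (2 * f)) + p * (knear_cst (n := n) s * r `^ (1 - s))).
  rewrite -mulrA -mulrBr -[leRHS]mulrA ler_pM2l// powRN -(ler_pM2l a0).
  by rewrite mulrBr mulVKf ?gt_eqF// (mulrA _ c f) (mulrA _ c (_ + _)).
have h2 : K * eps `^ s <= e / 2.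
  apply: (@le_trans _ _ (K * (e / 2 / (K + 1)))); first by rewrite ler_wpM2l// ltW.
  have K1 : 0 < K + 1 by rewrite ltr_wpDl.
  by rewrite mulrA ler_pdivrMr// mulrC ler_pM2l// lerDl.
have h3 : t * c * (far_mass (n := n) s r * (eps `^ s * c * (2 * f)) + p * (knear_cst (n := n) s * r `^ (1 - s))) =
   K * eps `^ s + t * c * p * knear_cst (n := n) s * r `^ (1 - s).
  by rewrite /K; ring.
rewrite h3 in h1; clear h h3 ha hK; lra.
Qed.

Lemma L1_dist_near (F : R -> set V) (E B : set V) (d : R) : L1_cvg F E -> borel_representative E B -> 0 < d ->
  \forall eps \near 0^'+, 0 < eps /\ forall C, borel_representative (F eps) C ->
    (\int[m]_x `|\1_C x - \1_B x|%:E <= d%:E)%E.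
Proof.
move=> [LF LE cF] EB d0.
have nd : nbhs (0 : \bar R)%E (fun x : \bar R => (x < d%:E)%E).
  by apply: open_nbhs_nbhs; split; [exact: open_ereal_lt_ereal|rewrite /= lte_fin].
have := cF _ nd; apply: filterS2 (nbhs_right_gt 0) => eps eps0 /= h.
split => // C FC; rewrite -(dist_representative FC EB); exact: ltW.
Qed.

(** The bound [limit_energy_le] removes the potential altogether, so that only the limit functional
    along the family remains. Members of infinite perimeter have energy +oo and need no estimate. *)
Lemma gamma_liminf (F : R -> set V) (E : set V) : L1_cvg F E ->
  (limit_energy s t E <= limf_einf (fun eps => energy s t eps (F eps)) 0^'+)%E.
Proof.
move=> FE; have [LF LE _] := FE.
have [B [EB Bfin]] := borel_representative_exists LE; have [_ mB _] := EB.
apply: lee_of_lt_real => b hb.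
(* Halved because [nonlocal (kern s)] is twice the fractional perimeter. *)
pose lam := t * c / 2.
have lam0 : 0 <= lam by rewrite divr_ge0.
(* This covers infinite values as well, since [fine] sends them to 0 on both sides. *)
have fracE (A C : set V) : borel_representative A C ->
    t * c * fine (frac_perimeter s A) = lam * fine (nonlocal (kern s) \1_C).
  move=> hAC; rewrite (frac_perimeter_representative hAC) /lam.
  by case: (nonlocal _ _) => [z| |];
    rewrite ?gt0_muley ?gt0_muleNy ?lte_fin ?invr_gt0//= ?mulr0// mulrA.
have hB : perimeter B = +oo%E \/ exists2 p : R, perimeter B = p%:E & b < p - lam * fine (nonlocal (kern s) \1_B).
  rewrite -(perimeter_representative EB).
  have [Einf|/perimeter_fin Ep] := eqVneq (perimeter E) +oo%E; first by left.
  right; exists (fine (perimeter E)) => //.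
  by move: hb; rewrite (limit_energyE LE Ep) lte_fin (fracE _ _ EB).
have [d d0 hd] := perturbed_perimeter_lsc n_gt0 s_gt0 s_lt1 lam0 mB Bfin hB.
apply: (le_limf_einf (L1_dist_near FE EB d0)) => eps [eps0 hC].
have LFe := LF _ eps0.
have [Finf|/perimeter_fin Fp] := eqVneq (perimeter (F eps)) +oo%E.
  by rewrite /energy Finf eqxx leey.
apply: le_trans (limit_energy_le eps0 LFe).
have [C [FC Cfin]] := borel_representative_exists LFe; have [_ mC _] := FC.
rewrite (limit_energyE LFe Fp) lee_fin (fracE _ _ FC).
apply: hd => //; first exact: hC.
by rewrite -(perimeter_representative FC).
Qed.

Lemma gamma_limsup (E : set V) : L1_set E -> exists F : R -> set V, L1_cvg F E /\
  (limf_esup (fun eps => energy s t eps (F eps)) 0^'+ <= limit_energy s t E)%E.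
Proof.
move=> LE; exists (fun=> E); split.
  split => //; apply: cvg_near_cst; apply: nearW => eps.
  rewrite (eq_integral (cst 0%E)) ?integral0// => x _.
  by rewrite subrr normr0.
have [Einf|/perimeter_fin Ep] := eqVneq (perimeter E) +oo%E.
  by rewrite /limit_energy Einf eqxx leey.
apply/lee_addgt0Pr => e e0.
exact: (limf_esup_le (energy_le_near LE Ep e0)).
Qed.

End gamma.

Theorem theorem2p6 (R : realType) (n : nat) (s t : R)
  (n_gt0 : (0 < n)%N) (s_gt0 : 0 < s) (s_lt1 : s < 1) (t_gt0 : 0 < t) :
  Gamma_converges (fun eps E => @energy R n s t eps E)
                  (fun E => @limit_energy R n s t E).
Proof.
split; first by move=> F E; exact: gamma_liminf.
by move=> E; exact: gamma_limsup.
Qed.
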